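(* Let $\varphi^t:HM\to HM$ be the geodesic flow of the Hilbert metric on a compact strictly convex projective manifold $M=\Omega/\Gamma$ and let $h_{top}$ denote its topological entropy. Then $$h_{top}=h_{vol}(\Omega,d_\Omega).$$
   Context: A compact strictly convex projective manifold is a compact quotient manifold $M=\Omega/\Gamma$, with $\Omega\subset\mathbb{P}^n(\mathbb{R})$, $n\ge2$, a strictly convex open set which is bounded in some affine chart, and $\Gamma\subset PGL(n+1,\mathbb{R})$ preserving $\Omega$ (acting freely and properly discontinuously). The Hilbert metric on $\Omega$ is, in an affine chart where $\Omega$ is bounded, $d_\Omega(x,y)=\frac12|\log([a,b,x,y])|$ with $a,b$ the intersection points of the line $(xy)$ with $\partial\Omega$ and $[a,b,x,y]=\frac{ax/bx}{ay/by}$ the cross-ratio (Euclidean lengths). It is $\Gamma$-invariant and descends to $M$. $HM=(TM\setminus\{0\})/\mathbb{R}^*_+$, and the geodesic flow $\varphi^t$ moves $(x,[\xi])$ along the straight line directed by $\xi$ at unit speed for the Hilbert metric. For a flow on a compact metric space $(W,d)$, let $d_t(x,y)=\max_{0\le s\le t}d(\varphi^s(x),\varphi^s(y))$ and $N(\varphi,t,\epsilon)$ the minimal number of open sets of $d_t$-diameter less than $\epsilon$ covering $W$; $h_{top}(\varphi)=\lim_{\epsilon\to0}\limsup_{t\to\infty}\frac1t\log N(\varphi,t,\epsilon)$. The volume entropy is $h_{vol}(\Omega,d_\Omega)=\lim_{r\to\infty}\frac1r\log vol(B(x,r))$ (provided the limit exists), where $B(x,r)$ is the $d_\Omega$-ball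 of radius $r$ about $x\in\Omega$ and $vol$ is the ($n$-dimensional) Hausdorff measure of $(\Omega,d_\Omega)$. *)

(* Defs.v *)
From HB Require Import structures.
From Stdlib Require Import Relation_Operators.
From mathcomp Require Import all_boot all_order all_algebra.
From mathcomp Require Import all_classical all_reals all_analysis.
Set Implicit Arguments.
Unset Strict Implicit.
Unset Printing Implicit Defensive.
Import Order.TTheory GRing.Theory Num.Theory.
Import numFieldNormedType.Exports.
Local Open Scope classical_set_scope.
Local Open Scope ring_scope.
Local Open Scope quotient_scope.

Definition gen_eq (T : Type) (r : T -> T -> Prop) : rel T :=
  fun x y => `[< clos_refl_sym_trans T r x y >].

Lemma gen_eq_equiv (T : Type) (r : T -> T -> Prop) :
  equiv_class_of (gen_eq r).
Proof.
split.
- by move=> x; apply/asboolP; exact: rst_refl.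
- by move=> x y; apply/idP/idP => /asboolP h; apply/asboolP; exact: rst_sym.
- by move=> y x z /asboolP h /asboolP k; apply/asboolP; exact: rst_trans h k.
Qed.

Definition gen_equiv (T : Type) (r : T -> T -> Prop) : equiv_rel T :=
  EquivRelPack (gen_eq_equiv r).

(* Quotient by the equivalence relation generated by [r], with the quotient
   topology.  When [r] is the orbit relation of a group action it is already an
   equivalence relation, and this is the orbit space; generating the relation
   makes the quotient available without hypotheses on [r]. *)
Definition quotient_space (T : topologicalType) (r : T -> T -> Prop) :=
  quotient_topology {eq_quot gen_equiv r}.

Notation proj_space R n := {L : {vspace 'rV[R]_(1 + n)} | \dim L == 1%N}.

Lemma proj_base_subproof (R : realType) (n : nat) :
  \dim <[(delta_mx 0 (lshift n 0) : 'rV[R]_(1 + n))%R]>%VS == 1%N.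
Proof.
rewrite dim_vline eqb1; apply/eqP => /matrixP/(_ 0 (lshift n 0)).
by rewrite !mxE !eqxx; apply/eqP/oner_neq0.
Qed.

(* The point of P^n with homogeneous coordinates [v]; junk if [v = 0]. *)
Definition proj_pt (R : realType) (n : nat) (v : 'rV[R]_(1 + n)) : proj_space R n :=
  insubd (exist (fun L : {vspace 'rV[R]_(1 + n)} => \dim L == 1%N)
            _ (proj_base_subproof R n)) <[v]>%VS.

(* PGL(n+1, R) acts faithfully on P^n, so it is given here as the group of
   transformations of P^n induced by invertible matrices. *)
Definition PGL (R : realType) (n : nat) :
    set (proj_space R n -> proj_space R n) :=
  [set g | exists2 B, B \in unitmx &
           forall v, v != 0 -> g (proj_pt v) = proj_pt (v *m B)].

Definition subgroup_of_maps (T : Type) (G : set (T -> T)) :=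
  [/\ G id, (forall g h, G g -> G h -> G (g \o h)) &
      forall g, G g -> exists2 h, G h & (cancel g h /\ cancel h g)].

(* The affine chart attached to an invertible matrix [A] has as domain the
   complement of the hyperplane (v A)_0 = 0, and sends [v] to
   ((v A)_1 / (v A)_0, ..., (v A)_n / (v A)_0); [of_chart] is its inverse. *)
Definition to_chart (R : realType) (n : nat) (A : 'M[R]_(1 + n))
    (p : proj_space R n) : 'rV[R]_n :=
  let u := vpick (val p) *m A in (lsubmx u 0 0)^-1 *: rsubmx u.

Definition of_chart (R : realType) (n : nat) (A : 'M[R]_(1 + n))
    (x : 'rV[R]_n) : proj_space R n :=
  proj_pt (row_mx 1%:M x *m invmx A).

Definition in_chart (R : realType) (n : nat) (A : 'M[R]_(1 + n))
    (Omega : set (proj_space R n)) : set 'rV[R]_n :=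
  of_chart A @^-1` Omega.

Definition map_in_chart (R : realType) (n : nat) (A : 'M[R]_(1 + n))
    (g : proj_space R n -> proj_space R n) : 'rV[R]_n -> 'rV[R]_n :=
  to_chart A \o g \o of_chart A.

Definition boundary (T : topologicalType) (D : set T) : set T :=
  closure D `\` interior D.

(* Strict convexity: the open segment between two distinct points of the
   closure lies in the interior (so in [D], which is open); in particular [D]
   is convex. *)
Definition strictly_convex (R : realType) (n : nat) (D : set 'rV[R]_n) :=
  forall x y, closure D x -> closure D y -> x != y ->
  forall t : R, 0 < t < 1 -> interior D ((1 - t) *: x + t *: y).

Record strictly_convex_domain (R : realType) (n : nat) (A : 'M[R]_(1 + n))
    (Omega : set (proj_space R n)) : Prop := {
  chart_unit : A \in unitmx ;
  domain_sub_chart : Omega `<=` range (of_chart A) ;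
  domain_nonempty : Omega !=set0 ;
  domain_open : open (in_chart A Omega) ;
  domain_bounded : bounded_set (in_chart A Omega) ;
  domain_strictly_convex : strictly_convex (in_chart A Omega) }.

(* M = Omega / Gamma; the points of Omega are represented by their affine
   coordinates in the chart [A]. *)
Definition manifold (R : realType) (n : nat) (A : 'M[R]_(1 + n))
    (Omega : set (proj_space R n))
    (Gamma : set (proj_space R n -> proj_space R n)) :=
  @quotient_space (set_type (in_chart A Omega))
    (fun x y => exists2 g, Gamma g & val y = map_in_chart A g (val x)).

HB.instance Definition _ (R : realType) (n : nat) (A : 'M[R]_(1 + n))
    (Omega : set (proj_space R n))
    (Gamma : set (proj_space R n -> proj_space R n)) :=
  Topological.on (manifold A Omega Gamma).
HB.instance Definition _ (R : realType) (n : nat) (A : 'M[R]_(1 + n))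
    (Omega : set (proj_space R n))
    (Gamma : set (proj_space R n -> proj_space R n)) :=
  Quotient.on (manifold A Omega Gamma).

Record compact_strictly_convex_projective_manifold (R : realType) (n : nat)
    (A : 'M[R]_(1 + n)) (Omega : set (proj_space R n))
    (Gamma : set (proj_space R n -> proj_space R n)) : Prop := {
  manifold_domain : strictly_convex_domain A Omega ;
  group_sub_PGL : Gamma `<=` @PGL R n ;
  group_subgroup : subgroup_of_maps Gamma ;
  group_preserves : forall g, Gamma g -> g @` Omega = Omega ;
  group_free : forall g p, Gamma g -> Omega p -> g p = p -> g = id ;
  group_properly_discontinuous : forall K : set 'rV[R]_n,
    compact K -> K `<=` in_chart A Omega ->
    finite_set [set g | Gamma g /\ (map_in_chart A g @` K) `&` K !=set0] ;
  manifold_compact : compact [set: manifold A Omega Gamma] }.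

Definition euclidean_length (R : realType) (n : nat) (v : 'rV[R]_n) : R :=
  Num.sqrt (\sum_i v 0 i ^+ 2).

Definition cross_ratio (R : realType) (n : nat) (a b x y : 'rV[R]_n) : R :=
  (euclidean_length (x - a) / euclidean_length (x - b)) /
  (euclidean_length (y - a) / euclidean_length (y - b)).

Definition line (R : realType) (n : nat) (x y : 'rV[R]_n) : set 'rV[R]_n :=
  [set x + t *: (y - x) | t in [set: R]].

(* For [x != y] in a bounded open convex set [D] there are exactly two
   intersection points; their order does not matter, because of the absolute
   value in [hilbert_dist]. *)
Definition line_ends (R : realType) (n : nat) (D : set 'rV[R]_n)
    (x y : 'rV[R]_n) : 'rV[R]_n * 'rV[R]_n :=
  xget (x, y) [set ab | ab.1 != ab.2 /\
                        line x y `&` boundary D = [set ab.1; ab.2]].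

Definition hilbert_dist (R : realType) (n : nat) (D : set 'rV[R]_n)
    (x y : 'rV[R]_n) : R :=
  if x == y then 0 else
  let ab := line_ends D x y in 2^-1 * `|ln (cross_ratio ab.1 ab.2 x y)|.

Definition slit_tangent (R : realType) (n : nat) (D : set 'rV[R]_n) :
    set ('rV[R]_n * 'rV[R]_n) :=
  [set w | D w.1 /\ w.2 != 0].

(* HM = (TM \ {0}) / R^*_+ with TM = TOmega / Gamma: the group acts on tangent
   vectors by differentials. *)
Definition HM (R : realType) (n : nat) (A : 'M[R]_(1 + n))
    (Omega : set (proj_space R n))
    (Gamma : set (proj_space R n -> proj_space R n)) :=
  @quotient_space (set_type (slit_tangent (in_chart A Omega)))
    (fun w w' => exists g, exists c : R,
      [/\ Gamma g, 0 < c,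
          (val w').1 = map_in_chart A g (val w).1 &
          (val w').2 = c *: 'd (map_in_chart A g) ((val w).1) (val w).2]).

HB.instance Definition _ (R : realType) (n : nat) (A : 'M[R]_(1 + n))
    (Omega : set (proj_space R n))
    (Gamma : set (proj_space R n -> proj_space R n)) :=
  Topological.on (HM A Omega Gamma).
HB.instance Definition _ (R : realType) (n : nat) (A : 'M[R]_(1 + n))
    (Omega : set (proj_space R n))
    (Gamma : set (proj_space R n -> proj_space R n)) :=
  Quotient.on (HM A Omega Gamma).

(* The vector [xi], based at the point of the line x + R xi at Hilbert distance
   |t| from [x], on the side of the sign of [t]. *)
Definition slit_flow (R : realType) (n : nat) (D : set 'rV[R]_n) (t : R)
    (w : set_type (slit_tangent D)) : set_type (slit_tangent D) :=
  xget w [set w' | exists s : R,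
    [/\ val w' = ((val w).1 + s *: (val w).2, (val w).2), 0 <= s * t &
        hilbert_dist D (val w).1 (val w').1 = `|t|]].

Definition geodesic_flow (R : realType) (n : nat) (A : 'M[R]_(1 + n))
    (Omega : set (proj_space R n))
    (Gamma : set (proj_space R n -> proj_space R n))
    (t : R) (q : HM A Omega Gamma) : HM A Omega Gamma :=
  \pi_(HM A Omega Gamma) (slit_flow t (repr q)).

Record metrizes (R : realType) (W : topologicalType) (d : W -> W -> R) : Prop := {
  metric_eq0 : forall x y, d x y = 0 <-> x = y ;
  metric_symm : forall x y, d x y = d y x ;
  metric_triang : forall x y z, d x z <= d x y + d y z ;
  metric_nbhs : forall x (U : set W), nbhs x U <->
    exists2 e : R, 0 < e & [set y | d x y < e] `<=` U }.

Definition diameter (R : realType) (T : Type) (d : T -> T -> \bar R)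
    (U : set T) : \bar R :=
  maxe 0%E (ereal_sup [set d xy.1 xy.2 | xy in U `*` U]).

Definition dynamical_dist (R : realType) (W : Type) (d : W -> W -> R)
    (phi : R -> W -> W) (t : R) (x y : W) : \bar R :=
  ereal_sup [set (d (phi s x) (phi s y))%:E | s in `[0, t]].

Definition covering_number (R : realType) (W : topologicalType)
    (d : W -> W -> R) (phi : R -> W -> W) (t eps : R) : \bar R :=
  ereal_inf [set k%:R%:E | k in [set k : nat | exists U : 'I_k -> set W,
    (forall i, open (U i) /\
               (diameter (dynamical_dist d phi t) (U i) < eps%:E)%E) /\
    \bigcup_i U i = [set: W]]].

Definition topological_entropy (R : realType) (W : topologicalType)
    (d : W -> W -> R) (phi : R -> W -> W) : \bar R :=
  lim (limf_esup (fun t : R => t^-1%:E * lne (covering_number d phi t eps))%E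
         (pinfty_nbhs R) @[eps --> 0^'+]).

(* k-dimensional Hausdorff measure of a subset [S] of the metric space (D, d),
   without normalizing constant. *)
Definition hausdorff_measure (R : realType) (T : Type) (D : set T)
    (d : T -> T -> R) (k : nat) (S : set T) : \bar R :=
  let diam := diameter (fun x y => (d x y)%:E) in
  ereal_sup [set
    ereal_inf [set (\sum_(0 <= i <oo) diam (U i) ^+ k)%E | U in
      [set U : nat -> set T |
        (forall i, U i `<=` D /\ (diam (U i) <= delta%:E)%E) /\
        S `<=` \bigcup_i U i]]
    | delta in [set delta : R | 0 < delta]].

Definition hilbert_ball (R : realType) (n : nat) (D : set 'rV[R]_n)
    (x : 'rV[R]_n) (r : R) : set 'rV[R]_n :=
  [set y | D y /\ hilbert_dist D x y < r].

Definition volume_growth (R : realType) (n : nat) (D : set 'rV[R]_n)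
    (x : 'rV[R]_n) (r : R) : \bar R :=
  (r^-1%:E *
   lne (hausdorff_measure D (hilbert_dist D) n (hilbert_ball D x r)))%E.

Definition volume_entropy (R : realType) (n : nat) (D : set 'rV[R]_n)
    (x : 'rV[R]_n) : \bar R :=
  lim (volume_growth D x r @[r --> +oo]).

(* Main.v *)
(** Let [D] be the domain in the chart, [hd] its Hilbert distance and [N r] the
    number of group elements that move a base point [o] by less than [r].
    Cocompactness makes [ln N] subadditive up to a shift, so that
    [ln (N r) / r] converges; both entropies are equal to its limit.
    - Volume: the ball of radius [r] is covered by about [N r] translates of
      one compact set, and contains about [N r] translates of one small ball,
      which are uniformly separated since the action is free and cocompact.
    - Entropy: the Hilbert distance is convex along pairs of geodesics, hence
      geodesics that are close at the times [0] and [t] are close in between,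
      and the pairs of end points are counted by [N] up to the group.
      Conversely two orbits in HM that start at the same base point and stay
      close lift to close geodesics, so that the vectors from [o] to its orbit
      points at distance less than [t] are separated, up to the distance
      (about [t] integer values) and a bounded multiplicity. *)

Require Import Defs.
From HB Require Import structures.
From mathcomp Require Import all_boot all_order all_algebra.
From mathcomp Require Import all_classical all_reals all_analysis.
From mathcomp Require Import finmap ring lra.
Import Order.TTheory GRing.Theory Num.Theory.
Import numFieldNormedType.Exports.
Local Open Scope classical_set_scope.
Local Open Scope ring_scope.
Set Implicit Arguments.
Unset Strict Implicit.
Unset Printing Implicit Defensive.

(** * Chords of a strictly convex domain *)

(** The Hilbert distance is defined through chosen boundary points, which is awkward for metric
    arguments. On the open convex cone over the domain, [hd x y < r] only says that two differences
    of multiples of the lifted points lie in the cone, the product of the multipliers being less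
    than [expR (2 * r)]. A group of linear maps preserving the cone then acts by isometries, and
    geodesics become affine in the parameter [expR (2 * t)]. Two geodesics are compared in the form
    of a bound by the sum of their distances at both ends, which is all that the counting needs. The
    metric on HM is any metric that induces its topology. It is related to the Hilbert geometry of
    the domain by compactness alone, through finite covers and Lebesgue numbers; the resulting
    constants are not explicit, but they change the orbit count only by a shift of the radius and a
    subexponential factor. *)

Section ConvexDomain.
Variables (R : realType) (n : nat) (D : set 'rV[R]_n).

Record convex_domain : Prop := ConvexDomain {
  cd_open : open D ;
  cd_bounded : bounded_set D ;
  cd_strict : strictly_convex D }.

Hypothesis hD : convex_domain.
Implicit Types (x y z xi a b : 'rV[R]_n) (p q s t r : R).

Lemma domain_norm_ball x : D x ->
  exists2 e : R, 0 < e & forall z, `|z - x| < e -> D z.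
Proof.
move=> Dx; have : nbhs x D by apply: open_nbhs_nbhs; split=> //; exact: cd_open.
move=> /nbhs_ballP[e /= e0 H]; exists e => // z zx; apply: H.
by rewrite -ball_normE /= distrC.
Qed.

Lemma closure_norm x :
  (forall e : R, 0 < e -> exists2 z, D z & `|z - x| < e) -> closure D x.
Proof.
move=> H U /nbhs_ballP[e /= e0 HU]; have [z Dz zx] := H e e0.
by exists z; split=> //; apply: HU; rewrite -ball_normE /= distrC.
Qed.

Lemma domain_combination x y t : closure D x -> D y -> 0 < t -> t <= 1 ->
  D ((1 - t) *: x + t *: y).
Proof.
move=> cx Dy t0; rewrite le_eqVlt => /predU1P[->|t1].
  by rewrite subrr scale0r scale1r add0r.
have [->|xy] := eqVneq x y; first by rewrite -scalerDl subrK scale1r.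
by apply: interior_subset; apply: cd_strict => //;
  [exact: subset_closure | rewrite t0 t1].
Qed.

(** The ends are recorded as parameters relative to [x], in units of [xi]. Cross-ratios on the line
    become rational functions of [p], [q] and [s], and moving the base point only shifts the
    parameters. *)
Definition chord x xi p q :=
  [/\ 0 < p, 0 < q & forall s, D (x + s *: xi) <-> - p < s < q].

Lemma chord_opp x xi p q : chord x xi p q -> chord x (- xi) q p.
Proof.
move=> [p0 q0 H]; split=> // s; rewrite scalerN -scaleNr H; split; lra.
Qed.

Lemma chord_shift x xi p q s : chord x xi p q -> - p < s < q ->
  chord (x + s *: xi) xi (p + s) (q - s).
Proof.
move=> [p0 q0 H] hs; split; [lra|lra|move=> u].
by rewrite -addrA -scalerDl H; split; lra.
Qed.

(** [q] is the supremum of the parameters whose points lie in [D]: finite since [D] is bounded, not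
    attained since [D] is open, and convexity fills the interval below it. *)
Lemma ray_end x xi : D x -> xi != 0 ->
  exists2 q, 0 < q & forall s, 0 <= s -> (D (x + s *: xi) <-> s < q).
Proof.
move=> Dx xi0; have nx : 0 < `|xi| by rewrite normr_gt0.
pose S := [set s | 0 <= s /\ D (x + s *: xi)].
have S0 : S 0 by split=> //; rewrite scale0r addr0.
have [M HM] : exists M, forall y, D y -> `|y| <= M.
  have [M0 [_ HM0]] := cd_bounded hD; exists (M0 + 1) => y Dy.
  by apply: HM0 => //; rewrite ltrDl.
have ubS : has_ubound S.
  exists ((M + `|x|) / `|xi|) => s [s0 /HM h].
  rewrite ler_pdivlMr //; have -> : s * `|xi| = `|s *: xi|.
    by rewrite normrZ ger0_norm.
  have -> : s *: xi = (x + s *: xi) - x by rewrite addrC addKr.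
  by rewrite (le_trans (ler_normB _ _)) // lerD2r.
have hsS : has_sup S by split=> //; exists 0.
have step s : 0 <= s -> D (x + s *: xi) ->
    exists2 e, 0 < e & D (x + (s + e) *: xi).
  move=> s0 Ds; have [e e0 He] := domain_norm_ball Ds.
  exists (e / 2 / `|xi|); first by rewrite !divr_gt0.
  apply: He; rewrite scalerDl addrA [_ + (_ / _) *: _]addrC addrK normrZ ger0_norm.
    by rewrite divfK ?gt_eqF //; lra.
  by rewrite !divr_ge0 // ltW.
have ubq s : S s -> s < sup S.
  move=> [s0 Ds]; have [e e0 De] := step s s0 Ds.
  have : s + e <= sup S by apply: ub_le_sup => //; split=> //; lra.
  lra.
exists (sup S); first exact: ubq.
move=> s s0; split=> [Ds|sq]; first by apply: ubq.
have [u [u0 Du] su] := sup_adherent (eps := sup S - s)  ltac:(lra) hsS.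
have {}su : s < u by lra.
have [->|s1] := eqVneq s 0; first by rewrite scale0r addr0.
have := @domain_combination x (x + u *: xi) (s / u) (subset_closure Dx) Du.
rewrite divr_gt0 ?ler_pdivrMr ?mul1r; [|lra|lra|lra] => /(_ isT (ltW su)).
rewrite scalerBl scale1r scalerDr scalerA divfK; last lra.
by rewrite addrA subrK.
Qed.

Lemma chord_exists x xi : D x -> xi != 0 -> exists p q, chord x xi p q.
Proof.
move=> Dx xi0; have [q q0 Hq] := ray_end Dx xi0.
have [||p p0 Hp] := @ray_end x (- xi) => //; first by rewrite oppr_eq0.
exists p, q; split=> // s; have [s0|s0] := leP 0 s.
  rewrite Hq //; split; lra.
have := Hp (- s); rewrite scalerN scaleNr opprK => -> //; last lra.
split; lra.
Qed.

Lemma chord_end x xi p q : chord x xi p q -> closure D (x + q *: xi).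
Proof.
move=> [p0 q0 H]; apply: closure_norm => e e0.
pose k := Num.min (q / 2) (e / 2 / (`|xi| + 1)).
have xi1 : 0 < `|xi| + 1 by have := normr_ge0 xi; lra.
have k0 : 0 < k by rewrite lt_min !divr_gt0.
have kq : k <= q / 2 by rewrite ge_min lexx.
have ke : k <= e / 2 / (`|xi| + 1) by rewrite ge_min lexx orbT.
exists (x + (q - k) *: xi); first by apply/H; lra.
rewrite scalerBl opprD addrACA subrr add0r addrAC subrr sub0r normrN normrZ.
rewrite gtr0_norm //.
have : k * (`|xi| + 1) <= e / 2 by rewrite -ler_pdivlMr.
have : k * `|xi| <= k * (`|xi| + 1) by rewrite ler_pM2l //; lra.
lra.
Qed.

Lemma chord_boundary x xi p q s : chord x xi p q ->
  boundary D (x + s *: xi) <-> (s = q \/ s = - p).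
Proof.
move=> H; have [p0 q0 Hs] := H; have iD : interior D = D by apply/interior_id; exact: cd_open.
have Dx : D x.
  by have := (Hs 0).2 ltac:(lra); rewrite scale0r addr0.
(* A point of the closure strictly beyond the end is combined with [x']; the weight is the one that
   puts the combination at the parameter [q'], which is not in [D]. The other end is reached through
   [chord_opp]. *)
have out x' xi' p' q' s' : chord x' xi' p' q' -> q' < s' -> ~ closure D (x' + s' *: xi').
  move=> [p'0 q'0 H'] qs cs.
  have Dx' : D x'.
    by have := (H' 0).2 ltac:(lra); rewrite scale0r addr0.
  have s'0 : 0 < s' by lra.
  have e0 : 0 < (s' - q') / s' by apply: divr_gt0; lra.
  have e1 : (s' - q') / s' <= 1 by rewrite ler_pdivrMr; lra.
  have := domain_combination cs Dx' e0 e1.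
  rewrite scalerDr scalerA addrAC -scalerDl subrK scale1r.
  have -> : (1 - (s' - q') / s') * s' = q' by field; lra.
  by move/H'; lra.
split.
  rewrite /boundary iD => -[cs nDs].
  have [sq|sq] := ltP q s; first by have := out _ _ _ _ _ H sq.
  have [sp|sp] := ltP s (- p).
    have := out _ _ _ _ (- s) (chord_opp H); rewrite scalerN scaleNr opprK.
    by move=> /(_ ltac:(lra)).
  have : ~ (- p < s < q) by move=> /Hs.
  by move=> /negP; rewrite negb_and -!leNgt => /orP[] h; [right|left]; lra.
move=> [->|->]; split; rewrite ?iD.
- exact: chord_end H.
- by move/Hs; lra.
- by have := chord_end (chord_opp H); rewrite scalerN scaleNr.
- by move/Hs; lra.
Qed.

Lemma euclidean_lengthZ (k : R) (v : 'rV[R]_n) :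
  euclidean_length (k *: v) = `|k| * euclidean_length v.
Proof.
rewrite /euclidean_length; under eq_bigr do rewrite mxE exprMn.
by rewrite -mulr_sumr sqrtrM ?sqr_ge0 // sqrtr_sqr.
Qed.

Lemma euclidean_length_eq0 (v : 'rV[R]_n) : euclidean_length v = 0 -> v = 0.
Proof.
move/eqP; rewrite sqrtr_eq0 => h; apply/rowP => i; rewrite mxE.
have : \sum_i v 0 i ^+ 2 = 0.
  by apply/eqP; rewrite eq_le h sumr_ge0 // => j _; exact: sqr_ge0.
move/psumr_eq0P => /(_ (fun j _ => sqr_ge0 _) i isT)/eqP.
by rewrite sqrf_eq0 => /eqP.
Qed.

(** [line_ends] chooses the two ends in an unknown order. Exchanging them inverts the cross-ratio,
    which the absolute value of the logarithm hides; [0 <= s] makes the displayed quotient at least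
    1 and so fixes the sign. *)
Lemma hilbert_dist_chord x xi p q s : chord x xi p q -> 0 <= s < q ->
  hilbert_dist D x (x + s *: xi) = 2^-1 * ln ((p + s) * q / (p * (q - s))).
Proof.
move=> H /andP[s0 sq]; have [p0 q0 Hs] := H.
have xi0 : xi != 0.
  apply/eqP => xi0; move: Hs; rewrite xi0 => /[dup] /(_ 0) [_ h1] /(_ q).
  by rewrite !scaler0 in h1 * => -[/(_ (h1 ltac:(lra)))]; lra.
rewrite /hilbert_dist; have [e|ne] := eqVneq x (x + s *: xi).
  have : s *: xi = 0 by rewrite -[LHS](addKr x) -e addNr.
  move/eqP; rewrite scaler_eq0 (negbTE xi0) orbF => /eqP ->.
  by rewrite addr0 subr0 divff ?ln1 ?mulr0 // mulf_neq0 //; lra.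
have s1 : 0 < s.
  rewrite lt_neqAle s0 andbT; apply: contraNneq ne => <-.
  by rewrite scale0r addr0.
set y := x + s *: xi; set a := x - p *: xi; set b := x + q *: xi.
have lineE : line x y `&` boundary D = [set a; b].
  apply/seteqP; split=> z.
    move=> [[t _ <-]]; rewrite /y addrAC subrr add0r scalerA.
    by move=> /(chord_boundary _ H)[->|->]; [right|left; rewrite /a scaleNr].
  move=> [->|->]; rewrite /a -?scaleNr; split.
  - exists (- p / s) => //; rewrite /y addrAC subrr add0r scalerA divfK //.
    by rewrite gt_eqF.
  - by apply/(chord_boundary _ H); right.
  - exists (q / s) => //; rewrite /y addrAC subrr add0r scalerA divfK //.
    by rewrite gt_eqF.
  - by apply/(chord_boundary _ H); left.
have ab : a != b.
  rewrite /a /b -scaleNr (inj_eq (addrI _)) -subr_eq0 -scalerBl scaler_eq0.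
  by rewrite (negbTE xi0) orbF; apply/eqP; lra.
have l0 : euclidean_length xi != 0.
  by apply: contra_neq xi0; exact: euclidean_length_eq0.
have xa : x - a = p *: xi by rewrite /a opprB addrC subrK.
have xb : x - b = (- q) *: xi by rewrite /b opprD addrA subrr sub0r scaleNr.
have ya : y - a = (p + s) *: xi.
  by rewrite /a /y opprB addrC addrA subrK -scalerDl.
have yb : y - b = (s - q) *: xi.
  by rewrite /b /y opprD addrACA subrr add0r -scalerBl.
have gt0 : 0 < (p + s) * q / (p * (q - s)).
  by rewrite divr_gt0 // mulr_gt0 //; lra.
have ge1 : 1 <= (p + s) * q / (p * (q - s)).
  by rewrite ler_pdivlMr ?mul1r; [nra|rewrite mulr_gt0 //; lra].
have cr1 : cross_ratio a b x y = ((p + s) * q / (p * (q - s)))^-1.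
  rewrite /cross_ratio xa xb ya yb !euclidean_lengthZ normrN.
  rewrite (gtr0_norm p0) (gtr0_norm q0) (gtr0_norm (_ : 0 < p + s)); last lra.
  rewrite (ltr0_norm (_ : s - q < 0)); last lra.
  by field; rewrite l0 /=; do ?[apply/andP; split]; lra.
have cr2 : cross_ratio b a x y = (p + s) * q / (p * (q - s)).
  rewrite /cross_ratio xa xb ya yb !euclidean_lengthZ normrN.
  rewrite (gtr0_norm p0) (gtr0_norm q0) (gtr0_norm (_ : 0 < p + s)); last lra.
  rewrite (ltr0_norm (_ : s - q < 0)); last lra.
  by field; rewrite l0 /=; do ?[apply/andP; split]; lra.
rewrite /line_ends; set ab' := xget _ _.
have [ne' E] : ab'.1 != ab'.2 /\ line x y `&` boundary D = [set ab'.1; ab'.2].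
  by rewrite /ab'; case: xgetP => [? _ //|/(_ (a, b))]; case.
have h1 : [set a; b] ab'.1 by rewrite -lineE E; left.
have h2 : [set a; b] ab'.2 by rewrite -lineE E; right.
have lnge : 0 <= ln ((p + s) * q / (p * (q - s))) by rewrite ln_ge0.
move: h1 h2 ne' => [->|->] [->|->]; rewrite ?eqxx // => _.
  by rewrite cr1 lnV // normrN ger0_norm.
by rewrite cr2 ger0_norm.
Qed.

End ConvexDomain.

(** * The Hilbert distance and its geodesics *)

(* Locked, since the decision procedures of [lra] otherwise try to identify
   two distances by unfolding the choice of the end points. *)
HB.lock Definition hdist (R : realType) (n : nat) (D : set 'rV[R]_n)
  (x y : 'rV[R]_n) : R := hilbert_dist D x y.

Lemma hdistE (R : realType) (n : nat) (D : set 'rV[R]_n) :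
  hilbert_dist D = hdist D.
Proof. by rewrite hdist.unlock. Qed.

Lemma hdxx (R : realType) (n : nat) (D : set 'rV[R]_n) x : hdist D x x = 0.
Proof. by rewrite -hdistE /hilbert_dist eqxx. Qed.

Section Lift.
Variables (R : realType) (n : nat).

(** Homogeneous coordinates: the chart is identified with the hyperplane [height v = 1]. Projective
    maps become linear, and convexity of [D] becomes stability of the cone over it under sums. *)
Definition lift1 (x : 'rV[R]_n) : 'rV[R]_(1 + n) := row_mx 1%:M x.

Definition height (v : 'rV[R]_(1 + n)) : R := lsubmx v 0 0.

Lemma heightD u v : height (u + v) = height u + height v.
Proof. by rewrite /height linearD mxE. Qed.

Lemma heightZ c v : height (c *: v) = c * height v.
Proof. by rewrite /height linearZ mxE. Qed.

Lemma heightN v : height (- v) = - height v.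
Proof. by rewrite /height linearN mxE. Qed.

Lemma height_lift x : height (lift1 x) = 1.
Proof. by rewrite /height /lift1 row_mxKl mxE. Qed.

Lemma rsubmx_lift x : rsubmx (lift1 x) = x.
Proof. exact: row_mxKr. Qed.

Lemma heightK v : height v != 0 ->
  v = height v *: lift1 ((height v)^-1 *: rsubmx v).
Proof.
move=> h0; rewrite /lift1 scale_row_mx scalerA divff // scale1r.
rewrite -[LHS]hsubmxK; congr row_mx; apply/matrixP => i j.
by rewrite !ord1 [RHS]mxE [1%:M _ _]mxE eqxx mulr1.
Qed.

Lemma lift_comb a b x y : a + b = 1 ->
  lift1 (a *: x + b *: y) = a *: lift1 x + b *: lift1 y.
Proof.
move=> ab; rewrite /lift1 !scale_row_mx add_row_mx; congr row_mx.
by rewrite -scalerDl ab scale1r.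
Qed.
End Lift.

Section Metric.
Variables (R : realType) (n : nat) (D : set 'rV[R]_n).
Hypothesis hD : convex_domain D.
Implicit Types (x y z xi : 'rV[R]_n) (p q s t r lam mu : R).
Notation hd := (hdist D).

Definition cone (v : 'rV[R]_(1 + n)) :=
  0 < height v /\ D ((height v)^-1 *: rsubmx v).

Lemma cone_lift x : cone (lift1 x) <-> D x.
Proof.
rewrite /cone height_lift rsubmx_lift invr1 scale1r; split=> [[]//|]; split=> //.
Qed.

Lemma cone_scale c v : 0 < c -> cone v -> cone (c *: v).
Proof.
move=> c0 [h0 Dv]; split; rewrite heightZ; first exact: mulr_gt0.
rewrite linearZ /= scalerA invfM [c^-1 * _]mulrC -mulrA mulVf ?mulr1 //.
by rewrite gt_eqF.
Qed.

Lemma cone_add u v : cone u -> cone v -> cone (u + v).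
Proof.
move=> [hu Du] [hv Dv]; split; rewrite heightD; first exact: addr_gt0.
have h0 : 0 < height u + height v by exact: addr_gt0.
have := @domain_combination _ _ _ hD _ _ (height v / (height u + height v))
  (subset_closure Du) Dv.
rewrite divr_gt0 // ler_pdivrMr // mul1r => /(_ isT) H.
suff : D ((1 - height v / (height u + height v)) *: ((height u)^-1 *: rsubmx u) +
   height v / (height u + height v) *: ((height v)^-1 *: rsubmx v)).
  congr D; rewrite !scalerA linearD scalerDr /=.
  by congr (_ *: _ + _ *: _); field; rewrite ?gt_eqF.
by apply: H; rewrite lerDr ltW.
Qed.

Lemma chord_dist x y p q : D y -> chord D x (y - x) p q ->
  1 < q /\ hd x y = 2^-1 * ln ((p + 1) * q / (p * (q - 1))).
Proof.
move=> Dy H; have [p0 q0 Hs] := H.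
have q1 : 1 < q.
  by have := (Hs 1).1; rewrite scale1r addrC subrK => /(_ Dy)/andP[].
split=> //; rewrite -(hilbert_dist_chord hD H) -?hdistE; last by lra.
by rewrite scale1r addrC subrK.
Qed.

(** For [lam > 1] the vector lies above the point of parameter [lam / (lam - 1)] on the line from
    [x] through [y], beyond [y]; being in the cone means that this parameter is less than [q]. The
    threshold found here and the one for the other end multiply to [expR (2 * hd x y)]. *)
Lemma cone_fwd x y p q lam : D y -> chord D x (y - x) p q ->
  cone (lam *: lift1 y - lift1 x) <-> q / (q - 1) < lam.
Proof.
move=> Dy H; have [p0 q0 Hs] := H; have [q1 _] := chord_dist Dy H.
rewrite /cone heightD heightN heightZ !height_lift mulr1 linearB linearZ /=.
rewrite !rsubmx_lift; have q10 : 0 < q - 1 by lra.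
split=> [[h0 Dv]|].
  rewrite ltr_pdivrMr //; have : D (x + (lam / (lam - 1)) *: (y - x)).
    suff -> : x + (lam / (lam - 1)) *: (y - x) =
      (lam - 1)^-1 *: (lam *: y - x) by [].
    by apply/rowP => i; rewrite !mxE; field; lra.
  by move/Hs => /andP[_]; rewrite ltr_pdivrMr //; lra.
rewrite ltr_pdivrMr // => h; have l1 : 1 < lam by nra.
split; first lra.
suff <- : x + (lam / (lam - 1)) *: (y - x) =
      (lam - 1)^-1 *: (lam *: y - x).
  apply/Hs; rewrite ltr_pdivrMr; last lra.
  apply/andP; split; last lra.
  by have : 0 < lam / (lam - 1) by [apply: divr_gt0; lra]; lra.
by apply/rowP => i; rewrite !mxE; field; lra.
Qed.

Lemma cone_bwd x y p q mu : chord D x (y - x) p q ->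
  cone (mu *: lift1 x - lift1 y) <-> (p + 1) / p < mu.
Proof.
move=> H; have [p0 q0 Hs] := H.
rewrite /cone heightD heightN heightZ !height_lift mulr1 linearB linearZ /=.
rewrite !rsubmx_lift ltr_pdivrMr //.
have E : mu - 1 != 0 ->
    (mu - 1)^-1 *: (mu *: x - y) = x + (- (mu - 1)^-1) *: (y - x).
  by move=> h; apply/rowP => i; rewrite !mxE; field.
split=> [[h0]|h].
  rewrite E; last lra.
  move/Hs => /andP[+ _]; rewrite ltrN2 -[X in X < _]mul1r ltr_pdivrMr //; lra.
have m1 : 1 < mu by nra.
split; [lra|rewrite E; last lra].
have i0 : 0 < (mu - 1)^-1 by rewrite invr_gt0; lra.
apply/Hs; rewrite ltrN2 -[X in X < _]mul1r ltr_pdivrMr; last lra.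
by apply/andP; split; lra.
Qed.

(** The thresholds of the two cone conditions are not attained; a strict bound on their product
    leaves room for two admissible multipliers. *)
Lemma split_prod (a b c : R) : 0 < a -> 0 < b -> a * b < c ->
  exists lam mu, [/\ a < lam, b < mu & lam * mu < c].
Proof.
move=> a0 b0 h; have ab : 0 < a * b by apply: mulr_gt0.
have h1 : a < c / b by rewrite ltr_pdivlMr.
pose l := (a + c / b) / 2; have al : a < l by rewrite /l; lra.
have lc : l < c / b by rewrite /l; lra.
have h2 : b < c / l by rewrite ltr_pdivlMr 1?mulrC -?ltr_pdivlMr //; lra.
exists l, ((b + c / l) / 2); split=> //; first lra.
have : (b + c / l) / 2 < c / l by lra.
rewrite ltr_pdivlMr; last lra.
by rewrite mulrC.
Qed.

(* This order-theoretic form of the Hilbert distance does not mention the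
   boundary: it gives the triangle inequality, the invariance under
   projective maps and the convexity along geodesics. *)
Lemma hd_lt_cone x y r : D x -> D y -> hd x y < r <->
  exists lam mu, [/\ 0 < lam, 0 < mu, lam * mu < expR (2 * r),
    cone (lam *: lift1 y - lift1 x) & cone (mu *: lift1 x - lift1 y)].
Proof.
move=> Dx Dy; have [->|xy] := eqVneq x y.
  rewrite hdxx.
  have E l : cone (l *: lift1 y - lift1 y) <-> 1 < l.
    split=> [[]|l1].
      by rewrite heightD heightN heightZ height_lift; lra.
    rewrite -[X in _ - X]scale1r -scalerBl; apply: cone_scale; first lra.
    exact/cone_lift.
  split=> [r0|[l [m [l0 m0 lm /E l1 /E m1]]]].
    have h : 1 * 1 < expR (2 * r) by rewrite mulr1 expR_gt1; lra.
    have [l [m [l1 m1 lm]]] := split_prod ltr01 ltr01 h.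
    by exists l, m; split; rewrite ?E //; lra.
  have : 1 < expR (2 * r) by nra.
  by rewrite expR_gt1; lra.
have xi0 : y - x != 0 by rewrite subr_eq0 eq_sym.
have [p [q H]] := chord_exists hD Dx xi0; have [p0 q0 Hs] := H.
have [q1 ->] := chord_dist Dy H; have q10 : 0 < q - 1 by lra.
have E : 2^-1 * ln ((p + 1) * q / (p * (q - 1))) < r <->
    q / (q - 1) * ((p + 1) / p) < expR (2 * r).
  have -> : q / (q - 1) * ((p + 1) / p) = (p + 1) * q / (p * (q - 1)).
    by field; rewrite !gt_eqF.
  have g0 : 0 < (p + 1) * q / (p * (q - 1)).
    by rewrite divr_gt0 // mulr_gt0 //; lra.
  rewrite -[X in X < expR _]lnK ?posrE // ltr_expR; split; lra.
rewrite E; split=> [h|[l [m [l0 m0 lm]]]].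
  have [||l [m [hl hm lm]]] := split_prod _ _ h.
  - by apply: divr_gt0; lra.
  - by apply: divr_gt0; lra.
  have a0 : 0 < q / (q - 1) by apply: divr_gt0; lra.
  have b0 : 0 < (p + 1) / p by apply: divr_gt0; lra.
  exists l, m; split=> //; try lra.
    exact/(cone_fwd _ Dy H).
  exact/(cone_bwd _ H).
move=> /(cone_fwd _ Dy H) hl /(cone_bwd _ H) hm; apply: le_lt_trans lm.
by apply: ler_pM; rewrite ?ltW // divr_gt0 //; lra.
Qed.

(** Rescaling the lifts changes [lam] and [mu] by inverse factors and leaves their product alone.
    The lifts may therefore be those that come from a linear map or from [geo_lift]. *)
Lemma hd_lt_scaled_cone x y r (a b : R) : D x -> D y -> 0 < a -> 0 < b ->
  hd x y < r <->
  exists lam mu, [/\ 0 < lam, 0 < mu, lam * mu < expR (2 * r),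
    cone (lam *: (b *: lift1 y) - a *: lift1 x) &
    cone (mu *: (a *: lift1 x) - b *: lift1 y)].
Proof.
move=> Dx Dy a0 b0; rewrite hd_lt_cone //.
split=> [[l [m [l0 m0 lm hl hm]]]|[l [m [l0 m0 lm hl hm]]]].
  exists (l * a / b), (m * b / a); split; rewrite ?divr_gt0 ?mulr_gt0 //.
  - by congr (_ < _): lm; field; rewrite !gt_eqF.
  - rewrite scalerA divfK ?gt_eqF // [l * a]mulrC -scalerA -scalerBr.
    exact: cone_scale.
  - rewrite scalerA divfK ?gt_eqF // [m * b]mulrC -scalerA -scalerBr.
    exact: cone_scale.
exists (l * b / a), (m * a / b); split; rewrite ?divr_gt0 ?mulr_gt0 //.
- by congr (_ < _): lm; field; rewrite !gt_eqF.
- have := cone_scale (_ : 0 < a^-1) hl; rewrite invr_gt0 => /(_ a0).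
  by rewrite scalerBr !scalerA mulVf ?gt_eqF // scale1r [a^-1 * _]mulrC mulrAC.
- have := cone_scale (_ : 0 < b^-1) hm; rewrite invr_gt0 => /(_ b0).
  by rewrite scalerBr !scalerA mulVf ?gt_eqF // scale1r [b^-1 * _]mulrC mulrAC.
Qed.

Lemma hd_gt0 x y : D x -> D y -> x != y -> 0 < hd x y.
Proof.
move=> Dx Dy xy; have xi0 : y - x != 0 by rewrite subr_eq0 eq_sym.
have [p [q H]] := chord_exists hD Dx xi0; have [p0 q0 Hs] := H.
have [q1 ->] := chord_dist Dy H; rewrite mulr_gt0 ?invr_gt0 // ln_gt0 //.
by rewrite ltr_pdivlMr ?mulr_gt0; nra.
Qed.

Lemma hd_ge0 x y : D x -> D y -> 0 <= hd x y.
Proof.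
move=> Dx Dy; have [->|xy] := eqVneq x y; first by rewrite hdxx.
exact/ltW/hd_gt0.
Qed.

Lemma hd_sym x y : D x -> D y -> hd x y = hd y x.
Proof.
move=> Dx Dy; have le u v : D u -> D v -> hd u v <= hd v u.
  move=> Du Dv; rewrite leNgt; apply/negP.
  move=> /(hd_lt_cone _ Dv Du)[l [m [l0 m0 lm hl hm]]].
  suff : hd u v < hd u v by rewrite ltxx.
  by apply/(hd_lt_cone _ Du Dv); exists m, l; split=> //; rewrite mulrC.
by apply/le_anti; rewrite !le.
Qed.

(** Multipliers compose: [l * l'] and [m * m'] serve for [x] and [z] because the cone is closed
    under sums and positive multiples. *)
Lemma hd_triangle y x z : D x -> D y -> D z -> hd x z <= hd x y + hd y z.
Proof.
move=> Dx Dy Dz; apply/ler_addgt0Pr => e e0.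
have h1 : hd x y < hd x y + e / 2 by lra.
have h2 : hd y z < hd y z + e / 2 by lra.
move: h1 h2 => /(hd_lt_cone _ Dx Dy)[l [m [l0 m0 lm hl hm]]].
move=> /(hd_lt_cone _ Dy Dz)[l' [m' [l'0 m'0 lm' hl' hm']]].
apply/ltW/(hd_lt_cone _ Dx Dz); exists (l * l'), (m * m').
split; rewrite ?mulr_gt0 //.
- have -> : l * l' * (m * m') = (l * m) * (l' * m') by ring.
  have -> : 2 * (hd x y + hd y z + e) =
    2 * (hd x y + e / 2) + 2 * (hd y z + e / 2) by field.
  by rewrite expRD; apply: ltr_pM; rewrite ?mulr_ge0 // ltW.
- have -> : (l * l') *: lift1 z - lift1 x =
    l *: (l' *: lift1 z - lift1 y) + (l *: lift1 y - lift1 x).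
    by rewrite scalerBr scalerA addrA subrK.
  by apply: cone_add => //; apply: cone_scale.
- have -> : (m * m') *: lift1 x - lift1 z =
    m' *: (m *: lift1 x - lift1 y) + (m' *: lift1 y - lift1 z).
    by rewrite scalerBr scalerA addrA subrK [m * _]mulrC.
  by apply: cone_add => //; apply: cone_scale.
Qed.

(* [geo_param p q t] is the affine coordinate of the point at signed Hilbert
   distance [t] from the origin of a chord with ends at [- p] and [q]. *)
Definition geo_param p q t :=
  p * q * (expR (2 * t) - 1) / (p * expR (2 * t) + q).

(** The chord is selected inside the definition, so that [geo] depends only on the base point and
    the vector. The default [(1, 1)] is reached only when there is no chord. *)
Definition geo x xi t :=
  let pq := xget (1, 1) [set pq : R * R | chord D x xi pq.1 pq.2] in
  x + geo_param pq.1 pq.2 t *: xi.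

Lemma chord_unique x xi p q p' q' :
  chord D x xi p q -> chord D x xi p' q' -> p = p' /\ q = q'.
Proof.
move=> [p0 q0 H] [p'0 q'0 H']; have E s : - p < s < q <-> - p' < s < q'.
  by rewrite -H.
by split; apply/eqP; rewrite eq_le; apply/andP; split; rewrite leNgt;
  apply/negP => h; [have := (E (- p')).1|have := (E (- p)).2|
    have := (E q').1|have := (E q).2]; lra.
Qed.

Lemma geoE x xi p q t : chord D x xi p q ->
  geo x xi t = x + geo_param p q t *: xi.
Proof.
move=> H; rewrite /geo; set pq := xget _ _.
have /(chord_unique H)[<- <- //] : chord D x xi pq.1 pq.2.
by rewrite /pq; case: xgetP => [? _ //|/(_ (p, q))]; case.
Qed.

Lemma geo_paramP p q t : 0 < p -> 0 < q ->
  let E := expR (2 * t) in let s := geo_param p q t in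
  [/\ 0 < p * E + q, p + s = p * E * (p + q) / (p * E + q) &
      q - s = q * (p + q) / (p * E + q)].
Proof.
move=> p0 q0 E s; have E0 : 0 < E by exact: expR_gt0.
have d0 : 0 < p * E + q by rewrite addr_gt0 // mulr_gt0.
by split=> //; rewrite /s /geo_param -/E; field; rewrite gt_eqF.
Qed.

Lemma geo_param_in p q t : 0 < p -> 0 < q -> - p < geo_param p q t < q.
Proof.
move=> p0 q0; have [d0 e1 e2] := geo_paramP t p0 q0.
have E0 : 0 < expR (2 * t) by exact: expR_gt0.
have : 0 < p * expR (2 * t) * (p + q) / (p * expR (2 * t) + q).
  by rewrite divr_gt0 // !mulr_gt0 // addr_gt0.
have : 0 < q * (p + q) / (p * expR (2 * t) + q).
  by rewrite divr_gt0 // !mulr_gt0 // addr_gt0.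
lra.
Qed.

Lemma geo_param_ge0 p q t : 0 < p -> 0 < q -> 0 <= t -> 0 <= geo_param p q t.
Proof.
move=> p0 q0 t0; have [d0 _ _] := geo_paramP t p0 q0.
rewrite /geo_param divr_ge0 ?(ltW d0) // mulr_ge0 //.
  by rewrite mulr_ge0 ?ltW.
by rewrite subr_ge0 -[X in X <= _]expR0 ler_expR; lra.
Qed.

Lemma geo_in x xi t : D x -> xi != 0 -> D (geo x xi t).
Proof.
move=> Dx /(chord_exists hD Dx)[p [q H]]; have [p0 q0 Hs] := H.
by rewrite (geoE _ H); apply/Hs/geo_param_in.
Qed.

Lemma geo0 x xi : geo x xi 0 = x.
Proof. by rewrite /geo /geo_param mulr0 expR0 subrr mulr0 mul0r scale0r addr0. Qed.

Lemma geo_dist x xi t t' : D x -> xi != 0 ->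
  hd (geo x xi t) (geo x xi t') = `|t - t'|.
Proof.
move=> Dx xi0; have key u v : u <= v -> hd (geo x xi u) (geo x xi v) = v - u.
  move=> uv; have [p [q H]] := chord_exists hD Dx xi0; have [p0 q0 Hs] := H.
  rewrite !(geoE _ H).
  set s := geo_param p q u; set s' := geo_param p q v.
  have hs : - p < s < q by exact: geo_param_in.
  have hs' : - p < s' < q by exact: geo_param_in.
  have [d0 e1 e2] := geo_paramP u p0 q0; have [d0' e1' e2'] := geo_paramP v p0 q0.
  have E0 : 0 < expR (2 * u) by exact: expR_gt0.
  have E'0 : 0 < expR (2 * v) by exact: expR_gt0.
  have EE : expR (2 * u) <= expR (2 * v) by rewrite ler_expR; lra.
  have ss : s <= s'.
    have -> : s' = s + p * q * (p + q) * (expR (2 * v) - expR (2 * u)) /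
        ((p * expR (2 * u) + q) * (p * expR (2 * v) + q)).
      by rewrite /s /s' /geo_param; field; rewrite !gt_eqF.
    rewrite lerDl divr_ge0 // !mulr_ge0 //; lra.
  have -> : x + s' *: xi = (x + s *: xi) + (s' - s) *: xi.
    by rewrite -addrA -scalerDl addrC [s + _]addrC subrK addrC.
  rewrite -hdistE (hilbert_dist_chord hD (chord_shift H hs)); last lra.
  (* By [geo_paramP] the distances to the two ends at time [u] are in the ratio of
     [p * expR (2 * u)] to [q], and likewise at time [v]; in the cross-ratio only the exponentials
     survive. *)
  have -> : (p + s + (s' - s)) * (q - s) / ((p + s) * (q - s - (s' - s))) =
      expR (2 * v - 2 * u).
    have -> : p + s + (s' - s) = p + s' by ring.
    have -> : q - s - (s' - s) = q - s' by ring.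
    rewrite /s /s' e1 e2 e1' e2' expRD expRN; field.
    by rewrite !gt_eqF //= addr_gt0.
  by rewrite expRK; field.
have [tt|/ltW tt] := leP t t'.
  by rewrite key // distrC ger0_norm // subr_ge0.
rewrite hd_sym ?key ?ger0_norm ?subr_ge0 //; exact: geo_in.
Qed.

Lemma geo_dist0 x xi t : D x -> xi != 0 -> hd x (geo x xi t) = `|t|.
Proof. by move=> Dx xi0; have := geo_dist 0 t Dx xi0; rewrite geo0 sub0r normrN. Qed.

Lemma ray_dist_inj x xi s s' : D x -> xi != 0 -> 0 <= s -> 0 <= s' ->
  D (x + s *: xi) -> D (x + s' *: xi) ->
  hd x (x + s *: xi) = hd x (x + s' *: xi) -> s = s'.
Proof.
move=> Dx xi0 s0 s'0; have [p [q H]] := chord_exists hD Dx xi0.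
have [p0 q0 Hs] := H; move=> /Hs hs /Hs hs'.
rewrite -hdistE !(hilbert_dist_chord hD H); [|lra|lra].
have gt0 u : 0 <= u -> - p < u < q -> 0 < (p + u) * q / (p * (q - u)).
  by move=> *; rewrite divr_gt0 // mulr_gt0 //; lra.
move=> /(mulfI (_ : 2^-1 != 0)) => /(_ ltac:(lra)) /ln_inj.
rewrite !posrE !gt0 // => /(_ isT isT)/eqP.
rewrite eqr_div; [|by rewrite mulf_neq0 //; lra..] => /eqP h.
have {}h : p * q * (p + q) * s = p * q * (p + q) * s' by lra.
apply: mulfI h; rewrite !mulf_neq0 //; lra.
Qed.

(** Along a ray the distance to the origin is injective. To recognize the point at time [t] it
    suffices to find a point of the ray at the right distance; this settles rescaled vectors,
    shifted origins, group actions and the flow alike. *)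
Lemma geo_unique x xi s t : D x -> xi != 0 -> 0 <= s -> 0 <= t ->
  D (x + s *: xi) -> hd x (x + s *: xi) = t -> x + s *: xi = geo x xi t.
Proof.
move=> Dx xi0 s0 t0 Ds h; have [p [q H]] := chord_exists hD Dx xi0.
have [p0 q0 Hs] := H; rewrite (geoE _ H).
congr (_ + _ *: _); apply: (@ray_dist_inj x xi) => //.
- exact: geo_param_ge0.
- by apply/Hs/geo_param_in.
- by rewrite h -(geoE _ H) geo_dist0 // ger0_norm.
Qed.

Lemma geo_ray x xi t : D x -> xi != 0 -> 0 <= t ->
  exists2 s, 0 <= s & geo x xi t = x + s *: xi.
Proof.
move=> Dx xi0 t0; have [p [q H]] := chord_exists hD Dx xi0.
have [p0 q0 _] := H; exists (geo_param p q t); last exact: geoE.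
exact: geo_param_ge0.
Qed.

Lemma geo_scale x xi c t : D x -> xi != 0 -> 0 < c -> 0 <= t ->
  geo x (c *: xi) t = geo x xi t.
Proof.
move=> Dx xi0 c0 t0; have cxi0 : c *: xi != 0.
  by rewrite scaler_eq0 negb_or xi0 gt_eqF.
have [s s0 e] := geo_ray Dx cxi0 t0; rewrite e scalerA.
apply: geo_unique; rewrite ?mulr_ge0 ?(ltW c0) //.
  by rewrite -scalerA -e; exact: geo_in.
by rewrite -scalerA -e geo_dist0 // ger0_norm.
Qed.

Lemma geo_shift x xi s t : D x -> xi != 0 -> 0 <= s -> 0 <= t ->
  geo (geo x xi s) xi t = geo x xi (s + t).
Proof.
move=> Dx xi0 s0 t0; have [p [q H]] := chord_exists hD Dx xi0.
have [p0 q0 Hs] := H; have Dy := geo_in s Dx xi0.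
have st : geo_param p q s <= geo_param p q (s + t).
  have hs := geo_param_in s p0 q0; have hst := geo_param_in (s + t) p0 q0.
  have [d0 _ e2] := geo_paramP s p0 q0; have [d0' _ e2'] := geo_paramP (s + t) p0 q0.
  suff : q - geo_param p q (s + t) <= q - geo_param p q s by lra.
  rewrite e2 e2' ler_pM2l ?mulr_gt0 ?addr_gt0 // lef_pV2 ?posrE //.
  by rewrite lerD2r ler_pM2l // ler_expR; lra.
have E : geo x xi (s + t) =
    geo x xi s + (geo_param p q (s + t) - geo_param p q s) *: xi.
  by rewrite !(geoE _ H) -addrA -scalerDl [geo_param p q s + _]addrC subrK.
rewrite E; apply/esym/geo_unique => //; rewrite ?subr_ge0 // -E.
  exact: geo_in.
by rewrite geo_dist // opprD addrA subrr sub0r normrN ger0_norm.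
Qed.

Lemma geo_through x y : D x -> D y -> x != y -> geo x (y - x) (hd x y) = y.
Proof.
move=> Dx Dy xy; have xi0 : y - x != 0 by rewrite subr_eq0 eq_sym.
have e : y = x + 1 *: (y - x) by rewrite scale1r addrC subrK.
by apply/esym; rewrite {1}e; apply: geo_unique; rewrite -?e //; exact: hd_ge0.
Qed.

(** The end of a chord lies only in the closure of [D], but adding any vector of the cone to its
    lift moves it inside. *)
Lemma cone_end x xi p q v : chord D x xi p q -> cone v ->
  cone (lift1 (x + q *: xi) + v).
Proof.
move=> H [h0 Dv]; have h1 : 0 < 1 + height v by lra.
split; rewrite heightD height_lift // linearD /= rsubmx_lift.
have := @domain_combination _ _ _ hD _ _ (height v / (1 + height v))
  (chord_end H) Dv.
rewrite divr_gt0 // ler_pdivrMr // => /(_ isT) K.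
suff : D ((1 - height v / (1 + height v)) *: (x + q *: xi) +
   height v / (1 + height v) *: ((height v)^-1 *: rsubmx v)).
  congr D; rewrite scalerA [RHS]scalerDr.
  by congr (_ *: _ + _ *: _); field; rewrite ?gt_eqF.
by apply: K; lra.
Qed.

(* Lifted with these weights, a geodesic runs linearly, in the parameter
   [expR (2 * t)], between fixed lifts of the two ends of its chord. *)
Lemma geo_lift x xi p q t : chord D x xi p q ->
  (p * expR (2 * t) + q) *: lift1 (geo x xi t) =
  (p * expR (2 * t)) *: lift1 (x + q *: xi) + q *: lift1 (x - p *: xi).
Proof.
move=> H; have [p0 q0 _] := H; have [d0 _ _] := geo_paramP t p0 q0.
set E := expR _ in d0 *; have dn : p * E + q != 0 by rewrite gt_eqF.
have -> : geo x xi t = (p * E / (p * E + q)) *: (x + q *: xi) +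
    (q / (p * E + q)) *: (x - p *: xi).
  rewrite (geoE _ H) /geo_param -/E; apply/rowP => i; rewrite !mxE; field.
  exact: dn.
rewrite lift_comb; last by field.
by rewrite scalerDr !scalerA; congr (_ *: _ + _ *: _); field.
Qed.

(* Otherwise combining the two memberships would put the end [x' + q' *: xi']
   of the second chord in [D]. *)
Lemma geo_lift_cross x xi x' xi' p q p' q' T lam mu :
  chord D x xi p q -> chord D x' xi' p' q' -> 0 < T -> 0 < lam ->
  cone (lam *: ((p' * expR (2 * T) + q') *: lift1 (geo x' xi' T)) -
        (p * expR (2 * T) + q) *: lift1 (geo x xi T)) ->
  cone (mu *: ((p + q) *: lift1 x) - (p' + q') *: lift1 x') ->
  1 <= lam * mu.
Proof.
move=> H H' T0 l0 hl hm; have [p0 q0 Hs] := H; have [p'0 q'0 Hs'] := H'.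
have E1 : 1 < expR (2 * T) by rewrite expR_gt1; lra.
have g0 := geo_lift 0 H; have g0' := geo_lift 0 H'; move: hl.
have gT := geo_lift T H; have gT' := geo_lift T H'.
rewrite !mulr0 !expR0 !mulr1 !geo0 in g0 g0'.
rewrite gT gT'; move: hm; rewrite g0 g0'.
set a := lift1 (x + q *: xi); set a' := lift1 (x - p *: xi).
set b := lift1 (x' + q' *: xi'); set b' := lift1 (x' - p' *: xi').
set E := expR _ in E1 *; move=> hm hl; rewrite leNgt; apply/negP => lm.
have c0 : 0 < p + q by lra.
have Dx : D x by have := (Hs 0).2 ltac:(lra); rewrite scale0r addr0.
(* When [lam * mu < 1], what is added to [a] lies in the cone, so [cone_end] applies. Once the lifts
   are expanded, the multiples of [a], [a'] and [b'] cancel, and a positive multiple of [b], the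
   lift of an end, remains. *)
have h1 : cone ((p * (E - 1)) *: (a + (p * (E - 1))^-1 *: (
    (1 - lam * mu) *: ((p + q) *: lift1 x) +
    (lam *: ((p' * E) *: b + q' *: b') - ((p * E) *: a + q *: a') +
     lam *: (mu *: (p *: a + q *: a') - (p' *: b + q' *: b')))))).
  have pE : 0 < p * (E - 1) by rewrite mulr_gt0 //; lra.
  apply: cone_scale => //; apply: (cone_end H); apply: cone_scale.
    by rewrite invr_gt0.
  apply: cone_add; first by apply: cone_scale; [lra|apply: cone_scale => //; exact/cone_lift].
  by apply: cone_add => //; apply: cone_scale.
have : cone ((lam * p' * (E - 1)) *: b).
  move: h1; rewrite g0 -/a -/a'; clear hm hl g0 g0' gT gT'; clearbody a a' b b'; congr cone.
  by apply/rowP => i; rewrite !mxE; field; lra.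
have k0 : 0 < lam * p' * (E - 1) by rewrite !mulr_gt0 //; lra.
move/(cone_scale (_ : 0 < (lam * p' * (E - 1))^-1)); rewrite invr_gt0 => /(_ k0).
rewrite scalerA mulVf ?gt_eqF // scale1r => /cone_lift /Hs'; lra.
Qed.

(** Both lifted geodesics are affine in [expR (2 * s)], so at time [s] they are combinations of
    their values at 0 and [T] with one common weight [al]. Multipliers that serve at both times
    serve at [s], hence the maxima. The obstacle is the mixed products: since [geo_lift_cross] gives
    [1 <= lT * m0], the product [l0 * mT] is at most that of all four multipliers, and
    symmetrically. *)
Lemma geo_convex x xi x' xi' s T : D x -> xi != 0 -> D x' -> xi' != 0 ->
  0 <= s <= T ->
  hd (geo x xi s) (geo x' xi' s) <= hd x x' + hd (geo x xi T) (geo x' xi' T).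
Proof.
move=> Dx xi0 Dx' xi'0 /andP[s0 sT].
have [->|s1] := eqVneq s 0.
  by rewrite !geo0 lerDl hd_ge0 //; exact: geo_in.
have T0 : 0 < T by rewrite (lt_le_trans _ sT) // lt_neqAle eq_sym s1.
have [p [q H]] := chord_exists hD Dx xi0; have [p0 q0 Hs] := H.
have [p' [q' H']] := chord_exists hD Dx' xi'0; have [p'0 q'0 Hs'] := H'.
have ET : 1 < expR (2 * T) by rewrite expR_gt1; lra.
have Es : 1 <= expR (2 * s) by rewrite -[X in X <= _]expR0 ler_expR; lra.
have EsT : expR (2 * s) <= expR (2 * T) by rewrite ler_expR; lra.
pose C t := (p * expR (2 * t) + q) *: lift1 (geo x xi t).
pose C' t := (p' * expR (2 * t) + q') *: lift1 (geo x' xi' t).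
have C0 : C 0 = (p + q) *: lift1 x by rewrite /C mulr0 expR0 mulr1 geo0.
have C'0 : C' 0 = (p' + q') *: lift1 x' by rewrite /C' mulr0 expR0 mulr1 geo0.
pose al := (expR (2 * s) - 1) / (expR (2 * T) - 1).
have al0 : 0 <= al by rewrite divr_ge0 //; lra.
have al1 : 0 <= 1 - al by rewrite subr_ge0 ler_pdivrMr ?mul1r; lra.
have comb (y xy : 'rV[R]_n) (pu qu : R) : chord D y xy pu qu ->
   (pu * expR (2 * s) + qu) *: lift1 (geo y xy s) =
   al *: ((pu * expR (2 * T) + qu) *: lift1 (geo y xy T)) +
   (1 - al) *: ((pu * expR (2 * 0) + qu) *: lift1 (geo y xy 0)).
  move=> K; rewrite !(geo_lift _ K) /al mulr0 expR0; apply/rowP => i.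
  by rewrite !mxE; field; lra.
have combC : C s = al *: C T + (1 - al) *: C 0 by exact: comb.
have combC' : C' s = al *: C' T + (1 - al) *: C' 0 by exact: comb.
have coneC t : cone (C t).
  apply: cone_scale; last by apply/cone_lift; exact: geo_in.
  by have [] := geo_paramP t p0 q0.
have coneC' t : cone (C' t).
  apply: cone_scale; last by apply/cone_lift; exact: geo_in.
  by have [] := geo_paramP t p'0 q'0.
apply/ler_addgt0Pr => e e0.
have h1 : hd x x' < hd x x' + e / 2 by lra.
have h2 : hd (geo x xi T) (geo x' xi' T) < hd (geo x xi T) (geo x' xi' T) + e / 2 by lra.
have d0 t := let: And3 d _ _ := geo_paramP t p0 q0 in d.
have d0' t := let: And3 d _ _ := geo_paramP t p'0 q'0 in d.
have [/(_ h1)[l0 [m0 [l00 m00 lm0 hl0 hm0]]] _] :=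
  hd_lt_scaled_cone (hd x x' + e / 2) Dx Dx' (addr_gt0 p0 q0) (addr_gt0 p'0 q'0).
have [/(_ h2)[lT [mT [lT0 mT0 lmT hlT hmT]]] _] :=
  hd_lt_scaled_cone (hd (geo x xi T) (geo x' xi' T) + e / 2) (geo_in T Dx xi0)
   (geo_in T Dx' xi'0) (d0 T) (d0' T).
have k1 := geo_lift_cross H H' T0 lT0 hlT hm0.
have k2 := geo_lift_cross H' H T0 mT0 hmT hl0.
apply/ltW/(hd_lt_scaled_cone _ (geo_in s Dx xi0) (geo_in s Dx' xi'0) (d0 s) (d0' s)).
exists (Num.max l0 lT), (Num.max m0 mT).
have mono (u v : 'rV[R]_(1 + n)) l l' : cone u -> cone (l *: u - v) -> l <= l' ->
    cone (l' *: u - v).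
  move=> cu cv; rewrite le_eqVlt => /predU1P[<- //|ll].
  have -> : l' *: u - v = (l' - l) *: u + (l *: u - v).
    by rewrite addrA -scalerDl subrK.
  by apply: cone_add => //; apply: cone_scale => //; lra.
have reg (l : R) (u v u' v' : 'rV[R]_(1 + n)) :
    l *: (al *: u + (1 - al) *: v) - (al *: u' + (1 - al) *: v') =
    al *: (l *: u - u') + (1 - al) *: (l *: v - v').
  by apply/rowP => i; rewrite !mxE; ring.
have convex (u v : 'rV[R]_(1 + n)) : cone u -> cone v -> cone (al *: u + (1 - al) *: v).
  move=> cu cv; have [->|a0] := eqVneq al 0.
    by rewrite scale0r add0r subr0 scale1r.
  have [->|a1] := eqVneq al 1; first by rewrite subrr scale0r addr0 scale1r.
  apply: cone_add; apply: cone_scale => //; first by rewrite lt_neqAle eq_sym a0.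
  by rewrite lt_neqAle al1 andbT eq_sym subr_eq0 eq_sym.
split.
- by rewrite lt_max l00.
- by rewrite lt_max m00.
- have -> : 2 * (hd x x' + hd (geo x xi T) (geo x' xi' T) + e) =
      2 * (hd x x' + e / 2) + 2 * (hd (geo x xi T) (geo x' xi' T) + e / 2).
    by field.
  rewrite expRD; set X := expR _ in lm0 *; set Y := expR _ in lmT *.
  have X1 : 1 < X by rewrite expR_gt1; have := hd_ge0 Dx Dx'; lra.
  have Y1 : 1 < Y.
    by rewrite expR_gt1; have := hd_ge0 (geo_in T Dx xi0) (geo_in T Dx' xi'0); lra.
  have XY : (l0 * m0) * (lT * mT) < X * Y.
    by apply: ltr_pM => //; rewrite mulr_ge0 // ltW.
  have c1 : l0 * m0 < X * Y by nra.
  have c2 : lT * mT < X * Y by nra.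
  have pp (a b c d : R) : 0 < a -> 0 < b -> 1 <= c * d -> a * b * (c * d) < X * Y ->
      a * b < X * Y.
    move=> a0 b0 cd h; apply: le_lt_trans h; rewrite ler_peMr //.
    by rewrite mulr_ge0 // ltW.
  have c3 : l0 * mT < X * Y.
    apply: (pp _ _ lT m0) => //; congr (_ < _): XY; ring.
  have c4 : lT * m0 < X * Y.
    apply: (pp _ _ mT l0) => //; congr (_ < _): XY; ring.
  by case: (leP l0 lT) => _; case: (leP m0 mT) => _.
- rewrite -/(C s) -/(C' s) combC combC'.
  rewrite reg; apply: convex; apply: mono.
  + exact: coneC'.
  + exact: hlT.
  + by rewrite le_max lexx orbT.
  + exact: coneC'.
  + by rewrite C0 C'0; exact: hl0.
  + by rewrite le_max lexx.
- rewrite -/(C s) -/(C' s) combC combC'.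
  rewrite reg; apply: convex; apply: mono.
  + exact: coneC.
  + exact: hmT.
  + by rewrite le_max lexx orbT.
  + exact: coneC.
  + by rewrite C0 C'0; exact: hm0.
  + by rewrite le_max lexx.
Qed.

End Metric.

(** * Comparison with the Euclidean topology *)

Section EuclideanComparison.
Variables (R : realType) (n : nat) (D : set 'rV[R]_n).
Hypothesis hD : convex_domain D.
Implicit Types (x y z xi : 'rV[R]_n) (p q s t r : R).
Notation hd := (hdist D).

Definition room (e : R) x := forall z, `|z - x| < e -> D z.

Lemma chord_room x xi p q e : chord D x xi p q -> xi != 0 -> 0 < e -> room e x ->
  e / `|xi| <= q.
Proof.
move=> [p0 q0 Hs] xi0 e0 rx; have nx : 0 < `|xi| by rewrite normr_gt0.
rewrite leNgt; apply/negP => h.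
have : D (x + q *: xi).
  by apply: rx; rewrite addrAC subrr add0r normrZ gtr0_norm // -ltr_pdivlMr.
by move/Hs; lra.
Qed.

(** [expR (2 * hd x y)] factors into [1 + p^-1] and [1 + (q - 1)^-1], one factor for each end. The
    free balls of radius [e] bound both inverses by the norm of [y - x] over [e], and
    [ln (1 + u) <= u]. *)
Lemma hd_le_norm e x y : 0 < e -> room e x -> room e y -> D x -> D y ->
  hd x y <= `|y - x| / e.
Proof.
move=> e0 rx ry Dx Dy; have [->|xy] := eqVneq x y.
  by rewrite hdxx subrr normr0 mul0r.
have xi0 : y - x != 0 by rewrite subr_eq0 eq_sym.
have [p [q H]] := chord_exists hD Dx xi0; have [p0 q0 Hs] := H.
have [q1 ->] := chord_dist hD Dy H; have nx : 0 < `|y - x| by rewrite normr_gt0.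
have := chord_room (chord_opp H) _ e0 rx; rewrite normrN oppr_eq0 => /(_ xi0) hp.
have := chord_shift H (_ : - p < 1 < q).
have y1 : x + 1 *: (y - x) = y by rewrite scale1r addrC subrK.
rewrite y1 => /(_ ltac:(lra)) H'; have hq := chord_room H' xi0 e0 ry.
have -> : (p + 1) * q / (p * (q - 1)) = (1 + p^-1) * (1 + (q - 1)^-1).
  by field; lra.
have ip : p^-1 <= `|y - x| / e by rewrite -[X in _ <= X]invf_div lef_pV2 // posrE ?divr_gt0.
have iq : (q - 1)^-1 <= `|y - x| / e.
  by rewrite -[X in _ <= X]invf_div lef_pV2 // posrE ?divr_gt0 //; lra.
have p'0 : 0 < p^-1 by rewrite invr_gt0.
have q'0 : 0 < (q - 1)^-1 by rewrite invr_gt0; lra.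
rewrite lnM ?posrE; [|lra|lra].
have := @le_ln1Dx R p^-1; have := @le_ln1Dx R (q - 1)^-1; lra.
Qed.

Lemma norm_le_hd : exists2 C : R, 0 < C &
  forall x y, D x -> D y -> `|y - x| <= C * hd x y.
Proof.
have [M0 [_ HM0]] := cd_bounded hD; pose M := `|M0| + 1.
have M1 : 1 <= M by rewrite lerDr.
have HM y : D y -> `|y| <= M.
  by move=> Dy; apply: HM0 => //; rewrite /M; have := ler_norm M0; lra.
(* The ends are within [2 * M] of the points, so each of the two factors is at least [1 + u], where
   [u] is the norm of [y - x] over [2 * M]. As [u <= 1], its logarithm is at least [u / 2], so
   [hd x y >= u / 2]. *)
exists (4 * M); first lra.
move=> x y Dx Dy; have [->|xy] := eqVneq x y.
  by rewrite hdxx subrr normr0 mulr0.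
have xi0 : y - x != 0 by rewrite subr_eq0 eq_sym.
have [p [q H]] := chord_exists hD Dx xi0; have [p0 q0 Hs] := H.
have [q1 ->] := chord_dist hD Dy H; have nx : 0 < `|y - x| by rewrite normr_gt0.
have bound z zeta a b : D z -> chord D z zeta a b -> b * `|zeta| <= 2 * M.
  move=> Dz [a0 b0 K]; rewrite leNgt; apply/negP => h.
  have z0 : 0 < `|zeta|.
    by rewrite normr_gt0; apply/eqP => z0; move: h; rewrite z0 normr0 mulr0; lra.
  pose c := 2 * M / `|zeta|; have cb : c < b by rewrite /c ltr_pdivrMr.
  pose m := (b + c) / 2; have mb : m < b by rewrite /m; lra.
  have cm : c < m by rewrite /m; lra.
  have c0 : 0 < c by rewrite divr_gt0 //; lra.
  have Dm : D (z + m *: zeta) by apply/K; lra.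
  have : `|m *: zeta| <= 2 * M.
    have -> : m *: zeta = (z + m *: zeta) - z by rewrite addrC addKr.
    rewrite (le_trans (ler_normB _ _)) //.
    by have := HM _ Dz; have := HM _ Dm; lra.
  rewrite normrZ gtr0_norm; last lra.
  by rewrite -ler_pdivlMr // -/c; lra.
have hq : (q - 1) * `|y - x| <= 2 * M.
  by have := bound _ _ _ _ Dx H; lra.
have hp : p * `|y - x| <= 2 * M.
  by have := bound _ _ _ _ Dx (chord_opp H); rewrite normrN.
set u := `|y - x| / (2 * M).
have u0 : 0 < u by rewrite divr_gt0 //; lra.
have u1 : u <= 1.
  rewrite ler_pdivrMr ?mul1r; last lra.
  by rewrite (le_trans (ler_normB _ _)) //; have := HM _ Dx; have := HM _ Dy; lra.
have -> : (p + 1) * q / (p * (q - 1)) = (1 + p^-1) * (1 + (q - 1)^-1).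
  by field; lra.
have ip : u <= p^-1.
  by rewrite -[u]invf_div lef_pV2 ?posrE ?divr_gt0 ?ler_pdivlMr //; lra.
have iq : u <= (q - 1)^-1.
  by rewrite -[u]invf_div lef_pV2 ?posrE ?divr_gt0 ?ler_pdivlMr //; lra.
rewrite lnM ?posrE; [|lra|lra].
have le1 v : u <= v -> u / 2 <= ln (1 + v).
  move=> uv; rewrite -[X in X <= _]expRK ler_ln ?posrE ?expR_gt0 //; last lra.
  apply: (@le_trans _ _ (1 + u)); last lra.
  have h : 1 - u / 2 <= expR (- (u / 2)).
    by have := @expR_ge1Dx R (- (u / 2)); lra.
  rewrite -[X in X <= _]invrK -expRN.
  rewrite (@le_trans _ _ (1 - u / 2)^-1) // ?lef_pV2 ?posrE ?expR_gt0 //; last first.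
    by rewrite -[X in X <= _]mul1r ler_pdivrMr; nra.
  lra.
have := le1 _ ip; have := le1 _ iq.
have -> : `|y - x| = 2 * M * u by rewrite /u mulrC divfK //; lra.
move=> h1 h2; nra.
Qed.

(** [y] lies on the segment from the point below [l *: lift1 y - lift1 x] to [x], with weight [l^-1]
    at [x]. The free ball about [x] contracts by this weight to one about [y], and [l^-1] exceeds
    [expR (- (2 * r))] because [m > 1]. This confines Hilbert balls to compact subsets of [D]. *)
Lemma hd_room x r e : D x -> room e x -> forall y, D y -> hd x y < r ->
  room (e * expR (- (2 * r))) y.
Proof.
move=> Dx rx y Dy /(hd_lt_cone hD _ Dx Dy)[l [m [l0 m0 lm hl hm]]] z hz.
move: hl hm => [hl Dw] [hm _].
rewrite !(heightD, heightN, heightZ, height_lift) !mulr1 in hl hm Dw.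
rewrite linearB linearZ /= !rsubmx_lift in Dw.
have il : 0 < l^-1 by rewrite invr_gt0.
have il1 : l^-1 <= 1 by rewrite -[X in _ <= X]invr1 lef_pV2 ?posrE //; lra.
have Dx' : D (x + l *: (z - y)).
  apply: rx; rewrite addrAC subrr add0r normrZ gtr0_norm // mulrC -ltr_pdivlMr //.
  have e0 : 0 < e.
    have := le_lt_trans (normr_ge0 _) hz; rewrite pmulr_lgt0 //; exact: expR_gt0.
  apply: (lt_le_trans hz); rewrite ler_pM2l // expRN lef_pV2 ?posrE ?expR_gt0 //.
  by nra.
have := domain_combination hD (subset_closure Dw) Dx' il il1.
congr D; apply/rowP => i; rewrite !mxE; field; lra.
Qed.

Lemma domain_room x : D x -> exists2 e : R, 0 < e & room e x.
Proof. exact: domain_norm_ball. Qed.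

Lemma hd_near x r : D x -> 0 < r ->
  exists2 e : R, 0 < e & forall y, `|y - x| < e -> D y /\ hd x y < r.
Proof.
move=> Dx r0; have [e e0 rx] := domain_room Dx.
exists (Num.min (e / 2) (e / 2 * r)).
  by rewrite lt_min !mulr_gt0.
move=> y; rewrite lt_min => /andP[h1 h2].
have ry : room (e / 2) y.
  move=> z hz; apply: rx; rewrite -[z](subrK y) -addrA.
  by rewrite (le_lt_trans (ler_normD _ _)) //; lra.
have rx2 : room (e / 2) x by move=> z hz; apply: rx; lra.
have Dy : D y by apply: rx; lra.
split=> //; apply: (le_lt_trans (hd_le_norm _ rx2 ry Dx Dy)); first lra.
by rewrite ltr_pdivrMr; lra.
Qed.

Lemma room_domain e x : 0 < e -> room e x -> D x.
Proof. by move=> e0; apply; rewrite subrr normr0. Qed.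

Lemma room_compact e : 0 < e -> compact [set x | room e x].
Proof.
move=> e0; apply: bounded_closed_compact.
  have [M [Mr HM]] := cd_bounded hD; exists M; split=> // N MN x /(room_domain e0).
  exact: HM.
move=> x cx z zx; pose k := (e - `|z - x|) / 2.
have k0 : 0 < k by rewrite /k; lra.
have : nbhs x (ball x k) by exact: nbhsx_ballx.
move=> /cx [y [ry]]; rewrite -ball_normE /= => xy; apply: ry.
have -> : z - y = (z - x) + (x - y) by rewrite addrA subrK.
by rewrite (le_lt_trans (ler_normD _ _)) //; move: xy; rewrite /k; lra.
Qed.

End EuclideanComparison.

(** * The action of the group *)

Section Projective.
Variables (R : realType) (n : nat).
Implicit Types (v w : 'rV[R]_(1 + n)) (x y : 'rV[R]_n) (A B : 'M[R]_(1 + n)).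

Lemma val_proj_pt v : v != 0 -> val (proj_pt v) = <[v]>%VS.
Proof. by move=> v0; rewrite /proj_pt insubdK // unfold_in dim_vline v0. Qed.

Lemma proj_pt_eq v w : v != 0 -> w != 0 -> proj_pt v = proj_pt w ->
  exists2 c, c != 0 & v = c *: w.
Proof.
move=> v0 w0 /(congr1 val); rewrite !val_proj_pt // => e.
have /vlineP[c vE] : v \in <[w]>%VS by rewrite -e memv_line.
by exists c => //; apply: contraNneq v0 => c0; rewrite vE c0 scale0r.
Qed.

Lemma to_chart_proj_pt A v : v != 0 ->
  to_chart A (proj_pt v) = (height (v *m A))^-1 *: rsubmx (v *m A).
Proof.
move=> v0; rewrite /to_chart val_proj_pt // -/(height _).
have : vpick <[v]>%VS != 0.
  by rewrite vpick0 -subv0 -memvE memv0.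
have /vlineP[c ->] : vpick <[v]>%VS \in <[v]>%VS by exact: memv_pick.
rewrite scaler_eq0 negb_or => /andP[c0 _].
rewrite -scalemxAl heightZ linearZ /= scalerA invfM mulrAC mulVf // mul1r.
by [].
Qed.

Lemma lift1_neq0 x : lift1 x != 0.
Proof.
apply/eqP => e; have := height_lift x; rewrite e /height linear0 mxE => /eqP.
by rewrite eq_sym oner_eq0.
Qed.

Lemma mulmx_unit_neq0 v A : A \in unitmx -> v != 0 -> v *m A != 0.
Proof.
move=> uA v0; apply: contraNneq v0 => e.
by rewrite -[v](mulmxK uA) e mul0mx.
Qed.

Lemma chart_mapE A g : A \in unitmx -> @PGL R n g ->
  exists2 B, B \in unitmx & forall x,
    (g (of_chart A x) = proj_pt (lift1 x *m invmx A *m (B))) /\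
    map_in_chart A g x =
      (height (lift1 x *m (invmx A *m B *m A)))^-1 *:
        rsubmx (lift1 x *m (invmx A *m B *m A)).
Proof.
move=> uA [B uB gB]; exists B => // x; split.
  by rewrite gB // mulmx_unit_neq0 ?unitmx_inv // lift1_neq0.
rewrite /map_in_chart /= /of_chart gB; last first.
  by rewrite mulmx_unit_neq0 ?unitmx_inv // lift1_neq0.
rewrite to_chart_proj_pt ?mulmxA //.
by rewrite !mulmx_unit_neq0 ?unitmx_inv // lift1_neq0.
Qed.

Lemma convex_weight_root (a b : R) : 0 < a -> b < 0 ->
  (1 - a / (a - b)) * a + a / (a - b) * b = 0.
Proof. by move=> a0 b0; field; lra. Qed.

(** The matrix of a projective map is defined up to a scalar; positive heights over [D] select a
    sign for which the cone over [D] is mapped into itself. *)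
Definition chart_matrix (D : set 'rV[R]_n) (f : 'rV[R]_n -> 'rV[R]_n) B :=
  (forall x, f x = (height (lift1 x *m B))^-1 *: rsubmx (lift1 x *m B)) /\
  (forall x, D x -> 0 < height (lift1 x *m B) /\ D (f x)).

(** The height of the image does not vanish on [D], because images stay in the chart. Being affine
    in the point, it keeps one sign on the convex set [D]; if this sign is negative, the matrix is
    negated. *)
Lemma chart_matrix_exists A Omega g : strictly_convex_domain A Omega ->
  @PGL R n g -> g @` Omega = Omega ->
  (forall x, in_chart A Omega x -> of_chart A (map_in_chart A g x) = g (of_chart A x))
  /\ exists B, chart_matrix (in_chart A Omega) (map_in_chart A g) B.
Proof.
move=> sc gP gO; have uA := chart_unit sc; set D := in_chart A Omega.
have hD : convex_domain D.
  by split; [exact: domain_open sc|exact: domain_bounded sc|exact: domain_strictly_convex sc].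
have [B uB HB] := chart_mapE uA gP; set B' := invmx A *m B *m A in HB *.
have main x : D x -> height (lift1 x *m B') != 0 /\
    (D (map_in_chart A g x) /\ of_chart A (map_in_chart A g x) = g (of_chart A x)).
  move=> Dx; have Og : Omega (g (of_chart A x)) by rewrite -gO; exists (of_chart A x).
  have [y _ yE] := domain_sub_chart sc Og.
  have n1 : lift1 y *m invmx A != 0 by rewrite mulmx_unit_neq0 ?unitmx_inv ?lift1_neq0.
  have n2 : lift1 x *m invmx A *m B != 0.
    by rewrite !mulmx_unit_neq0 ?unitmx_inv ?lift1_neq0.
  have [c c0 cE] : exists2 c, c != 0 & lift1 x *m invmx A *m B = c *: (lift1 y *m invmx A).
    by apply: proj_pt_eq => //; rewrite -(HB x).1 -yE.
  have E : lift1 x *m B' = c *: lift1 y.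
    by rewrite /B' !mulmxA cE -scalemxAl mulmxKV.
  have Ey : map_in_chart A g x = y.
    rewrite (HB x).2 E heightZ linearZ /= height_lift rsubmx_lift mulr1.
    by rewrite scalerA mulVf // scale1r.
  split; first by rewrite E heightZ height_lift mulr1.
  by rewrite Ey yE; split=> //; rewrite /D /in_chart /= yE.
split; first by move=> x /main[_ []].
have [x0 Dx0] : D !=set0.
  have [p Op] := domain_nonempty sc; have [y _ yE] := domain_sub_chart sc Op.
  by exists y; rewrite /D /in_chart /= yE.
have same x y : D x -> D y -> 0 < height (lift1 x *m B') ->
    0 < height (lift1 y *m B').
  move=> Dx Dy hx; have [hy _] := main y Dy.
  rewrite lt_neqAle eq_sym hy /= leNgt; apply/negP => hy0.
  pose t := height (lift1 x *m B') / (height (lift1 x *m B') - height (lift1 y *m B')).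
  have t0 : 0 < t by apply: divr_gt0 => //; lra.
  have t1 : t <= 1 by rewrite ler_pdivrMr; lra.
  have [] := main _ (domain_combination hD (subset_closure Dx) Dy t0 t1).
  rewrite lift_comb ?subrK // mulmxDl heightD -!scalemxAl !heightZ => /eqP[].
  exact: convex_weight_root.
have [h0|h0] := ltP 0 (height (lift1 x0 *m B')).
  exists B'; split=> x; first exact: (HB x).2.
  by move=> Dx; split; [exact: same h0|have [_ []] := main x Dx].
exists (- B'); split=> x.
  by rewrite (HB x).2 mulmxN heightN linearN /= invrN scalerN scaleNr opprK.
move=> Dx; split; last by have [_ []] := main x Dx.
rewrite mulmxN heightN oppr_gt0 ltNge; apply/negP => hx.
have [hx0 _] := main x Dx; have [hx00 _] := main x0 Dx0.
have : 0 < height (lift1 x0 *m B').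
  by apply: (same x) => //; rewrite lt_neqAle eq_sym hx0.
lra.
Qed.

End Projective.

Section ChartMatrix.
Variables (R : realType) (n : nat) (D : set 'rV[R]_n).
Hypothesis hD : convex_domain D.
Variables (f : 'rV[R]_n -> 'rV[R]_n) (B : 'M[R]_(1 + n)).
Hypothesis fB : chart_matrix D f B.
Implicit Types (x y xi : 'rV[R]_n).
Notation hd := (hdist D).

Let alpha x := height (lift1 x *m B).

Lemma chart_matrix_lift x : D x -> lift1 x *m B = alpha x *: lift1 (f x).
Proof.
move=> Dx; have [h0 _] := fB.2 x Dx.
by rewrite fB.1 -heightK // gt_eqF.
Qed.

Lemma chart_matrix_cone v : cone D v -> cone D (v *m B).
Proof.
move=> [h0 Dv]; rewrite (heightK (v := v)) ?gt_eqF // -scalemxAl.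
rewrite chart_matrix_lift //; do 2 (apply: cone_scale => //).
  by have [] := fB.2 _ Dv.
by apply/cone_lift; have [] := fB.2 _ Dv.
Qed.

(** A matrix that maps the cone into itself carries multipliers for [x] and [y] to multipliers for
    their images. Equality will come from the inverse group element. *)
Lemma chart_matrix_hd x y : D x -> D y -> hd (f x) (f y) <= hd x y.
Proof.
move=> Dx Dy; have [hx Dfx] := fB.2 x Dx; have [hy Dfy] := fB.2 y Dy.
rewrite leNgt; apply/negP => /(hd_lt_cone hD _ Dx Dy)[l [m [l0 m0 lm hl hm]]].
suff : hd (f x) (f y) < hd (f x) (f y) by rewrite ltxx.
apply/(hd_lt_scaled_cone hD _ Dfx Dfy hx hy); exists l, m; split=> //.
  rewrite -/(alpha x) -/(alpha y) -!chart_matrix_lift //.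
  by have := chart_matrix_cone hl; rewrite mulmxBl -scalemxAl.
rewrite -/(alpha x) -/(alpha y) -!chart_matrix_lift //.
by have := chart_matrix_cone hm; rewrite mulmxBl -scalemxAl.
Qed.

Definition chart_derivative x xi : 'rV[R]_n :=
  let v := row_mx 0 xi *m B in
  (alpha x)^-1 *: (rsubmx v - height v *: f x).

Lemma lift1D x xi s : lift1 (x + s *: xi) = lift1 x + s *: row_mx 0 xi.
Proof. by rewrite /lift1 scale_row_mx add_row_mx scaler0 addr0. Qed.

(** A projective map sends lines to lines with a fractional linear change of parameter. In this form
    the limit of the difference quotient can be read off, and rays visibly go to rays while the
    heights are positive. *)
Lemma chart_matrix_line x xi s : D x ->
  alpha x + s * height (row_mx 0 xi *m B) != 0 ->
  f (x + s *: xi) = f x + (s * alpha x / (alpha x + s * height (row_mx 0 xi *m B)))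
    *: chart_derivative x xi.
Proof.
move=> Dx; have [a0 _] := fB.2 x Dx; move: a0; rewrite /chart_derivative fB.1.
rewrite fB.1 /alpha lift1D mulmxDl -scalemxAl heightD heightZ linearD linearZ /=.
set a := height (lift1 x *m B); set b := height _; set u := rsubmx _.
set v := rsubmx _ => a0 ab; apply/rowP => i; rewrite !mxE; field.
by rewrite ab gt_eqF.
Qed.

Lemma chart_matrix_differentiable x : D x -> differentiable f x.
Proof.
move=> Dx; have [a0 _] := fB.2 x Dx.
pose k (j : 'I_(1 + n)) (y : 'rV[R]_n) := (lift1 y *m B) 0 j.
have kE j y : k j y = B (lshift n 0) j + \sum_i y 0 i * B (rshift 1 i) j.
  rewrite /k mxE big_split_ord /= big_ord1 /lift1 row_mxEl mxE eqxx mul1r.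
  by congr (_ + _); apply: eq_bigr => i _; rewrite row_mxEr.
have dk j : differentiable (k j) x.
  have -> : k j = cst (B (lshift n 0) j) +
      \sum_(i < n) (fun y : 'rV[R]_n => B (rshift 1 i) j *: y 0 i).
    apply/funext => y; rewrite kE fctE; congr (_ + _).
    by rewrite fct_sumE; apply: eq_bigr => i _; rewrite mulrC.
  apply: differentiableD; first exact: differentiable_cst.
  apply: differentiable_sum => i; apply: differentiableZ.
  exact: differentiable_coord.
have -> : f = \sum_(i < n) (fun y => ((k (lshift n 0) y)^-1 * k (rshift 1 i) y)
    *: (delta_mx 0 i : 'rV[R]_n)).
  apply/funext => y; rewrite fct_sumE fB.1 [LHS]row_sum_delta.
  apply: eq_bigr => i _; congr (_ *: _).
  by rewrite /k /height mxE [rsubmx _ _ _]mxE [lsubmx _ _ _]mxE.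
apply: differentiable_sum => i; apply: differentiableZl.
apply: differentiableM => //; apply: differentiableV => //.
by move: a0; rewrite /height mxE => /lt0r_neq0.
Qed.

Lemma chart_matrix_diff x xi : D x -> 'd f x xi = chart_derivative x xi.
Proof.
move=> Dx; have [a0 _] := fB.2 x Dx.
have := deriveE xi (chart_matrix_differentiable Dx) => <-.
apply: cvg_lim => //.
set b := height (row_mx 0 xi *m B).
have c1 : (alpha x / (alpha x + h * b)) *: chart_derivative x xi @[h --> 0^'] -->
    (alpha x / (alpha x + 0 * b)) *: chart_derivative x xi.
  apply: cvgZr_tmp; apply: cvgM; first exact: cvg_cst.
  apply: cvgV; first by rewrite mul0r addr0 gt_eqF.
  apply: cvgD; first exact: cvg_cst.
  apply: cvgM; last exact: cvg_cst.
  exact: (@cvg_within_filter _ _ _ (nbhs 0)).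
have e1 : alpha x / (alpha x + 0 * b) = 1.
  by rewrite mul0r addr0 divff // gt_eqF.
rewrite e1 scale1r in c1.
apply: cvg_trans c1; apply: near_eq_cvg; near=> h.
have h0 : h != 0 by near: h; exact: nbhs_dnbhs_neq.
have hb : alpha x + h * b != 0.
  near: h; apply: nbhs_dnbhs.
  have : (alpha x + h * b) @[h --> (0:R)] --> alpha x + 0 * b.
    by apply: cvgD; [exact: cvg_cst|apply: cvgM; [exact: cvg_id|exact: cvg_cst]].
  rewrite mul0r addr0 => /cvgr_neq0; apply; exact: lt0r_neq0.
have -> : (f \o shift x) (h *: xi) = f (x + h *: xi) by rewrite addrC.
rewrite chart_matrix_line //.
rewrite addrAC subrr add0r [RHS]scalerA.
by congr (_ *: _); rewrite mulrA mulrA mulVf // mul1r.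
Unshelve. all: by end_near. Qed.

End ChartMatrix.

Section Action.
Variables (R : realType) (n : nat) (A : 'M[R]_(1 + n)).
Variables (Omega : set (proj_space R n))
  (Gamma : set (proj_space R n -> proj_space R n)).
Hypothesis hM : compact_strictly_convex_projective_manifold A Omega Gamma.
Implicit Types (x y xi : 'rV[R]_n).
Notation D := (in_chart A Omega).
Notation hd := (hdist D).
Notation act := (map_in_chart A).

Lemma manifold_convex_domain : convex_domain D.
Proof.
have sc := manifold_domain hM.
by split; [exact: domain_open sc|exact: domain_bounded sc|exact: domain_strictly_convex sc].
Qed.
Let hD := manifold_convex_domain.

Lemma act_matrix g : Gamma g -> exists B, chart_matrix D (act g) B.
Proof.
move=> Gg; have [] // := chart_matrix_exists (manifold_domain hM) (group_sub_PGL hM Gg).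
exact: group_preserves hM _ Gg.
Qed.

Lemma act_of_chart g x : Gamma g -> D x -> of_chart A (act g x) = g (of_chart A x).
Proof.
move=> Gg; have [+ _] := chart_matrix_exists (manifold_domain hM) (group_sub_PGL hM Gg)
  (group_preserves hM Gg).
exact.
Qed.

Lemma act_in g x : Gamma g -> D x -> D (act g x).
Proof. by move=> /act_matrix[B [_ HB]] /HB[]. Qed.

Lemma of_chartK x : to_chart A (of_chart A x) = x.
Proof.
have uA := chart_unit (manifold_domain hM).
rewrite /of_chart to_chart_proj_pt; last first.
  by rewrite mulmx_unit_neq0 ?unitmx_inv ?lift1_neq0.
by rewrite mulmxKV // height_lift rsubmx_lift invr1 scale1r.
Qed.

Lemma act_id x : act id x = x.
Proof. exact: of_chartK. Qed.

Lemma act_comp g h x : Gamma h -> D x -> act (g \o h) x = act g (act h x).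
Proof. by move=> Gh Dx; rewrite {2}/map_in_chart /= act_of_chart. Qed.

Lemma group_id : Gamma id.
Proof. by have [] := group_subgroup hM. Qed.

Lemma group_comp g h : Gamma g -> Gamma h -> Gamma (g \o h).
Proof. by have [_ + _] := group_subgroup hM; exact. Qed.

Lemma group_inv g : Gamma g -> exists2 h, Gamma h & h \o g = id /\ g \o h = id.
Proof.
have [_ _ /[apply] -[h Gh [c1 c2]]] := group_subgroup hM; exists h => //.
by split; apply/funext => y /=; rewrite ?c1 ?c2.
Qed.

Lemma act_invK g h x : Gamma g -> h \o g = id -> D x -> act h (act g x) = x.
Proof. by move=> Gg e Dx; rewrite -act_comp // e act_id. Qed.

Lemma act_hd g x y : Gamma g -> D x -> D y -> hd (act g x) (act g y) = hd x y.
Proof.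
move=> Gg Dx Dy; have le k u v : Gamma k -> D u -> D v -> hd (act k u) (act k v) <= hd u v.
  by move=> /act_matrix[B HB] Du Dv; exact: (chart_matrix_hd hD HB).
apply/le_anti; rewrite le //=.
have [h Gh [hg _]] := group_inv Gg.
by rewrite -{1}(act_invK Gg hg Dx) -{1}(act_invK Gg hg Dy) le //; exact: act_in.
Qed.

Lemma act_free g x : Gamma g -> D x -> act g x = x -> g = id.
Proof.
move=> Gg Dx e; apply: (group_free hM Gg Dx).
by rewrite -act_of_chart // e.
Qed.

(** The image stays on the ray spanned by the differential and keeps its distances, so [geo_unique]
    applies. The differential cannot kill [xi]: the isometry would send [x] and the point at time 1
    to the same point. *)
Lemma act_ray g x xi : Gamma g -> D x -> xi != 0 ->
  'd (act g) x xi != 0 /\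
  forall t, 0 <= t -> act g (geo D x xi t) = geo D (act g x) ('d (act g) x xi) t.
Proof.
move=> Gg Dx xi0; have [B HB] := act_matrix Gg.
rewrite (chart_matrix_diff HB) //; set v := chart_derivative _ _ _ _.
have line t : 0 <= t -> exists2 s, 0 <= s & act g (geo D x xi t) = act g x + s *: v.
  move=> t0; have [s s0 E] := geo_ray hD Dx xi0 t0.
  have [a0 _] := HB.2 x Dx.
  have [+ _] := HB.2 _ (geo_in hD t Dx xi0); rewrite E lift1D.
  rewrite mulmxDl heightD -scalemxAl heightZ => as0.
  rewrite (chart_matrix_line HB) //; last by rewrite gt_eqF.
  exists (s * height (lift1 x *m B) /
    (height (lift1 x *m B) + s * height (row_mx 0 xi *m B))) => //.
  by rewrite divr_ge0 ?mulr_ge0 // ltW.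
have v0 : v != 0.
  apply/eqP => v0; have [s _] := line 1 ler01; rewrite v0 scaler0 addr0 => e.
  have := act_hd Gg Dx (geo_in hD 1 Dx xi0); rewrite e hdxx geo_dist0 //.
  by rewrite normr1 => /eqP; rewrite eq_sym oner_eq0.
split=> // t t0; have [s s0 e] := line t t0; rewrite e.
have Dg := geo_in hD t Dx xi0.
apply: geo_unique => //; rewrite -?e; [exact: act_in|exact: act_in|].
by rewrite act_hd // geo_dist0 // ger0_norm.
Qed.

End Action.

(** * Orbit counting *)

Section LinearGrowth.
Variable R : realType.
Implicit Types (f g : R -> R) (L a b e r s : R).

(** Convergence of [f r / r] to [L], with the division cleared so that shifts, sums and squeezes
    reduce to linear arithmetic. *)
Definition linear_growth f L := forall e, 0 < e ->
  exists r0, forall r, r0 <= r -> `|f r - L * r| <= e * r.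

Lemma linear_growth_shift f L a b : linear_growth f L ->
  linear_growth (fun r => f (r + a) + b) L.
Proof.
move=> H e e0; have [r0 H0] := H (e / 2) ltac:(lra).
pose c := (e / 2 + `|L|) * `|a| + `|b|.
exists (Num.max (r0 - a) (c / (e / 2))) => r; rewrite ge_max => /andP[h1 h2].
have {}h2 : c <= e / 2 * r by rewrite mulrC -ler_pdivrMr //; lra.
have {}H0 := H0 (r + a) ltac:(lra).
have -> : f (r + a) + b - L * r = (f (r + a) - L * (r + a)) + (L * a + b) by ring.
rewrite (le_trans (ler_normD _ _)) //.
have k1 : `|L * a + b| <= `|L| * `|a| + `|b|.
  by rewrite (le_trans (ler_normD _ _)) // normrM.
have k2 : a <= `|a| by exact: ler_norm.
rewrite /c in h2; nra.
Qed.

Lemma linear_growth_squeeze f g h L r1 : linear_growth f L -> linear_growth h L ->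
  (forall r, r1 <= r -> f r <= g r <= h r) -> linear_growth g L.
Proof.
move=> Hf Hh H e e0; have [a Ha] := Hf e e0; have [b Hb] := Hh e e0.
exists (Num.max r1 (Num.max a b)) => r; rewrite !ge_max => /and3P[h1 h2 h3].
have := Ha r h2; have := Hb r h3; have := H r h1; rewrite !ler_norml; lra.
Qed.

Lemma linear_growthD f g L : linear_growth f L -> linear_growth g 0 ->
  linear_growth (fun r => f r + g r) L.
Proof.
move=> Hf Hg e e0; have [a Ha] := Hf (e / 2) ltac:(lra).
have [b Hb] := Hg (e / 2) ltac:(lra).
exists (Num.max a b) => r; rewrite !ge_max => /andP[h1 h2].
have := Ha r h1; have := Hb r h2; rewrite !ler_norml; lra.
Qed.

(** It absorbs the factor [t + 2] lost in [covering_lower]. Applying [ln u < u] to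
    [u = e / 2 * (r + 2)] makes the slope as small as required. *)
Lemma linear_growth_ln : linear_growth (fun r => - ln (r + 2)) 0.
Proof.
move=> e e0; exists (Num.max 1 ((1 - ln (e / 2) + e) / (e / 2))) => r.
rewrite ge_max => /andP[r1]; rewrite ler_pdivrMr; last lra.
move=> h; rewrite mul0r subr0 normrN ger0_norm; last by rewrite ln_ge0; lra.
have k0 : 0 < e / 2 by lra.
have : ln (e / 2 * (r + 2)) <= e / 2 * (r + 2).
  by apply/ltW/ln_sublinear; rewrite mulr_gt0 //; lra.
rewrite lnM ?posrE //; lra.
Qed.

Lemma linear_growth_cvg f L : linear_growth f L ->
  (r^-1 * f r) @[r --> +oo] --> L.
Proof.
move=> H; apply/cvgrPdist_le => e e0; have [r0 H0] := H e e0.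
near=> r; have r1 : 0 < r by near: r; exact: nbhs_pinfty_gt.
have h : r0 <= r by near: r; apply: nbhs_pinfty_ge; exact: num_real.
have -> : L - r^-1 * f r = - (r^-1 * (f r - L * r)) by field; lra.
rewrite normrN normrM gtr0_norm ?invr_gt0 // mulrC ler_pdivrMr //.
exact: H0.
Unshelve. all: by end_near. Qed.

(** Fekete's lemma for a real parameter: the limit is the infimum of [f r / r], and monotonicity
    interpolates between the multiples of a nearly optimal [r1]. *)
Lemma subadditive_growth f : (forall r s, 0 <= r -> r <= s -> f r <= f s) ->
  (forall r, 0 <= r -> 0 <= f r) ->
  (forall r s, 0 <= r -> 0 <= s -> f (r + s) <= f r + f s) ->
  exists L, linear_growth f L.
Proof.
move=> mono f0 sub; pose S := [set f r / r | r in [set r | 0 < r]].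
have hS : has_inf S.
  split; first by exists (f 1 / 1), 1 => //=.
  by exists 0 => _ [r /= r0 <-]; rewrite divr_ge0 ?f0 // ltW.
exists (inf S) => e e0.
have [_ [r1 /= r10 <-] hr1] := inf_adherent (eps := e / 2) ltac:(lra) hS.
(* The extra [r1] starts the induction at [f r1] and covers the remainder of [r] modulo [r1]. *)
have iter (k : nat) : f (k%:R * r1 + r1) <= k%:R * f r1 + f r1.
  elim: k => [|k IH]; first by rewrite !mul0r !add0r.
  rewrite -natr1 !mulrDl !mul1r.
  have := sub (k%:R * r1 + r1) r1 ltac:(by rewrite addr_ge0 ?mulr_ge0 // ltW) ltac:(lra).
  lra.
exists (Num.max r1 (f r1 / (e / 2))) => r; rewrite ge_max => /andP[h1 h2].
have r0 : 0 < r by lra.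
have {}h2 : f r1 <= e / 2 * r by rewrite mulrC -ler_pdivrMr //; lra.
have lo : inf S * r <= f r.
  rewrite -ler_pdivlMr //; apply: ge_inf; first by have [] := hS.
  by exists r.
rewrite ger0_norm ?subr_ge0 //.
have q0 : 0 <= r / r1 by rewrite divr_ge0 ?ltW.
have /andP[t1 t2] := truncn_itv q0; set k := Num.truncn _ in t1 t2.
rewrite ler_pdivlMr // in t1; rewrite ltr_pdivrMr // in t2.
have u1 : f r <= f (k%:R * r1 + r1).
  apply: mono; first lra.
  by move: t2; rewrite -natr1; lra.
have u2 := iter k.
have u3 : k%:R * f r1 <= (inf S + e / 2) * r.
  have v1 : f r1 <= (inf S + e / 2) * r1 by rewrite -ler_pdivrMr //; lra.
  apply: (@le_trans _ _ (k%:R * ((inf S + e / 2) * r1))).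
    by rewrite ler_wpM2l.
  have v2 : 0 <= inf S + e / 2.
    have : 0 <= f r1 / r1 by rewrite divr_ge0 ?f0 // ltW.
    lra.
  by rewrite mulrCA ler_wpM2l.
lra.
Qed.
End LinearGrowth.

(** If no finite subfamily covers [A], the complements of finite unions generate a proper filter; a
    cluster point of it lies in some [f i], whose complement belongs to the filter. Lists with
    [List.In] allow an arbitrary index type. *)
Lemma finite_subcover (T : topologicalType) (A : set T) (I : Type)
    (f : I -> set T) : compact A -> (forall i, open (f i)) ->
  A `<=` \bigcup_i f i ->
  exists s : seq I, forall x, A x -> exists2 i, List.In i s & f i x.
Proof.
move=> cA fo Af; apply: contrapT => nex.
pose U (s : seq I) := [set x | exists2 i, List.In i s & f i x].
pose F : set_system T := [set B | exists s, A `\` U s `<=` B].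
have nU s : exists x, A x /\ ~ U s x.
  apply: contrapT => h; apply: nex; exists s => x Ax.
  by apply: contrapT => h'; apply: h; exists x.
have FF : ProperFilter F.
  split; first by move=> [s hs]; have [x [Ax Ux]] := nU s; exact: (hs x).
  split; first by exists [::].
    move=> B C [s hs] [t ht]; exists (s ++ t) => x [Ax Ux]; split.
      by apply: hs; split=> // -[i si fi]; apply: Ux; exists i => //; apply/List.in_or_app; left.
    by apply: ht; split=> // -[i si fi]; apply: Ux; exists i => //; apply/List.in_or_app; right.
  by move=> B C BC [s hs]; exists s => x /hs /BC.
have [|p [Ap clp]] := cA F FF; first by exists [::] => x [].
have [i _ fip] := Af p Ap.
have Fi : F (A `\` f i).
  by exists [:: i] => x [Ax nU1]; split=> // fix_; apply: nU1; exists i => //; left.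
have ni : nbhs p (f i) by apply: open_nbhs_nbhs; split.
by have [x [[_ nf] fx]] := clp _ _ Fi ni.
Qed.

Lemma In_mem (T : eqType) (t : seq T) a : a \in t -> List.In a t.
Proof.
elim: t => // b t IH; rewrite inE => /orP[/eqP ->|/IH h]; first by left.
by right.
Qed.

Lemma seq_pos_lower (R : realType) (I : Type) (s : seq I) (f : I -> R) :
  (forall i, 0 < f i) -> exists2 e, 0 < e & forall i, List.In i s -> e <= f i.
Proof.
move=> f0; elim: s => [|i s [e e0 He]]; first by exists 1.
exists (Num.min e (f i)); first by rewrite lt_min e0 f0.
by move=> j [<-|/He h]; rewrite ge_min ?lexx ?orbT ?h.
Qed.

Lemma fset_set_card_seq (T : choiceType) (A : set T) (s : seq T) :
  finite_set A -> (forall x, A x -> x \in s) -> (#|` fset_set A | <= size s)%N.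
Proof.
move=> fA As; apply: uniq_leq_size; first exact: fset_uniq.
by move=> x; rewrite in_fset_set // => /set_mem /As.
Qed.

Section OrbitCounting.
Variables (R : realType) (n : nat) (A : 'M[R]_(1 + n)).
Variables (Omega : set (proj_space R n))
  (Gamma : set (proj_space R n -> proj_space R n)).
Hypothesis hM : compact_strictly_convex_projective_manifold A Omega Gamma.
Implicit Types (x y o xi : 'rV[R]_n).
Notation D := (in_chart A Omega).
Notation hd := (hdist D).
Notation act := (map_in_chart A).
Let hD := manifold_convex_domain hM.

(** By [hd_room] the points at distance less than [r] from [o] lie in one compact subset of [D], to
    which proper discontinuity applies. *)
Lemma finite_moves o (r : R) : D o -> finite_set [set g | Gamma g /\
  exists y, [/\ D y, hd o y < r & hd o (act g y) < r]].
Proof.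
move=> Do; have [e e0 ro] := domain_room hD Do.
have f0 : 0 < e * expR (- (2 * r)) by rewrite mulr_gt0 // expR_gt0.
have := group_properly_discontinuous hM (room_compact hD f0).
have sub : [set x | room D (e * expR (- (2 * r))) x] `<=` D.
  by move=> x; exact: (room_domain f0).
move=> /(_ sub); apply: sub_finite_set => g [Gg [y [Dy h1 h2]]]; split=> //.
exists (act g y); split; first by exists y => //; exact: (hd_room hD Do ro).
by apply: (hd_room hD Do ro) => //; exact: (act_in hM).
Qed.

Lemma open_hd_ball x r : D x -> open [set y | D y /\ hd x y < r].
Proof.
move=> Dx; rewrite openE => y [Dy xy].
have [|e e0 He] := hd_near (r := r - hd x y) hD Dy; first by rewrite subr_gt0.
rewrite /interior; apply/nbhs_ballP; exists e => //= z.
rewrite -ball_normE /= distrC => /He[Dz yz]; split=> //.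
have := hd_triangle hD Dx Dy Dz; lra.
Qed.

Lemma manifold_pi_eq (y z : set_type D) :
  \pi_(manifold A Omega Gamma)%qT y = \pi_(manifold A Omega Gamma)%qT z ->
  exists2 g, Gamma g & val z = act g (val y).
Proof.
move=> /eqquotP /asboolP; elim.
- by move=> u v [g Gg e]; exists g.
- by move=> u; exists id; [exact: group_id hM|rewrite (act_id hM)].
- move=> u v _ [g Gg e]; have [h Gh [hg _]] := group_inv hM Gg.
  by exists h => //; rewrite e (act_invK hM Gg hg) //; exact/set_mem/(valP u).
- move=> u v w _ [g Gg e] _ [h Gh e']; exists (h \o g).
    exact: group_comp hM _ _ Gh Gg.
  by rewrite (act_comp hM _ Gg) -?e ?e' //; exact/set_mem/(valP u).
Qed.

(** The classes with a representative at distance less than [k] from [o] form an increasing sequence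
    of open sets covering the compact quotient, so one of them is everything. *)
Lemma cocompact o : D o ->
  exists2 r, 0 < r & forall y, D y -> exists2 g, Gamma g & hd o (act g y) < r.
Proof.
move=> Do; pose M := manifold A Omega Gamma.
pose U (k : nat) : set M := [set q | exists2 y : set_type D,
  q = \pi_(M)%qT y & exists2 g, Gamma g & hd o (act g (val y)) < k%:R].
have oU k : open (U k).
  pose V := [set y | exists2 g, Gamma g & D y /\ hd o (act g y) < k%:R].
  have oV : open V.
    rewrite openE => y [g Gg [Dy hy]].
    have Dgy := act_in hM Gg Dy.
    have [|e e0 He] := hd_near (r := k%:R - hd o (act g y)) hD Dy.
      by rewrite subr_gt0.
    apply/nbhs_ballP; exists e => //= z.
    rewrite -ball_normE /= distrC => /He[Dz yz]; exists g => //; split=> //.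
    have := hd_triangle hD Do Dgy (act_in hM Gg Dz); rewrite (act_hd hM) //; lra.
  change (@open (set_type D) (\pi_(M)%qT @^-1` U k)).
  suff -> : \pi_(M)%qT @^-1` U k = val @^-1` V by exists V.
  apply/seteqP; split=> y /=.
    move=> [z /manifold_pi_eq[g Gg e] [h Gh hz]]; exists (h \o g).
      exact: group_comp hM _ _ Gh Gg.
    have Dy : D (val y) by exact/set_mem/(valP y).
    by split=> //; rewrite (act_comp hM _ Gg) // -e.
  by move=> [g Gg [Dy hy]]; exists y => //; exists g.
have [|s hs] := finite_subcover (manifold_compact hM) oU.
  move=> q _; pose y := repr q; exists (Num.truncn (hd o (val y))).+1 => //.
  exists y; first by rewrite reprK.
  exists id; first exact: group_id hM.
  by rewrite (act_id hM) truncnS_gt.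
have [b Hb] : exists b : nat, forall k, List.In k s -> (k <= b)%N.
  elim: s {hs} => [|k s [b Hb]]; first by exists 0%N.
  by exists (maxn k b) => j [->|/Hb h]; rewrite leq_max ?leqnn // h orbT.
exists (b.+1%:R); first by rewrite ltr0n.
move=> y Dy; have ymem : y \in D by exact/mem_set.
have [k /Hb kb [z /manifold_pi_eq[h Gh e] [g Gg hz]]] :=
  hs (\pi_(M)%qT (exist (fun y => y \in D) y ymem)) I.
exists (g \o h); first exact: group_comp hM _ _ Gg Gh.
rewrite (act_comp hM _ Gh) //; move: e; rewrite {2}/val /= => <-.
by rewrite (lt_le_trans hz) // ler_nat leqW.
Qed.

(* Freeness alone only gives [hd y (act g y) > 0]; cocompactness makes the
   bound uniform. *)
Lemma displacement : exists2 i, 0 < i &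
  forall g y, Gamma g -> D y -> hd y (act g y) < i -> g = id.
Proof.
have [p Op] := domain_nonempty (manifold_domain hM).
have [base _ o0E] := domain_sub_chart (manifold_domain hM) Op.
have Do : D base by rewrite /in_chart /= o0E.
have [r r0 Hr] := cocompact Do.
have [e e0 ro] := domain_room hD Do.
have f0 : 0 < e * expR (- (2 * r)) by rewrite mulr_gt0 // expR_gt0.
pose K := [set x | room D (e * expR (- (2 * r))) x].
have KD : K `<=` D by move=> x; exact: (room_domain f0).
have loc y : exists2 i, 0 < i & D y -> forall g, Gamma g -> hd y (act g y) < 2 * i -> g = id.
  have [Dy|nDy] := pselect (D y); last by exists 1.
  have [s hs] := (finite_seqP _).1 (finite_moves 1 Dy).
  (* The list contains the identity, which fixes [y]; the value 1 keeps the minimum positive. The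
     list only knows the elements that move [y] by less than 1, hence the cap [1 / 2] below. *)
  pose f g := if hd y (act g y) <= 0 then 1 else hd y (act g y) / 2.
  have [g|i i0 Hi] := @seq_pos_lower R _ s f.
    by rewrite /f; case: (leP (hd y (act g y)) 0) => // h; lra.
  exists (Num.min i (1 / 2)); first by rewrite lt_min i0; lra.
  move=> _ g Gg hg; have Dgy := act_in hM Gg Dy.
  apply: (act_free hM Gg Dy); apply/esym/eqP; apply: contraPT hg => ne.
  have pos := hd_gt0 hD Dy Dgy ne; apply/negP; rewrite -leNgt.
  have [h1|h1] := leP 1 (hd y (act g y)).
    have : Num.min i (1 / 2) <= 1 / 2 by rewrite ge_min lexx orbT.
    lra.
  have : g \in s.
    have : [set` s] g by rewrite -hs; split=> //; exists y; rewrite hdxx ltr01.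
    by [].
  move=> /In_mem /Hi; rewrite /f ifF; last by apply/negbTE; rewrite -ltNge.
  move=> h2.
  have : Num.min i (1 / 2) <= i by rewrite ge_min lexx.
  lra.
pose i_ y := sval (cid2 (loc y)).
have i_gt0 y : 0 < i_ y by rewrite /i_; case: cid2.
have i_P y : D y -> forall g, Gamma g -> hd y (act g y) < 2 * i_ y -> g = id.
  by rewrite /i_; case: cid2.
pose U y := [set z | D y /\ (D z /\ hd y z < i_ y / 2)].
have oU y : open (U y).
  have [Dy|nDy] := pselect (D y).
    suff -> : U y = [set z | D z /\ hd y z < i_ y / 2] by exact: open_hd_ball.
    by apply/seteqP; split=> z // -[].
  by suff -> : U y = set0 by [exact: open0]; apply/seteqP; split=> z // -[].
have [|s hs] := finite_subcover (room_compact hD f0) oU.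
  move=> y Ky; exists y => //; have Dy := KD _ Ky; do 2 split=> //.
  by rewrite hdxx divr_gt0.
have [i i0 Hi] := @seq_pos_lower R _ s i_ i_gt0.
exists i => // g y Gg Dy hg.
have [h Gh hy] := Hr y Dy; have [k Gk [kh hk]] := group_inv hM Gh.
have Dhy := act_in hM Gh Dy; have Dgy := act_in hM Gg Dy.
have Kz : K (act h y) by exact: (hd_room hD Do ro).
have [w sw [Dw [_ wz]]] := hs _ Kz.
(* The conjugate of [g] by [h] moves [act h y], a point of the compact set [K], as far as [g] moves
   [y]. Passing to the centre [w] costs twice [i_ w / 2], which stays within [2 * i_ w]. *)
have Gc : Gamma (h \o g \o k) by do 2 (apply: (group_comp hM) => //).
have ec : act (h \o g \o k) (act h y) = act h (act g y).
  by rewrite (act_comp hM _ Gk Dhy) (act_invK hM Gh kh Dy) (act_comp hM _ Gg Dy).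
suff cid_ : h \o g \o k = id.
  apply/funext => p'; have := congr1 (fun F => k (F (h p'))) cid_.
  have kE q : k (h q) = q by rewrite -[k _]/((k \o h) q) kh.
  by rewrite /= !kE.
apply: (i_P w Dw _ Gc).
have Dcw := act_in hM Gc Dw; have Dcz := act_in hM Gc Dhy.
have t1 := hd_triangle hD Dw Dhy Dcw; have t2 := hd_triangle hD Dhy Dcz Dcw.
have := Hi w sw; move: t2; rewrite ec (act_hd hM) // -ec [X in _ + X](act_hd hM) //.
rewrite [hd (act h y) w](hd_sym hD) //; lra.
Qed.

Lemma finite_orbit_ball o (r : R) : D o -> finite_set [set g | Gamma g /\ hd o (act g o) < r].
Proof.
move=> Do; apply: sub_finite_set (finite_moves (Num.max r 1) Do) => g [Gg h].
by split=> //; exists o; rewrite hdxx !lt_max h ltr01 orbT.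
Qed.

Definition orbit_count o (r : R) : nat :=
  #|` fset_set [set g | Gamma g /\ hd o (act g o) < r] |.

Lemma orbit_count_mono o (r s : R) : D o -> r <= s -> (orbit_count o r <= orbit_count o s)%N.
Proof.
move=> Do rs; apply: fset_set_card_seq; first exact: finite_orbit_ball.
move=> g [Gg h]; rewrite in_fset_set; last exact: finite_orbit_ball.
by apply/mem_set; split=> //; exact: lt_le_trans h rs.
Qed.

Lemma orbit_count_gt0 o (r : R) : D o -> 0 < r -> (0 < orbit_count o r)%N.
Proof.
move=> Do r0; rewrite cardfs_gt0; apply/fset0Pn; exists id.
rewrite in_fset_set; last exact: finite_orbit_ball.
by apply/mem_set; split; [exact: group_id hM|rewrite (act_id hM) hdxx].
Qed.

(** The geodesic from [o] to [act g o] is cut at a point [z], which some [h] brings within [c] of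
    [o]. Then [g] is the product of the inverse of [h] and [h \o g], which move [o] by less than
    [r + c] and [s + c]. *)
Lemma orbit_count_submul o (c : R) : D o -> 0 < c ->
  (forall y, D y -> exists2 g, Gamma g & hd o (act g y) < c) ->
  forall r s : R, 0 < r -> 0 < s ->
  (orbit_count o (r + s) <= orbit_count o (r + c) * orbit_count o (s + c))%N.
Proof.
move=> Do c0 Hc r s r0 s0.
have fB t := finite_orbit_ball t Do.
pose B t := [set g | Gamma g /\ hd o (act g o) < t].
rewrite /orbit_count -(size_allpairs (fun g h : proj_space R n -> _ => g \o h)).
apply: fset_set_card_seq => //.
move=> g [Gg hg]; have Dgo := act_in hM Gg Do.
have [z [Dz h1 h2]] : exists z, [/\ D z, hd o z < r & hd z (act g o) < s].
  have [e|ne] := eqVneq o (act g o); first by exists o; rewrite -e hdxx.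
  pose l := hd o (act g o); have l0 : 0 <= l by exact: hd_ge0.
  have xi0 : act g o - o != 0 by rewrite subr_eq0 eq_sym.
  (* A proportional cut: [l < r + s] keeps both parts strictly below [r] and [s]. *)
  pose t := l * r / (r + s); have rs0 : 0 < r + s by lra.
  have t0 : 0 <= t by rewrite divr_ge0 ?mulr_ge0 // ltW.
  have tr : t < r by rewrite ltr_pdivrMr // mulrC ltr_pM2l.
  have lt : l - t < s.
    have -> : l - t = l * s / (r + s) by rewrite /t; field; lra.
    by rewrite ltr_pdivrMr // mulrC ltr_pM2l.
  have tl : t <= l by rewrite ler_pdivrMr // ler_wpM2l //; lra.
  exists (geo D o (act g o - o) t); split; first exact: geo_in.
    by rewrite geo_dist0 // ger0_norm.
  rewrite -{2}(geo_through hD Do Dgo ne) geo_dist // ler0_norm; rewrite -/l; lra.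
have [h Gh hz] := Hc z Dz; have [k Gk [kh hk]] := group_inv hM Gh.
have Dhz := act_in hM Gh Dz; have Dko := act_in hM Gk Do.
apply/allpairsP; exists (k, h \o g) => /=; split; last first.
- by apply/funext => p' /=; rewrite -[RHS]/((k \o h) (g p')) kh.
- rewrite in_fset_set //; apply/mem_set; split.
    exact: group_comp hM _ _ Gh Gg.
  rewrite (act_comp hM _ Gg) //.
  have := hd_triangle hD Do Dhz (act_in hM Gh Dgo).
  rewrite (act_hd hM) //; lra.
- rewrite in_fset_set //; apply/mem_set; split=> //.
  have := hd_triangle hD Do Dz Dko.
  have -> : hd z (act k o) = hd (act h z) o.
    by rewrite -(act_hd hM Gh Dz Dko) (act_invK hM Gk hk).
  rewrite (hd_sym hD Dhz Do); lra.
Qed.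

Lemma orbit_count_growth o : D o ->
  exists L, linear_growth (fun r => ln (orbit_count o r)%:R) L.
Proof.
move=> Do; have [c c0 Hc] := cocompact Do.
have N0 (r : R) : 0 < r -> 0 < (orbit_count o r)%:R :> R.
  by move=> r0; rewrite ltr0n orbit_count_gt0.
have lnmono (r s : R) : 0 < r -> r <= s ->
    ln (orbit_count o r)%:R <= ln (orbit_count o s)%:R :> R.
  move=> r0 rs; have s0 : 0 < s by lra.
  by rewrite ler_ln ?posrE ?N0 // ler_nat orbit_count_mono.
(* The shift by [c + c] absorbs the loss: [r + s + (c + c)] splits into [r + c] and [s + c], and
   each part gains another [c] from [orbit_count_submul]. *)
pose W r : R := ln (orbit_count o (r + (c + c)))%:R.
have [L HL] : exists L, linear_growth W L.
  apply: subadditive_growth => [r s r0 rs|r r0|r s r0 s0].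
  - by apply: lnmono; lra.
  - by rewrite ln_ge0 // ler1n orbit_count_gt0 //; lra.
  have -> : W (r + s) = ln (orbit_count o ((r + c) + (s + c)))%:R.
    by congr (ln (orbit_count o _)%:R); ring.
  rewrite /W -lnM ?posrE; [|by apply: N0; lra..].
  rewrite ler_ln ?posrE; [|by apply: N0; lra|by apply: mulr_gt0; apply: N0; lra].
  rewrite -natrM ler_nat ![_ + (c + c)]addrA.
  by apply: (orbit_count_submul Do c0 Hc); lra.
exists L; have := linear_growth_shift (- (c + c)) 0 HL.
congr (linear_growth _ L); apply/funext => r.
by rewrite /W subrK addr0.
Qed.

End OrbitCounting.

(** * Volume growth *)

Section Grid.
Variables (R : realType).

Lemma row_norm_le (n : nat) (v : 'rV[R]_n) c :
  (`|v| <= c) <-> (0 <= c /\ forall i, `|v 0 i| <= c).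
Proof.
have -> : `|v| = mx_norm v by [].
rewrite mx_normrE; split=> [h|[c0 h]].
  split; first by apply: le_trans h; exact: bigmax_ge_id.
  move=> i; apply: le_trans h.
  exact: (@le_bigmax _ _ _ 0 (fun i : 'I_1 * 'I_n => `|v i.1 i.2|) (0, i)).
by apply: bigmax_le => // -[i j] _ /=; rewrite ord1.
Qed.

Lemma card_grid_interval (N : nat) (a b r : R) : 0 < b -> 0 < r ->
  (#|[pred j : 'I_N | `|a + b * (j : nat)%:R| < r]|%:R : R) <= 2 * r / b + 1.
Proof.
move=> b0 r0; set P := [pred j : 'I_N | _].
have c0 : 0 <= 2 * r / b by rewrite divr_ge0 ?mulr_ge0 // ltW.
have [j0 Pj0|Pn] := pickP P; last by rewrite eq_card0 // addr_ge0.
pose m := [arg min_(j < j0 | P j) (j : nat)].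
have [Pm mP] : P m /\ forall j, P j -> (m <= j)%N.
  by rewrite /m; case: arg_minnP.
pose k := (Num.truncn (2 * r / b)).+1.
have bound j : P j -> (j - m < k)%N.
  move=> Pj; have mj := mP _ Pj; rewrite ltnS.
  rewrite truncn_ge_nat // natrB // ler_pdivlMr //.
  move: Pj Pm; rewrite /P !inE !ltr_norml; lra.
have : (#|P| <= #|'I_k|)%N.
  apply: (@leq_card_in _ _ (fun j : 'I_N => inord (j - m) : 'I_k)).
  move=> i j Pi Pj /(congr1 (fun u : 'I_k => (u : nat))).
  rewrite !inordK ?bound // => e; apply/val_inj.
  by rewrite /= -(subnK (mP _ Pi)) -(subnK (mP _ Pj)) e.
rewrite card_ord -(ler_nat R) => /le_trans; apply.
by rewrite /k -natr1 lerD2r; have /andP[] := truncn_itv c0.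
Qed.

Lemma foldr_muln_le (T : Type) (F : T -> nat) (s : seq T) (b : R) :
  (forall i, (F i)%:R <= b) -> ((foldr muln 1 [seq F i | i <- s])%:R : R) <= b ^+ size s.
Proof.
move=> H; elim: s => [|i s IH] /=; first by rewrite expr0.
rewrite natrM exprS; apply: ler_pM => //; exact: ler0n.
Qed.

Lemma exprD_le (n : nat) (a b : R) : 0 <= a -> 0 <= b ->
  (a + b) ^+ n <= 2 ^+ n * (a ^+ n + b ^+ n).
Proof.
move=> a0 b0; wlog ab : a b a0 b0 / a <= b.
  by move=> H; case: (leP a b) => [|/ltW] h; [|rewrite addrC [_ ^+ n + _]addrC]; exact: H.
apply: (@le_trans _ _ ((2 * b) ^+ n)).
  by rewrite lerXn2r ?nnegrE //; lra.
by rewrite exprMn ler_pM2l ?exprn_gt0 // lerDr exprn_ge0.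
Qed.

Variables (n : nat).
Hypothesis n0 : (0 < n)%N.

(* Comparison of covers with a fine grid replaces Lebesgue measure. *)
Lemma cube_cover_finite (o : 'rV[R]_n) (rho : R) (k : nat) (a : nat -> 'rV[R]_n)
    (r : nat -> R) : 0 < rho -> (forall i, 0 < r i) ->
  (forall x, `|x - o| <= rho -> exists2 i, (i < k)%N & `|x - a i| < r i) ->
  (rho / 4) ^+ n <= \sum_(i < k) r i ^+ n.
Proof.
move=> rho0 r0 cover.
have [e e0 He] : exists2 e, 0 < e & forall i : 'I_k, e <= r i.
  have [e e0 He] := @seq_pos_lower R _ (iota 0 k) r r0; exists e => // i.
  by apply: He; have := mem_iota 0 k i; rewrite add0n ltn_ord => /In_mem.
(* The mesh [b = rho / N] is at most twice the smallest radius, so the [+ 1] of [card_grid_interval]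
   is at most [2 * r i / b], and a ball holds at most [(4 * r i / b) ^+ n] grid points. *)
pose N := (Num.truncn (rho / (2 * e))).+1.
have N0 : 0 < N%:R :> R by rewrite ltr0n.
have Ne : rho <= 2 * e * N%:R.
  have := truncnS_gt (rho / (2 * e)); rewrite -/N ltr_pdivrMr; last lra.
  by rewrite mulrC => /ltW.
pose b := rho / N%:R; have b0 : 0 < b by rewrite divr_gt0.
pose pt (j : {ffun 'I_n -> 'I_N}) : 'rV[R]_n := \row_l (o 0 l + b * (j l : nat)%:R).
have inC j : `|pt j - o| <= rho.
  apply/row_norm_le; split; first exact: ltW.
  move=> l; rewrite !mxE addrAC subrr add0r ger0_norm ?(mulr_ge0 (ltW b0)) //.
  rewrite /b mulrAC ler_pdivrMr // ler_pM2l // ler_nat.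
  by rewrite ltnW.
pose S (i : 'I_k) := [set j | `|pt j - a i| < r i]%SET.
have covS : (#|{ffun 'I_n -> 'I_N}| <= \sum_(i < k) #|S i|)%N.
  rewrite -sum1_card; under [X in (_ <= X)%N]eq_bigr do rewrite -sum1_card big_mkcond.
  rewrite exchange_big /=; apply: leq_sum => j _.
  have [i ik hi] := cover _ (inC j).
  rewrite (bigD1 (Ordinal ik)) //= {1}/S inE hi; exact: leq_addr.
have cardS i : (#|S i|%:R : R) <= (4 * r i / b) ^+ n.
  pose F (l : 'I_n) := [pred j : 'I_N | `|(o 0 l - a i 0 l) + b * (j : nat)%:R| < r i].
  have SF : (#|S i| <= #|family F|)%N.
    apply: fintype.subset_leq_card; apply/fintype.subsetP => j; rewrite inE => h.
    apply/familyP => l; rewrite inE.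
    have -> : o 0 l - a i 0 l + b * (j l : nat)%:R = (pt j - a i) 0 l.
      by rewrite !mxE addrAC.
    by apply: le_lt_trans h; have [+ _] := row_norm_le (pt j - a i) `|pt j - a i|; case.
  apply: (@le_trans _ _ #|family F|%:R); first by rewrite ler_nat.
  rewrite card_family /image_mem -[X in _ <= _ ^+ X](card_ord n) cardE.
  apply: foldr_muln_le => l.
  apply: (le_trans (card_grid_interval N (o 0 l - a i 0 l) b0 (r0 i))).
  have : 1 <= 2 * r i / b.
    rewrite ler_pdivlMr // mul1r /b ler_pdivrMr //.
    by apply: (le_trans Ne); rewrite ler_pM2r // ler_pM2l // He.
  lra.
have main : N%:R ^+ n <= \sum_(i < k) (4 * r i / b) ^+ n :> R.
  rewrite -natrX; apply: (@le_trans _ _ (\sum_(i < k) #|S i|)%:R).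
    by rewrite ler_nat; move: covS; rewrite card_ffun !card_ord.
  by rewrite natr_sum; apply: ler_sum => i _.
have E (i : nat) : (4 * r i / b) ^+ n = (4 / rho) ^+ n * N%:R ^+ n * r i ^+ n.
  by rewrite -!exprMn; congr (_ ^+ _); rewrite /b; field; lra.
rewrite (eq_bigr _ (fun (i : 'I_k) _ => E i)) -mulr_sumr in main.
rewrite mulrAC -[X in X <= _]mul1r ler_pM2r ?exprn_gt0 // in main.
have -> : rho / 4 = (4 / rho)^-1 by rewrite invf_div.
by rewrite exprVn -[X in X <= _]mulr1 ler_pdivrMl // exprn_gt0 // divr_gt0.
Qed.

(** Each set is enlarged to an open ball of radius [s i + t i] about one of its points, with [t i]
    summable; compactness then leaves finitely many. The inequality [exprD_le] turns [rho / 4] into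
    [rho / 8]. *)
Lemma cube_cover_series (o : 'rV[R]_n) (rho : R) (V : nat -> set 'rV[R]_n)
    (s : nat -> R) : 0 < rho -> (forall i, 0 <= s i) ->
  (forall i x y, V i x -> V i y -> `|x - y| <= s i) ->
  [set x | `|x - o| <= rho] `<=` \bigcup_i V i ->
  exists k, (rho / 8) ^+ n / 2 <= \sum_(i < k) s i ^+ n.
Proof.
move=> rho0 s0 sV cover.
(* The enlargement may cost half of the bound; [th <= 1] ensures [t i ^+ n <= t i]. *)
pose th := Num.min ((rho / 8) ^+ n / 2) 1.
have th0 : 0 < th by rewrite lt_min ltr01 divr_gt0 // exprn_gt0 // divr_gt0.
pose t i := th / 2 ^+ i.+1.
have t0 i : 0 < t i by rewrite divr_gt0 // exprn_gt0.
have t1 i : t i <= 1.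
  rewrite ler_pdivrMr ?exprn_gt0 // mul1r (@le_trans _ _ 1) ?ge_min ?lexx ?orbT //.
  by rewrite exprn_ege1 // ler1n.
have st k : \sum_(i < k) t i <= th.
  suff -> : \sum_(i < k) t i = th - th / 2 ^+ k.
    by rewrite gerBl divr_ge0 ?ltW // exprn_gt0.
  elim: k => [|k IH]; first by rewrite big_ord0 expr0 divr1 subrr.
  by rewrite big_ord_recr /= IH /t exprS; field; rewrite expf_neq0.
pose a i := xget o (V i).
pose r i := s i + t i.
have r0 i : 0 < r i by rewrite ltr_wpDl.
have [|||l hl] := @finite_subcover _ [set x | `|x - o| <= rho] nat
   (fun i => [set x | `|x - a i| < r i]).
- apply: bounded_closed_compact.
    exists (rho + `|o|); split; first exact: num_real.
    move=> M hM x /= hx; rewrite -[x](subrK o).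
    by rewrite (le_trans (ler_normD _ _)) // ltW // (le_lt_trans _ hM) // lerD2r.
  move=> x cx /=; apply/ler_addgt0Pr => e e0.
  have : nbhs x (ball x e) by exact: nbhsx_ballx.
  move=> /cx [y [/= hy]]; rewrite -ball_normE /= => xy.
  rewrite -[x](subrK y) -addrA (le_trans (ler_normD _ _)) //.
  by rewrite [rho + e]addrC lerD // ltW.
- move=> i; rewrite openE => x /= hx; apply/nbhs_ballP.
  exists (r i - `|x - a i|); rewrite /= ?subr_gt0 // => y.
  rewrite -ball_normE /= => xy; rewrite -[y](subrK x) -addrA.
  by rewrite (le_lt_trans (ler_normD _ _)) // distrC -ltrBrDr.
- move=> x hx; have [i _ Vx] := cover x hx; exists i => //=.
  rewrite (le_lt_trans _ (_ : s i < r i)) ?ltrDl //; apply: sV => //.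
  by rewrite /a; case: xgetP => [y _ //|/(_ x)].
have [k Hk] : exists k : nat, forall i, List.In i l -> (i < k)%N.
  elim: l {hl} => [|i l [k Hk]]; first by exists 0%N.
  by exists (maxn i.+1 k) => j [->|/Hk h]; rewrite leq_max ?leqnn // h orbT.
exists k.
have := @cube_cover_finite o rho k a r rho0 r0.
have cov x : `|x - o| <= rho -> exists2 i, (i < k)%N & `|x - a i| < r i.
  by move=> /hl [i /Hk]; exists i.
move=> /(_ cov) h1.
have h2 : \sum_(i < k) r i ^+ n <= 2 ^+ n * (\sum_(i < k) s i ^+ n + th).
  apply: (@le_trans _ _ (\sum_(i < k) 2 ^+ n * (s i ^+ n + t i))).
    apply: ler_sum => i _; apply: (le_trans (exprD_le _ _ _)) => //; first exact: ltW.
    rewrite ler_pM2l ?exprn_gt0 // lerD2l.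
    rewrite -[X in _ <= X]expr1 ler_wiXn2l ?(ltW (t0 _)) //.
  rewrite -mulr_sumr ler_pM2l ?exprn_gt0 // big_split /= lerD2l; exact: st.
have : (rho / 8) ^+ n <= \sum_(i < k) s i ^+ n + th.
  have -> : rho / 8 = rho / 4 / 2 by field.
  rewrite expr_div_n ler_pdivrMr ?exprn_gt0 // [_ * 2 ^+ n]mulrC.
  exact: le_trans h1 h2.
have : th <= (rho / 8) ^+ n / 2 by rewrite ge_min lexx.
lra.
Qed.
End Grid.

(** * Diameters and bounds for Hausdorff measures *)

Section Diameter.
Local Open Scope ereal_scope.
Variables (R : realType) (T : Type) (d : T -> T -> \bar R).
Implicit Types (U V : set T).

Lemma diameter_ge0 U : 0 <= diameter d U.
Proof. by rewrite /diameter le_max lexx. Qed.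

Lemma diameter_ub U x y : U x -> U y -> d x y <= diameter d U.
Proof.
move=> Ux Uy; rewrite /diameter le_max; apply/orP; right.
by apply: ereal_sup_ubound; exists (x, y).
Qed.

Lemma diameter_le U c : 0 <= c -> (forall x y, U x -> U y -> d x y <= c) ->
  diameter d U <= c.
Proof.
move=> c0 H; rewrite /diameter ge_max c0 /=; apply: ge_ereal_sup.
by move=> _ [[x y] [/= Ux Uy] <-]; exact: H.
Qed.

Lemma diameter_sub U V : U `<=` V -> diameter d U <= diameter d V.
Proof.
move=> UV; apply: diameter_le; first exact: diameter_ge0.
by move=> x y /UV Vx /UV Vy; exact: diameter_ub.
Qed.

Lemma diameter0 : diameter d set0 = 0.
Proof. by apply/le_anti; rewrite diameter_ge0 andbT; exact: diameter_le. Qed.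

Lemma diameter0_expn k : (0 < k)%N -> diameter d set0 ^+ k = 0.
Proof. by rewrite diameter0; case: k => // k _; rewrite expeS mul0e. Qed.

Lemma diameter_expn_ge0 U k : 0 <= diameter d U ^+ k.
Proof. by apply: expe_ge0; exact: diameter_ge0. Qed.

Lemma diameter_expn_le U (a : R) k : diameter d U <= a%:E ->
  diameter d U ^+ k <= (a ^+ k)%:E.
Proof.
have := diameter_ge0 U; case: (diameter d U) => // r.
by rewrite !lee_fin -EFin_expe lee_fin => r0 ra; rewrite lerXn2r ?nnegrE //; exact: le_trans ra.
Qed.
End Diameter.

Section HausdorffBounds.
Variables (R : realType) (T : Type) (D : set T) (d : T -> T -> R) (k : nat).
Hypothesis k0 : (0 < k)%N.
Notation diam := (diameter (fun x y => (d x y)%:E)).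

(** A finite cover is continued by empty sets, which contribute zero since [0 < k]. The bound [c] is
    uniform in [delta] because the measure is a supremum over [delta]. *)
Lemma hausdorff_measure_le (S : set T) (c : R) :
  (forall delta, 0 < delta -> exists2 a : R, 0 <= a <= delta &
     exists l : seq (set T),
       [/\ forall U, U \in l -> U `<=` D /\ (diam U <= a%:E)%E,
           forall x, S x -> exists2 U, U \in l & U x &
           (size l)%:R * a ^+ k <= c]) ->
  (hausdorff_measure D d k S <= c%:E)%E.
Proof.
move=> H; apply: ge_ereal_sup => _ [delta /= delta0 <-].
have [a /andP[a0 ad] [l [Hl Sl ac]]] := H delta delta0.
pose U i := nth set0 l i.
have HU i : U i `<=` D /\ (diam (U i) <= a%:E)%E.
  have [il|il] := ltnP i (size l).
    by apply: Hl; exact: mem_nth.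
  by rewrite /U nth_default // diameter0 lee_fin; split.
apply: (@le_trans _ _ (\sum_(0 <= i <oo) diam (U i) ^+ k)%E).
  apply: ereal_inf_lbound; exists U => //; split.
    move=> i; have [h1 h2] := HU i; split=> //.
    by apply: le_trans h2 _; rewrite lee_fin.
  move=> x /Sl [W Wl Wx]; exists (index W l) => //; by rewrite /U nth_index.
apply: lime_le; first by apply: is_cvg_nneseries => i _ _; exact: diameter_expn_ge0.
apply: nearW => N; apply: (@le_trans _ _
  (\sum_(0 <= i < N) (if (i < size l)%N then (a ^+ k)%:E else 0%E))%E).
  apply: lee_sum => i _; case: ltnP => il; first by apply: diameter_expn_le; have [] := HU i.
  by rewrite /U nth_default // diameter0_expn.
rewrite -big_mkcond /= big_mkord.
have -> : (\sum_(i < N | (i < size l)%N) (a ^+ k)%:E =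
    (#|[pred i : 'I_N | (i < size l)%N]|%:R * a ^+ k)%:E)%E.
  by rewrite sumEFin sumr_const mulr_natl.
rewrite lee_fin; apply: le_trans ac; rewrite ler_wpM2r ?exprn_ge0 // ler_nat.
have [m|m] := leqP N (size l).
  by apply: leq_trans (max_card _) _; rewrite card_ord.
have : (#|[pred i : 'I_N | (i < size l)%N]| <= #|'I_(size l)|)%N.
  have s0 : (0 < size l)%N || (size l == 0)%N by case: (size l).
  case/orP: s0 => [s0|/eqP s0]; last by rewrite s0 eq_card0.
  apply: (@leq_card_in _ _ (fun i : 'I_N => insubd (Ordinal s0) (i : nat))).
  move=> i j; rewrite !inE => ik jk /(congr1 val).
  by rewrite !val_insubd ik jk => /val_inj.
by rewrite card_ord.
Qed.

(* If the pieces [W g] are far apart, a fine cover of their union splits into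
   covers of the single pieces. *)
Lemma hausdorff_measure_ge (I : eqType) (s : seq I) (W : I -> set T) (S : set T)
    (delta v : R) : 0 < delta -> uniq s ->
  (forall g, g \in s -> W g `<=` S) ->
  (forall g h x y, g \in s -> h \in s -> W g x -> W h y -> d x y <= delta -> g = h) ->
  (forall g (U : nat -> set T), g \in s ->
    (forall i, U i `<=` D /\ (diam (U i) <= delta%:E)%E) ->
    W g `<=` \bigcup_i U i -> (v%:E <= \sum_(0 <= i <oo) diam (U i) ^+ k)%E) ->
  (((size s)%:R * v)%:E <= hausdorff_measure D d k S)%E.
Proof.
move=> delta0 us WS sep low.
apply: (@le_trans _ _ (ereal_inf [set (\sum_(0 <= i <oo) diam (U i) ^+ k)%E | U in
      [set U : nat -> set T |
        (forall i, U i `<=` D /\ (diam (U i) <= delta%:E)%E) /\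
        S `<=` \bigcup_i U i]])); last first.
  by apply: ereal_sup_ubound; exists delta.
apply: le_ereal_inf_tmp => _ [U [HU SU] <-].
apply: (@le_trans _ _ (\sum_(g <- s) \sum_(0 <= i <oo) diam (U i `&` W g) ^+ k)%E).
  have -> : (((size s)%:R * v)%:E = \sum_(g <- s) v%:E :> \bar R)%E.
    by rewrite sumEFin big_const_seq count_predT iter_addr addr0 mulr_natl.
  rewrite big_seq [X in (_ <= X)%E]big_seq; apply: lee_sum => g gs.
  apply: (low g) => // [i|x Wx].
    have [h1 h2] := HU i; split; first by move=> x [/h1].
    by apply: le_trans h2; apply: diameter_sub; exact: subIsetl.
  by have [i _ Ui] := SU _ (WS _ gs _ Wx); exists i.
rewrite -nneseries_sum; last by move=> *; exact: diameter_expn_ge0.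
apply: lee_nneseries => [i _ _|i _].
  by apply: sume_ge0 => *; exact: diameter_expn_ge0.
have [[g [gs [x [Ux Wx]]]]|nex] := pselect (exists g, g \in s /\ (U i `&` W g) !=set0).
  rewrite (perm_big _ (perm_to_rem gs)) big_cons big1_seq /=.
    have -> (u : \bar R) : (u + 0 = u)%R by exact: adde0.
    have := diameter_sub (fun x y => (d x y)%:E) (@subIsetl _ (U i) (W g)).
    have [_] := HU i; have := diameter_ge0 (fun x y => (d x y)%:E) (U i).
    case: (diameter _ (U i)) => // r _ _ h.
    by rewrite -EFin_expe; exact: diameter_expn_le.
  move=> h; rewrite mem_rem_uniq // inE => /andP[hg hs].
  suff -> : U i `&` W h = set0 by rewrite diameter0_expn.
  apply/seteqP; split=> // y [Uy Wy]; move/eqP: hg; apply.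
  apply: (sep h g y x) => //; rewrite -lee_fin.
  apply: le_trans (HU i).2.
  exact: (diameter_ub (fun x y => (d x y)%:E)).
rewrite big1_seq ?diameter_expn_ge0 // => g /andP[_ gs].
suff -> : U i `&` W g = set0 by rewrite diameter0_expn.
by apply/seteqP; split=> // y Uy; apply: nex; exists g; split=> //; exists y.
Qed.
End HausdorffBounds.

Section VolumeBounds.
Variables (R : realType) (n : nat) (A : 'M[R]_(1 + n)).
Variables (Omega : set (proj_space R n))
  (Gamma : set (proj_space R n -> proj_space R n)).
Hypothesis hM : compact_strictly_convex_projective_manifold A Omega Gamma.
Hypothesis n0 : (0 < n)%N.
Implicit Types (x y o xi : 'rV[R]_n).
Notation D := (in_chart A Omega).
Notation hd := (hdist D).
Notation act := (map_in_chart A).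
Notation diam := (diameter (fun x y => (hd x y)%:E)).
Let hD := manifold_convex_domain hM.
Notation vol := (hausdorff_measure D hd n).
Notation hball o r := [set y | D y /\ hd o y < r].

(** A point of the ball is a translate of a point with room [e], by an element that moves [o] by
    less than [r + c]. The points with room [e] are cut into grid cells of side [h], whose Hilbert
    diameter is at most [h / e] by [hd_le_norm]. *)
Lemma volume_upper o : D o -> exists2 c, 0 < c & exists2 C : R, 0 < C &
  forall r, (vol (hball o r) <= (C * (orbit_count A Omega Gamma o (r + c))%:R)%:E)%E.
Proof.
move=> Do; have [c c0 Hc] := cocompact hM Do; exists c => //.
have [e0 e00 ro] := domain_room hD Do.
pose e := e0 * expR (- (2 * c)).
have e_gt0 : 0 < e by rewrite mulr_gt0 // expR_gt0.
have [M0 [_ HM0]] := cd_bounded hD; pose M : R := `|M0| + 1.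
have M1 : 1 <= M by rewrite lerDr.
have HM y : D y -> `|y| <= M.
  by move=> Dy; apply: HM0 => //; rewrite /M; have := ler_norm M0; lra.
(* Each coordinate has [m + 1] cells of side [2 * M / m], the last one for the value [M] itself, and
   [(m + 1) * (2 * M / m) <= 4 * M] whatever the mesh. *)
exists ((4 * M / e) ^+ n); first by rewrite exprn_gt0 // divr_gt0 //; lra.
move=> r; apply: (hausdorff_measure_le n0) => delta delta0.
pose m := (Num.truncn (2 * M / (e * delta))).+1.
have m0 : 0 < m%:R :> R by rewrite ltr0n.
have hm : 2 * M / (e * delta) <= m%:R by apply/ltW/truncnS_gt.
pose h := 2 * M / m%:R; have h0 : 0 < h by rewrite divr_gt0 //; lra.
exists (h / e).
  apply/andP; split; first by rewrite divr_ge0 // ltW.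
  rewrite ler_pdivrMr // /h ler_pdivrMr //.
  move: hm; rewrite ler_pdivrMr; last exact: mulr_gt0.
  by rewrite [m%:R * _]mulrC [e * delta]mulrC.
pose cell (j : {ffun 'I_n -> 'I_m.+1}) := [set y | [/\ D y, room D e y &
  forall l, Num.truncn ((y 0 l + M) / h) = j l]].
pose G := fset_set [set g | Gamma g /\ hd o (act g o) < r + c].
exists [seq act g @` cell j | g <- G, j <- enum {ffun 'I_n -> 'I_m.+1}].
have coord y l : D y -> 0 <= (y 0 l + M) / h <= m%:R.
  move=> /HM /row_norm_le[_ /(_ l)]; rewrite ler_norml => /andP[h1 h2].
  rewrite divr_ge0 ?(ltW h0) //=; last lra.
  by rewrite ler_pdivrMr // /h mulrC divfK ?gt_eqF //; lra.
have GP g : g \in G -> Gamma g.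
  by rewrite in_fset_set; [move=> /set_mem[]|exact: (finite_orbit_ball hM)].
split.
- move=> _ /allpairsP[[g j] /= [/GP Gg _ ->]]; split.
    by move=> _ [y [Dy _ _] <-]; exact: (act_in hM).
  apply: diameter_le; first by rewrite lee_fin divr_ge0 // ltW.
  move=> _ _ [y [Dy ry yj] <-] [z [Dz rz zj] <-]; rewrite lee_fin (act_hd hM) //.
  apply: (le_trans (hd_le_norm hD e_gt0 ry rz Dy Dz)).
  rewrite ler_pM2r ?invr_gt0 //; apply/row_norm_le; split; first exact: ltW.
  move=> l; rewrite !mxE; have /andP[y1 _] := coord y l Dy.
  have /andP[z1 _] := coord z l Dz.
  have /andP[a1 a2] := truncn_itv y1; have /andP[b1 b2] := truncn_itv z1.
  rewrite yj ler_pdivlMr // in a1; rewrite yj ltr_pdivrMr // -natr1 in a2.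
  rewrite zj ler_pdivlMr // in b1; rewrite zj ltr_pdivrMr // -natr1 in b2.
  by rewrite ler_norml; apply/andP; split; lra.
- move=> y [Dy oy]; have [g Gg gy] := Hc y Dy; have [k Gk [kg gk]] := group_inv hM Gg.
  have Dgy := act_in hM Gg Dy; have Dgo := act_in hM Gg Do.
  have Dko := act_in hM Gk Do.
  have kG : k \in G.
    rewrite in_fset_set; [apply/mem_set; split=> //|exact: (finite_orbit_ball hM)].
    have -> : hd o (act k o) = hd (act g o) o.
      by rewrite -(act_hd hM Gg Do Dko) (act_invK hM Gk gk).
    have := hd_triangle hD Dgo Dgy Do; rewrite (act_hd hM) // (hd_sym hD Dgy Do); lra.
  pose j : {ffun 'I_n -> 'I_m.+1} := [ffun l => inord (Num.truncn ((act g y 0 l + M) / h))].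
  exists (act k @` cell j).
    by apply/allpairsP; exists (k, j); rewrite mem_enum.
  exists (act g y); last exact: (act_invK hM Gg kg).
  split=> //; first exact: (hd_room hD Do ro).
  move=> l; rewrite ffunE inordK // ltnS.
  have /andP[t0 t1] := coord _ l Dgy.
  by rewrite -(ler_nat R) (le_trans _ t1) // truncn_le.
- rewrite size_allpairs -cardE card_ffun !card_ord natrM natrX.
  rewrite -mulrA [X in _ <= X]mulrC -/(orbit_count A Omega Gamma o (r + c)).
  rewrite ler_wpM2l // -exprMn lerXn2r ?nnegrE //.
  + by rewrite mulr_ge0 // divr_ge0 // ltW.
  + by rewrite divr_ge0 ?(ltW e_gt0) //; lra.
  rewrite mulrA ler_pM2r ?invr_gt0 // /h mulrA ler_pdivrMr //.
  have : 1 <= m%:R :> R by rewrite ler1n.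
  rewrite -natr1; nra.
Qed.

(** A cover of one translate of the small ball is pulled back by the inverse isometry to a cover of
    a norm ball about [o], where [cube_cover_series] gives a bound independent of the translate;
    [norm_le_hd] converts the diameters. *)
Lemma volume_lower o : D o -> exists2 v : R, 0 < v &
  forall r, ((v * (orbit_count A Omega Gamma o (r - 1))%:R)%:E <= vol (hball o r))%E.
Proof.
move=> Do; have [i i0 Hi] := displacement hM.
have [C C0 HC] := norm_le_hd hD.
(* [e <= 1] keeps translates with centre within [r - 1] inside the ball of radius [r]. With
   [e <= i / 4], translates at distance at most [i / 4] have centres at distance less than [i],
   hence coincide. *)
pose e := Num.min 1 (i / 4).
have e0 : 0 < e by rewrite lt_min ltr01 divr_gt0.
have e1 : e <= 1 by rewrite ge_min lexx.
have ei : e <= i / 4 by rewrite ge_min lexx orbT.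
have [rho0 rho00 Hrho] := hd_near hD Do e0.
pose rho := rho0 / 2; have rho1 : 0 < rho by rewrite divr_gt0.
pose v := (rho / 8) ^+ n / 2 / C ^+ n.
have v0 : 0 < v.
  by rewrite /v !divr_gt0 // exprn_gt0 // divr_gt0.
exists v => // r; rewrite mulrC.
pose G := fset_set [set g | Gamma g /\ hd o (act g o) < r - 1].
have GP g : g \in G -> Gamma g /\ hd o (act g o) < r - 1.
  by rewrite in_fset_set; [move=> /set_mem|exact: (finite_orbit_ball hM)].
apply: (@hausdorff_measure_ge R _ D hd n n0 _ G
  (fun g => act g @` [set y | D y /\ hd o y < e]) (hball o r) (i / 4)).
- by rewrite divr_gt0.
- exact: fset_uniq.
- move=> g /GP[Gg hg] _ [y [Dy oy] <-]; split; first exact: (act_in hM).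
  have := hd_triangle hD Do (act_in hM Gg Do) (act_in hM Gg Dy).
  by rewrite (act_hd hM) //; lra.
- move=> g h _ _ /GP[Gg _] /GP[Gh _] [x [Dx ox] <-] [y [Dy oy] <-] hxy.
  have [k Gk [kg gk]] := group_inv hM Gg.
  have Dgx := act_in hM Gg Dx; have Dhy := act_in hM Gh Dy.
  have Dgo := act_in hM Gg Do; have Dho := act_in hM Gh Do.
  suff E : k \o h = id.
    apply/funext => p; have := congr1 (fun F => g (F p)) E => /= <-.
    by rewrite -[LHS]/((g \o k) (h p)) gk.
  apply: (Hi _ o (group_comp hM Gk Gh) Do).
  rewrite (act_comp hM _ Gh) // -(act_hd hM Gg Do (act_in hM Gk Dho)).
  rewrite (act_invK hM Gk gk Dho).
  have t1 := hd_triangle hD Dgo Dgx Dho; have t2 := hd_triangle hD Dgx Dhy Dho.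
  rewrite (act_hd hM Gg Do Dx) in t1.
  rewrite (act_hd hM Gh Dy Do) (hd_sym hD Dy Do) in t2; lra.
- move=> g U /GP[Gg _] HU cov; have [k Gk [kg gk]] := group_inv hM Gg.
  pose V j := act k @` U j.
  pose s j := C * fine (diam (U j)).
  have fin j : (diam (U j) = (fine (diam (U j)))%:E)%E.
    have [_] := HU j; have := diameter_ge0 (fun x y => (hd x y)%:E) (U j).
    by case: (diameter _ _).
  have fin0 j : 0 <= fine (diam (U j)) by rewrite -lee_fin -fin diameter_ge0.
  have [|||K HK] := @cube_cover_series R n n0 o rho V s rho1.
  + by move=> j; exact: mulr_ge0 (ltW C0) (fin0 j).
  + move=> j _ _ [x Ux <-] [y Uy <-].
    have [UD _] := HU j; have Dx := UD _ Ux; have Dy := UD _ Uy.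
    apply: (le_trans (HC _ _ (act_in hM Gk Dy) (act_in hM Gk Dx))).
    rewrite /s ler_pM2l // (act_hd hM) // -lee_fin -fin.
    exact: (diameter_ub (fun x y => (hd x y)%:E)).
  + move=> x /= hx; have [Dx ox] : D x /\ hd o x < e.
      by apply: Hrho; rewrite /rho in hx; lra.
    have [|j _ Uj] := cov (act g x); first by exists x.
    by exists j => //; exists (act g x) => //; exact: (act_invK hM Gg kg).
  apply: le_trans (nneseries_lim_ge K _); last by move=> *; exact: diameter_expn_ge0.
  rewrite big_mkord; under eq_bigr do rewrite fin -EFin_expe.
  rewrite sumEFin lee_fin /v ler_pdivrMr ?exprn_gt0 // mulr_suml.
  apply: le_trans HK _; apply: ler_sum => j _.
  by rewrite /s exprMn mulrC.
Qed.
End VolumeBounds.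

(** * The geodesic flow on HM *)

Section TangentVectors.
Variables (R : realType) (n : nat) (A : 'M[R]_(1 + n)).
Variables (Omega : set (proj_space R n))
  (Gamma : set (proj_space R n -> proj_space R n)).
Hypothesis hM : compact_strictly_convex_projective_manifold A Omega Gamma.
Notation D := (in_chart A Omega).
Notation hd := (hdist D).
Notation act := (map_in_chart A).
Notation X := (set_type (slit_tangent D)).
Notation HM := (HM A Omega Gamma).
Let hD := manifold_convex_domain hM.
Implicit Types (x y p o xi : 'rV[R]_n) (w v : X) (s t r : R).

Definition foot w : 'rV[R]_n := (val w).1.
Definition dir w : 'rV[R]_n := (val w).2.
Definition ray w t := geo D (foot w) (dir w) t.

Lemma foot_in w : D (foot w).
Proof. by have /set_mem[] := valP w. Qed.

Lemma dir_neq0 w : dir w != 0.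
Proof. by have /set_mem[] := valP w. Qed.

Lemma ray_in w t : D (ray w t).
Proof. by apply: geo_in => //; [exact: foot_in|exact: dir_neq0]. Qed.

Lemma ray0 w : ray w 0 = foot w.
Proof. exact: geo0. Qed.

Lemma ray_hd w s t : hd (ray w s) (ray w t) = `|s - t|.
Proof. by apply: geo_dist => //; [exact: foot_in|exact: dir_neq0]. Qed.

Definition vec x xi (Dx : D x) (xi0 : xi != 0) : X :=
  exist _ (x, xi) (mem_set (conj Dx xi0)).

Lemma ray_vec x xi (Dx : D x) (xi0 : xi != 0) t :
  ray (vec Dx xi0) t = geo D x xi t.
Proof. by []. Qed.

Lemma slit_flowE t w : 0 <= t -> val (slit_flow t w) = (ray w t, dir w).
Proof.
move=> t0; have Dx := foot_in w; have xi0 := dir_neq0 w.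
have [s s0 e] := geo_ray hD Dx xi0 t0.
have Dg := ray_in w t.
rewrite /slit_flow; case: xgetP => [w' _|/(_ (vec Dg xi0))]; last first.
  case; exists s; split; rewrite /= ?mulr_ge0 //; first by rewrite -e.
  by rewrite hdistE geo_dist0.
move=> [u [ve ut hu]]; rewrite ve -/(foot w) -/(dir w) in ut hu *; congr (_, _).
have Du : D (foot w + u *: dir w) by have := foot_in w'; rewrite /foot ve.
rewrite hdistE (ger0_norm t0) /= in hu.
(* For [t = 0] the condition [0 <= u * t] says nothing about the sign of [u]; the vanishing distance
   alone fixes the point. *)
have [t1|t1] := eqVneq t 0.
  rewrite t1 ray0; apply/eqP; apply: contraPT hu => ne; rewrite t1.
  by apply/eqP; rewrite gt_eqF // hd_gt0 // eq_sym.
apply: geo_unique => //; move: ut; rewrite pmulr_lge0 //.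
by rewrite lt_neqAle eq_sym t1.
Qed.

Lemma ray_flow s t w : 0 <= s -> 0 <= t -> ray (slit_flow s w) t = ray w (s + t).
Proof.
move=> s0 t0; rewrite {1}/ray /foot /dir (slit_flowE w s0).
exact: (geo_shift hD (foot_in w) (dir_neq0 w) s0 t0).
Qed.

Lemma foot_flow s w : 0 <= s -> foot (slit_flow s w) = ray w s.
Proof. by move=> s0; rewrite /foot (slit_flowE w s0). Qed.

(** Equivalence of vectors expressed through the points of their geodesics: this hides the
    differential and the positive factor, and composes like the group action. *)
Definition same_ray w w' := exists2 g, Gamma g &
  forall t, 0 <= t -> act g (ray w t) = ray w' t.

Lemma same_ray_refl w : same_ray w w.
Proof. by exists id; [exact: group_id hM|move=> t _; exact: (act_id hM)]. Qed.

Lemma same_ray_sym w w' : same_ray w w' -> same_ray w' w.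
Proof.
move=> [g Gg H]; have [k Gk [kg gk]] := group_inv hM Gg; exists k => // t t0.
by rewrite -H // (act_invK hM Gg kg) //; exact: ray_in.
Qed.

Lemma same_ray_trans w w' w'' : same_ray w w' -> same_ray w' w'' -> same_ray w w''.
Proof.
move=> [g Gg H] [h Gh H']; exists (h \o g); first exact: (group_comp hM Gh Gg).
by move=> t t0; rewrite (act_comp hM _ Gg (ray_in w t)) H // H'.
Qed.

Lemma ray_neq_foot w : ray w 1 != foot w.
Proof.
apply/eqP => e; have := ray_hd w 1 0; rewrite ray0 e hdxx subr0 normr1 => /eqP.
by rewrite eq_sym oner_eq0.
Qed.

Lemma ray1 w : exists2 s, 0 < s & ray w 1 = foot w + s *: dir w.
Proof.
have [s s0 e] := geo_ray hD (foot_in w) (dir_neq0 w) ler01.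
exists s => //; rewrite lt_neqAle s0 andbT; apply: contraNneq (ray_neq_foot w) => se.
by rewrite /ray e -se scale0r addr0.
Qed.

(** From the rays, the vectors are recovered up to a positive factor as the displacement from the
    foot to the point at time 1. *)
Lemma pi_eqP w w' :
  \pi_(HM)%qT w = \pi_(HM)%qT w' <-> same_ray w w'.
Proof.
split=> [/eqquotP /asboolP|[g Gg H]].
  elim=> {w w'}.
  - move=> w w' [g [c [Gg c0 e1 e2]]]; exists g => // t t0.
    have [d0 Hd] := act_ray hM Gg (foot_in w) (dir_neq0 w).
    rewrite /ray Hd // /foot e1 /dir e2 geo_scale //.
    by apply: (act_in hM) => //; exact: foot_in.
  - exact: same_ray_refl.
  - by move=> w w' _; exact: same_ray_sym.
  - by move=> w w' w'' _ h _; exact: same_ray_trans.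
apply/eqquotP/asboolP; apply: Relation_Operators.rst_step.
have Dx := foot_in w; have [d0 Hd] := act_ray hM Gg Dx (dir_neq0 w).
have e0 : foot w' = act g (foot w) by rewrite -!ray0 H.
have [s' s'0 e'] := ray1 w'.
have [s s0 e] := geo_ray hD (act_in hM Gg Dx) d0 ler01.
have E : s *: 'd (act g) (foot w) (dir w) = s' *: dir w'.
  have : ray w' 1 = act g (foot w) + s *: 'd (act g) (foot w) (dir w).
    by rewrite -e -Hd // -H.
  by rewrite e' e0 => /addrI.
have s1 : 0 < s.
  rewrite lt_neqAle s0 andbT; apply/eqP => se; move: E; rewrite -se scale0r.
  move/esym/eqP; rewrite scaler_eq0 (negbTE (dir_neq0 w')) orbF.
  by rewrite gt_eqF.
exists g, (s / s'); split=> //; first exact: divr_gt0.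
by rewrite -/(foot w) -/(dir w) mulrC -scalerA E scalerA mulVf ?gt_eqF // scale1r.
Qed.

Lemma same_ray_flow s w w' : 0 <= s -> same_ray w w' ->
  same_ray (slit_flow s w) (slit_flow s w').
Proof.
move=> s0 [g Gg H]; exists g; first exact: Gg.
move=> t t0; have st := addr_ge0 s0 t0.
exact: (etrans (congr1 (act g) (ray_flow w s0 t0)) (etrans (H _ st) (esym (ray_flow w' s0 t0)))).
Qed.

Lemma pi_flow s w : 0 <= s ->
  geodesic_flow s (\pi_(HM)%qT w) = \pi_(HM)%qT (slit_flow s w).
Proof.
move=> s0; apply/pi_eqP; apply: same_ray_flow => //.
by apply/pi_eqP; rewrite reprK.
Qed.

Lemma act_vec g w : Gamma g -> exists2 w', \pi_(HM)%qT w' = \pi_(HM)%qT w &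
  forall t, 0 <= t -> ray w' t = act g (ray w t).
Proof.
move=> Gg; have [d0 Hd] := act_ray hM Gg (foot_in w) (dir_neq0 w).
exists (vec (act_in hM Gg (foot_in w)) d0).
  apply/pi_eqP/same_ray_sym; exists g => // t t0; exact: Hd.
by move=> t t0; rewrite /ray Hd.
Qed.

(** This representative is determined by the points at the times 0 and 1, so that nearby points give
    nearby vectors. *)
Lemma pi_reparam w : exists2 w', \pi_(HM)%qT w' = \pi_(HM)%qT w &
  val w' = (foot w, ray w 1 - foot w).
Proof.
have ne : ray w 1 - foot w != 0 by rewrite subr_eq0 ray_neq_foot.
exists (vec (foot_in w) ne) => //; apply/pi_eqP; exists id; first exact: group_id hM.
have [s s0 e] := ray1 w.
have eD : ray w 1 - foot w = s *: dir w by rewrite e addrAC subrr add0r.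
move=> t t0; rewrite (act_id hM) ray_vec eD.
exact: (geo_scale hD (foot_in w) (dir_neq0 w) s0 t0).
Qed.

Lemma nbhs_slit w (V : set X) (e : R) : 0 < e ->
  (forall w', `|foot w' - foot w| < e -> `|dir w' - dir w| < e -> V w') -> nbhs w V.
Proof.
move=> e0 H; pose B : set ('rV[R]_n * 'rV[R]_n) :=
  [set u | `|u.1 - foot w| < e /\ `|u.2 - dir w| < e].
have nB : nbhs (val w) B.
  exists (ball (foot w) e, ball (dir w) e).
    by split; apply: nbhsx_ballx.
  by move=> [a b] /= []; rewrite -!ball_normE /= => h1 h2; split; rewrite distrC.
have : nbhs w ((val : X -> _) @^-1` B) by exact: initial_continuous nB.
by apply: filterS => w' [h1 h2]; exact: H.
Qed.

(** Sets of vectors described by points of [D] alone; they tie the topology of HM to the Hilbert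
    distance. *)
Definition tube p (q : 'rV[R]_n) r t : set X :=
  [set w | hd p (foot w) < r /\ hd q (ray w t) < r].

(** The point [y] with the same affine parameter [s] on the ray of [w'] is close to [ray w t] in
    norm. Its Hilbert time differs from [t] by less than [2 * k], so [ray w' t] is within [3 * k] of
    [ray w t]; hence the division by 4. *)
Lemma tube_open p (q : 'rV[R]_n) r t : D p -> D q -> 0 < t -> open (tube p q r t).
Proof.
move=> Dp Dq t0; rewrite openE => w [hp hq].
have Dx := foot_in w; have Dy := ray_in w t.
have [s s0 e] := geo_ray hD Dx (dir_neq0 w) (ltW t0).
pose k := Num.min (r - hd p (foot w)) (r - hd q (ray w t)) / 4.
have k0 : 0 < k by rewrite divr_gt0 // lt_min !subr_gt0 hp.
have k1 : 4 * k <= r - hd p (foot w) by rewrite mulrC divfK // ge_min lexx.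
have k2 : 4 * k <= r - hd q (ray w t) by rewrite mulrC divfK // ge_min lexx orbT.
have [e1 e10 H1] := hd_near hD Dx k0; have [e2 e20 H2] := hd_near hD Dy k0.
pose d := Num.min e1 (e2 / (2 + 2 * s)).
have s2 : 0 < 2 + 2 * s by lra.
have d0 : 0 < d by rewrite lt_min e10 divr_gt0.
have d1 : d <= e1 by rewrite ge_min lexx.
have d2 : d * (2 + 2 * s) <= e2 by rewrite -ler_pdivlMr // ge_min lexx orbT.
apply: (nbhs_slit d0) => w' hx hxi.
have Dx' := foot_in w'; have xi'0 := dir_neq0 w'.
have [_ xx'] := H1 _ (lt_le_trans hx d1).
pose y := foot w' + s *: dir w'.
have [Dy' yy'] : D y /\ hd (ray w t) y < k.
  apply: H2; have -> : y - ray w t = (foot w' - foot w) + s *: (dir w' - dir w).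
    by rewrite /y [ray w t]e scalerBr opprD addrACA.
  apply: (le_lt_trans (ler_normD _ _)); rewrite normrZ (ger0_norm s0).
  have : s * `|dir w' - dir w| <= s * d by rewrite ler_wpM2l // ltW.
  lra.
have yE : y = geo D (foot w') (dir w') (hd (foot w') y).
  by apply: geo_unique => //; exact: hd_ge0.
have hty : hd (ray w' t) y = `|t - hd (foot w') y|.
  by rewrite {1}yE; exact: geo_dist.
have ht : hd (foot w) (ray w t) = t by rewrite -ray0 ray_hd sub0r normrN gtr0_norm.
have a1 := hd_triangle hD Dx' Dx Dy'; have a2 := hd_triangle hD Dx Dy Dy'.
have b1 := hd_triangle hD Dx Dx' Dy; have b2 := hd_triangle hD Dx' Dy' Dy.
rewrite (hd_sym hD Dx' Dx) in a1; rewrite (hd_sym hD Dy' Dy) in b2.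
have hb : `|t - hd (foot w') y| < 2 * k by rewrite ltr_norml; lra.
have Dt := ray_in w' t.
have c1 := hd_triangle hD Dq Dy Dt; have c2 := hd_triangle hD Dy Dy' Dt.
rewrite (hd_sym hD Dy' Dt) in c2.
have c3 := hd_triangle hD Dp Dx Dx'.
split; lra.
Qed.

Lemma tube_act g p (q : 'rV[R]_n) r t w w' : Gamma g -> D p -> D q -> 0 <= t ->
  (forall t, 0 <= t -> act g (ray w t) = ray w' t) ->
  tube p q r t w -> tube (act g p) (act g q) r t w'.
Proof.
move=> Gg Dp Dq t0 H [h1 h2]; rewrite /tube /= -(ray0 w') -!H // !(act_hd hM) //;
  try exact: ray_in.
by rewrite ray0.
Qed.

Lemma pi_tube_open p (q : 'rV[R]_n) r t : D p -> D q -> 0 < t ->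
  open (\pi_(HM)%qT @` tube p q r t : set HM).
Proof.
move=> Dp Dq t0; change (@open X (\pi_(HM)%qT @^-1` (\pi_(HM)%qT @` tube p q r t))).
suff -> : \pi_(HM)%qT @^-1` (\pi_(HM)%qT @` tube p q r t) =
    \bigcup_(g in Gamma) tube (act g p) (act g q) r t.
  by apply: bigcup_open => g Gg; apply: tube_open => //; exact: (act_in hM).
apply/seteqP; split=> w /=.
  move=> [v tv /pi_eqP[g Gg H]]; exists g => //; exact: (tube_act Gg Dp Dq (ltW t0) H).
move=> [g Gg tw]; have [k Gk [kg gk]] := group_inv hM Gg.
have [v pv rv] := act_vec w Gk; exists v => //.
have := tube_act Gk (act_in hM Gg Dp) (act_in hM Gg Dq) (ltW t0) _ tw.
move=> /(_ v) H; have := H (fun t ht => esym (rv t ht)).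
by rewrite !(act_invK hM Gg kg).
Qed.

(** Every class has a representative of norm one based in a fixed compact subset of [D], by
    cocompactness and rescaling. These pairs form a compact set, and open sets of HM pull back to
    traces of open sets of pairs. *)
Lemma hm_finite_cover (I : Type) (f : I -> set HM) : (forall i, open (f i)) ->
  (forall q, exists i, f i q) ->
  exists s : seq I, forall q, exists2 i, List.In i s & f i q.
Proof.
move=> fo fc.
have [b Ob] := domain_nonempty (manifold_domain hM).
have [base _ bE] := domain_sub_chart (manifold_domain hM) Ob.
have Db : D base by rewrite /in_chart /= bE.
have [c c0 Hc] := cocompact hM Db; have [e e0 re] := domain_room hD Db.
have f0 : 0 < e * expR (- (2 * c)) by rewrite mulr_gt0 // expR_gt0.
pose K1 := [set x | room D (e * expR (- (2 * c))) x].
pose K2 := [set xi : 'rV[R]_n | `|xi| = 1].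
have cK2 : compact K2.
  apply: bounded_closed_compact.
    exists 1; split; first exact: num_real.
    by move=> M M1 xi /= ->; exact: ltW.
  apply: (@closed_comp _ _ (fun xi : 'rV[R]_n => `|xi|) [set 1]).
    by move=> xi _; exact: norm_continuous.
  exact: closed_eq.
have cK : compact (K1 `*` K2) by apply: compact_setX => //; exact: room_compact.
have oV i : exists V : set ('rV[R]_n * 'rV[R]_n), open V /\
    (val : X -> _) @^-1` V = \pi_(HM)%qT @^-1` f i.
  by have [V oV e'] := fo i; exists V.
pose V i := projT1 (cid (oV i)).
have VP i : open (V i) /\ (val : X -> _) @^-1` V i = \pi_(HM)%qT @^-1` f i.
  by rewrite /V; case: cid.
have good w : K1 (foot w) -> `|dir w| = 1 -> forall i, V i (val w) -> f i (\pi_(HM)%qT w).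
  move=> _ _ i Vi; have [_ E] := VP i.
  by have : ((val : X -> _) @^-1` V i) w by []; rewrite E.
have [|s Hs] := finite_subcover cK (fun i => (VP i).1).
  move=> [x xi] /= [Kx Kxi].
  have Dx : D x by exact: room_domain f0 Kx.
  have xi0 : xi != 0.
    apply/eqP => z; move: Kxi.
    by rewrite /K2 /= z normr0 => /eqP; rewrite eq_sym oner_eq0.
  have [i fi] := fc (\pi_(HM)%qT (vec Dx xi0)); exists i => //.
  have [_ E] := VP i.
  have : (\pi_(HM)%qT @^-1` f i) (vec Dx xi0) by [].
  by rewrite -E.
exists s => q; pose w := repr q.
have [g Gg hg] := Hc _ (foot_in w).
have [d0 Hd] := act_ray hM Gg (foot_in w) (dir_neq0 w).
pose xi := `|'d (act g) (foot w) (dir w)|^-1 *: 'd (act g) (foot w) (dir w).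
have n0 : 0 < `|'d (act g) (foot w) (dir w)| by rewrite normr_gt0.
have xi0 : xi != 0 by rewrite scaler_eq0 negb_or d0 invr_eq0 gt_eqF.
have Dg := act_in hM Gg (foot_in w).
pose w' := vec Dg xi0.
have pw : \pi_(HM)%qT w' = q.
  rewrite -[q]reprK; apply/pi_eqP/same_ray_sym; exists g => // t t0.
  rewrite /ray Hd // /foot /dir /= -/(foot w) -/(dir w) geo_scale //.
  by rewrite invr_gt0.
have Kw : (K1 `*` K2) (val w').
  split; first exact: (hd_room hD Db re).
  by rewrite /K2 /= normrZ normfV normr_id mulVf // gt_eqF.
have [i si Vi] := Hs _ Kw; exists i => //.
have [_ E] := VP i; rewrite -pw.
by have : ((val : X -> _) @^-1` V i) w' by []; rewrite E.
Qed.
End TangentVectors.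

Lemma size_le_fibers (T : Type) (I : finType) (f : T -> I) (s : seq T) (b : nat) :
  (forall i, (count (fun x => f x == i) s <= b)%N) -> (size s <= #|I| * b)%N.
Proof.
move=> H; have -> : size s = (\sum_(i : I) count (fun x => f x == i) s)%N.
  elim: s {H} => [|x s IH] /=; first by rewrite big1.
  rewrite big_split /= -IH (bigD1 (f x)) //= eqxx big1 ?addn0 //.
  by move=> i /negbTE; rewrite eq_sym => ->.
rewrite -sum_nat_const; exact: leq_sum.
Qed.

(** * Covering numbers *)

Section MetricOnHM.
Variables (R : realType) (n : nat) (A : 'M[R]_(1 + n)).
Variables (Omega : set (proj_space R n))
  (Gamma : set (proj_space R n -> proj_space R n)).
Hypothesis hM : compact_strictly_convex_projective_manifold A Omega Gamma.
Notation D := (in_chart A Omega).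
Notation hd := (hdist D).
Notation act := (map_in_chart A).
Notation X := (set_type (slit_tangent D)).
Notation HM := (HM A Omega Gamma).
Notation phi := (@geodesic_flow R n A Omega Gamma).
Let hD := manifold_convex_domain hM.
Variable d : HM -> HM -> R.
Hypothesis hd_d : metrizes d.
Implicit Types (x y p o xi : 'rV[R]_n) (w v : X) (s t r e : R).

Lemma metric_refl q : d q q = 0.
Proof. by apply/(metric_eq0 hd_d). Qed.

Lemma metric_ball_open q e : open [set q' | d q q' < e].
Proof.
rewrite openE => q' /= h; apply/(metric_nbhs hd_d); exists (e - d q q').
  by rewrite subr_gt0.
move=> q'' /= h'; have := metric_triang hd_d q q' q''; lra.
Qed.

Lemma lebesgue_number (I : Type) (f : I -> set HM) : (forall i, open (f i)) ->
  (forall q, exists i, f i q) ->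
  exists2 e, 0 < e & forall q q', d q q' < e -> exists2 i, f i q & f i q'.
Proof.
move=> fo fc.
have loc q : exists2 e, 0 < e & exists i, forall q', d q q' < 2 * e -> f i q'.
  have [i fi] := fc q.
  have /(metric_nbhs hd_d)[e e0 H] : nbhs q (f i).
    exact: (open_nbhs_nbhs (conj (fo i) fi)).
  exists (e / 2); first exact: divr_gt0.
  by exists i => q' h; apply: H; rewrite /=; lra.
pose e q := sval (cid2 (loc q)).
have e_gt0 q : 0 < e q by rewrite /e; case: cid2.
have eP q : exists i, forall q', d q q' < 2 * e q -> f i q'.
  by rewrite /e; case: cid2.
have [||s Hs] := @hm_finite_cover _ _ _ _ _ hM _ (fun q => [set q' | d q q' < e q]).
- by move=> q; exact: metric_ball_open.
- by move=> q; exists q; rewrite /= metric_refl.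
have [e1 e10 He1] := seq_pos_lower s e_gt0.
exists e1 => // q q' qq'; have [q0 /He1 h1 h2] := Hs q.
have [i Hi] := eP q0; exists i; apply: Hi; first by have := e_gt0 q0; rewrite /= in h2; lra.
by have := metric_triang hd_d q0 q q'; rewrite /= in h2; lra.
Qed.

Lemma tube_self w r t : 0 < r -> tube (foot w) (ray w t) r t w.
Proof. by move=> r0; split; rewrite hdxx. Qed.

(** The covering sets are images of tubes: two classes in the same one have representatives with
    feet near a common point, and the elements linking [w] and [w'] to them give [g]. *)
Lemma footpoints_close r : 0 < r -> exists2 e, 0 < e &
  forall w w', d (\pi_(HM)%qT w) (\pi_(HM)%qT w') < e ->
    exists2 g, Gamma g & hd (foot w) (act g (foot w')) < r.
Proof.
move=> r0; have r2 : 0 < r / 2 by rewrite divr_gt0.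
have [||e e0 He] := @lebesgue_number X
  (fun v => \pi_(HM)%qT @` tube (foot v) (ray v 1) (r / 2) 1).
- by move=> v; apply: (pi_tube_open hM) => //; [exact: foot_in|exact: (ray_in hM)].
- move=> q; exists (repr q), (repr q); last exact: reprK.
  exact: tube_self.
exists e => // w w' /He[v [u [hu _] /(pi_eqP hM)[g Gg Hg]] [u' [hu' _] /(pi_eqP hM)[g' Gg' Hg']]].
have [k Gk [kg gk]] := group_inv hM Gg'.
exists (g \o k); first exact: (group_comp hM).
have Du := foot_in u; have Du' := foot_in u'; have Dw' := foot_in w'.
have Dv := foot_in v.
have fw : foot w = act g (foot u) by have := Hg 0 (lexx 0); rewrite !ray0.
have fw' : foot w' = act g' (foot u') by have := Hg' 0 (lexx 0); rewrite !ray0.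
rewrite (act_comp hM _ Gk Dw') fw' (act_invK hM Gg' kg Du') fw (act_hd hM Gg Du Du').
have := hd_triangle hD Du Dv Du'; rewrite (hd_sym hD Du Dv); lra.
Qed.

Lemma vectors_near e w : 0 < e -> exists2 r, 0 < r & forall w',
  hd (foot w) (foot w') < r -> hd (ray w 1) (ray w' 1) < r ->
  d (\pi_(HM)%qT w) (\pi_(HM)%qT w') < e.
Proof.
move=> e0; have [w0 pw0 vw0] := pi_reparam hM w.
have [V oV VE] : open (\pi_(HM)%qT @^-1` [set q | d (\pi_(HM)%qT w) q < e] : set X).
  exact: (metric_ball_open (\pi_(HM)%qT w) e).
have Vw0 : V (foot w, ray w 1 - foot w).
  rewrite -vw0; have : ((val : X -> _) @^-1` V) w0 by rewrite VE /= pw0 metric_refl.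
  by [].
have : nbhs (foot w, ray w 1 - foot w) V by apply: open_nbhs_nbhs.
move=> [[B1 B2] /= [/nbhs_ballP[e1 /= e10 H1] /nbhs_ballP[e2 /= e20 H2]] HV].
have [C C0 HC] := norm_le_hd hD.
pose k := Num.min e1 (e2 / 2).
have k0 : 0 < k by rewrite lt_min e10 divr_gt0.
have k1 : k <= e1 by rewrite ge_min lexx.
have k2 : k <= e2 / 2 by rewrite ge_min lexx orbT.
exists (k / C); first exact: divr_gt0.
move=> w' h1 h2; have [w1 pw1 vw1] := pi_reparam hM w'; rewrite -pw1.
have n1 : `|foot w' - foot w| < k.
  apply: (le_lt_trans (HC _ _ (foot_in w) (foot_in w'))).
  by rewrite mulrC -ltr_pdivlMr.
have n2 : `|ray w' 1 - ray w 1| < k.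
  apply: (le_lt_trans (HC _ _ (ray_in hM w 1) (ray_in hM w' 1))).
  by rewrite mulrC -ltr_pdivlMr.
have : ((val : X -> _) @^-1` V) w1.
  rewrite /= -/(val w1) vw1; apply: HV; split=> /=.
    by apply: H1; rewrite -ball_normE /= distrC; lra.
  apply: H2; rewrite -ball_normE /=.
  have -> : ray w 1 - foot w - (ray w' 1 - foot w') =
      (foot w' - foot w) - (ray w' 1 - ray w 1).
    by apply/rowP => i; rewrite !mxE; ring.
  by apply: (le_lt_trans (ler_normB _ _)); lra.
by rewrite VE.
Qed.

(** The radius of [vectors_near] depends on [w]. A group element moves [w] and [w'] together next to
    one of finitely many vectors [v], so their least radius works; halving [e] and the radii pays
    for the detour through [v]. *)
Lemma vectors_close e : 0 < e -> exists2 r, 0 < r & forall w w',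
  hd (foot w) (foot w') < r -> hd (ray w 1) (ray w' 1) < r ->
  d (\pi_(HM)%qT w) (\pi_(HM)%qT w') < e.
Proof.
move=> e0; have e2 : 0 < e / 2 by rewrite divr_gt0.
pose r w := sval (cid2 (vectors_near w e2)) / 2.
have r_gt0 w : 0 < r w by rewrite /r; case: cid2 => /= a a0 _; rewrite divr_gt0.
have rP w w' : hd (foot w) (foot w') < 2 * r w -> hd (ray w 1) (ray w' 1) < 2 * r w ->
    d (\pi_(HM)%qT w) (\pi_(HM)%qT w') < e / 2.
  by rewrite /r; case: cid2 => /= a a0 H; rewrite mulrC divfK //; exact: H.
have [||s Hs] := hm_finite_cover hM
  (f := fun v => \pi_(HM)%qT @` tube (foot v) (ray v 1) (r v) 1).
- by move=> v; apply: (pi_tube_open hM) => //; [exact: foot_in|exact: (ray_in hM)].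
- move=> q; exists (repr q), (repr q); last exact: reprK.
  exact: tube_self.
have [r1 r10 Hr1] := seq_pos_lower s r_gt0.
exists r1 => // w w' h1 h2.
have [v /Hr1 rv [u [u1 u2] /(pi_eqP hM) hu]] := Hs (\pi_(HM)%qT w).
have [g Gg Hg] := same_ray_sym hM hu.
have [u' pu' ru'] := act_vec hM w' Gg.
have -> : \pi_(HM)%qT w = \pi_(HM)%qT u by apply/(pi_eqP hM); exact: same_ray_sym.
rewrite -pu'.
have Dw := foot_in w; have Dw' := foot_in w'.
have f1 : foot u = act g (foot w) by have := Hg 0 (lexx 0); rewrite !ray0.
have f2 : foot u' = act g (foot w') by have := ru' 0 (lexx 0); rewrite !ray0.
have d1 : hd (foot u) (foot u') < r1 by rewrite f1 f2 (act_hd hM).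
have d2 : hd (ray u 1) (ray u' 1) < r1.
  rewrite -(Hg 1 ler01) (ru' 1 ler01) (act_hd hM Gg) //; exact: (ray_in hM).
have Dv := foot_in v; have Du := foot_in u; have Du' := foot_in u'.
have Ev := ray_in hM v 1; have Eu := ray_in hM u 1; have Eu' := ray_in hM u' 1.
have t1 := hd_triangle hD Dv Du Du'; have t2 := hd_triangle hD Ev Eu Eu'.
have rv0 := r_gt0 v.
have a1 : d (\pi_(HM)%qT v) (\pi_(HM)%qT u) < e / 2 by apply: rP; lra.
have a2 : d (\pi_(HM)%qT v) (\pi_(HM)%qT u') < e / 2 by apply: rP; lra.
have := metric_triang hd_d (\pi_(HM)%qT u) (\pi_(HM)%qT v) (\pi_(HM)%qT u').
rewrite (metric_symm hd_d (\pi_(HM)%qT u) (\pi_(HM)%qT v)); lra.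
Qed.

Lemma rays_close w w' s t : 0 <= s <= t ->
  hd (ray w s) (ray w' s) <= hd (foot w) (foot w') + hd (ray w t) (ray w' t).
Proof.
by move=> st; apply: (geo_convex hD) => //; first [exact: foot_in|exact: dir_neq0].
Qed.

(** A vector is judged by its points at the times 0 and 1, so control up to time [t] requires the
    rays to be close up to [t + 1]. *)
Lemma flow_close r e t w w' :
  (forall w w', hd (foot w) (foot w') < r -> hd (ray w 1) (ray w' 1) < r ->
    d (\pi_(HM)%qT w) (\pi_(HM)%qT w') < e) ->
  (forall s, 0 <= s <= t + 1 -> hd (ray w s) (ray w' s) < r) ->
  forall s, 0 <= s <= t -> d (phi s (\pi_(HM)%qT w)) (phi s (\pi_(HM)%qT w')) < e.
Proof.
move=> H close s /andP[s0 st].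
have -> := f_equal2 d (pi_flow hM w s0) (pi_flow hM w' s0); apply: H.
  by have -> := f_equal2 hd (foot_flow hM w s0) (foot_flow hM w' s0); apply: close; lra.
have -> := f_equal2 hd (ray_flow hM w s0 ler01) (ray_flow hM w' s0 ler01).
apply: close; lra.
Qed.

(* By convexity of [hd] along geodesics, the vectors whose geodesics join a
   ball about [p] to a ball about [act g p'] stay close during the whole time;
   with [p], [p'] in a finite net, it suffices to count the [g]. *)
Lemma covering_upper o e : D o -> 0 < e -> exists2 m : nat, (0 < m)%N &
  exists2 c, 0 < c & forall t, 0 <= t ->
  (covering_number d phi t e <= (m * orbit_count A Omega Gamma o (t + c))%:R%:E)%E.
Proof.
move=> Do e0; have [r r0 Hr] := vectors_close (e := e / 2) ltac:(lra).
(* Two vectors of one tube are less than [2 * k] apart at both ends, and [rays_close] adds the two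
   bounds. *)
pose k := r / 4; have k0 : 0 < k by rewrite divr_gt0.
have [c c0 Hc] := cocompact hM Do; have [e1 e10 re] := domain_room hD Do.
have f0 : 0 < e1 * expR (- (2 * c)) by rewrite mulr_gt0 // expR_gt0.
pose U p := [set y | D p /\ (D y /\ hd p y < k)].
have oU p : open (U p).
  have [Dp|nDp] := pselect (D p).
    suff -> : U p = [set z | D z /\ hd p z < k] by exact: (open_hd_ball hM).
    by apply/seteqP; split=> z // -[].
  by suff -> : U p = set0 by [exact: open0]; apply/seteqP; split=> z // -[].
have [|P HP] := finite_subcover (room_compact hD f0) oU.
  move=> y Ky; have Dy := room_domain f0 Ky; exists y => //; do 2 split=> //.
  by rewrite hdxx.
have net y : D y -> exists2 g, Gamma g & exists2 p, (p \in P /\ D p) & hd p (act g y) < k.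
  move=> Dy; have [g Gg hg] := Hc y Dy; exists g => //.
  have Kg := hd_room hD Do re (act_in hM Gg Dy) hg.
  have [p pP [Dp [_ h]]] := HP _ Kg; exists p => //; split=> //.
  by elim: (P) pP => //= p' P' IH [->|/IH h']; rewrite inE ?eqxx // h' orbT.
have [b b0 Hb] : exists2 b, 0 <= b & forall p, p \in P -> hd o p <= b.
  elim: (P) => [|p P' [b b0 Hb]]; first by exists 0.
  exists (Num.max b (hd o p)); first by rewrite le_max b0.
  by move=> p'; rewrite inE => /orP[/eqP ->|/Hb h]; rewrite le_max ?lexx ?orbT ?h.
(* The successor makes the factor positive. The path from [o] through [p], the foot, the point at
   time [t + 1] and [act h' p'] to [act h' o] is shorter than [b + k + (t + 1) + k + b]. *)
exists (size P * size P).+1 => //; exists (2 * k + 2 * b + 2); first lra.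
move=> t t0; set cc := 2 * k + 2 * b + 2.
pose G := fset_set [set g | Gamma g /\ hd o (act g o) < t + cc].
have GP g : g \in G <-> Gamma g /\ hd o (act g o) < t + cc.
  rewrite in_fset_set; last exact: (finite_orbit_ball hM).
  by split=> [/set_mem|]; last move=> h; [|exact/mem_set].
pose F (pp : 'rV[R]_n * 'rV[R]_n) (g : proj_space R n -> proj_space R n) : set HM :=
  if pselect (D pp.1 /\ (D pp.2 /\ Gamma g)) is left _ then
    \pi_(HM)%qT @` tube pp.1 (act g pp.2) k (t + 1) else set0.
pose l := [seq F pp g | pp <- [seq (p, p') | p <- P, p' <- P], g <- G].
have sl : (size l <= (size P * size P).+1 * orbit_count A Omega Gamma o (t + cc))%N.
  by rewrite size_allpairs size_allpairs leq_mul2r leqnSn orbT.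
apply: (@le_trans _ _ (size l)%:R%:E); last by rewrite lee_fin ler_nat.
apply: ereal_inf_lbound; exists (size l) => //.
exists (fun i => nth set0 l i); split; last first.
  apply/seteqP; split=> // q _; pose w := repr q.
  have [g Gg [p [pP Dp] hp]] := net _ (foot_in w).
  have [w' pw' rw'] := act_vec hM w Gg.
  have fw' : foot w' = act g (foot w) by have := rw' 0 (lexx 0); rewrite !ray0.
  rewrite -fw' in hp; have Dw' := foot_in w'.
  have Dy := ray_in hM w' (t + 1).
  have [h Gh [p' [p'P Dp'] hp']] := net _ Dy.
  have [h' Gh' [h'h hh']] := group_inv hM Gh.
  have Dhy := act_in hM Gh Dy; have Dh'p := act_in hM Gh' Dp'.
  have Dh'o := act_in hM Gh' Do.
  have e2 : hd (act h' p') (ray w' (t + 1)) < k.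
    by rewrite -(act_hd hM Gh Dh'p Dy) (act_invK hM Gh' hh' Dp').
  have h'G : h' \in G.
    apply/GP; split=> //.
    have a1 := hd_triangle hD Do Dp Dh'o; have a2 := hd_triangle hD Dp Dw' Dh'o.
    have a3 := hd_triangle hD Dw' Dy Dh'o; have a4 := hd_triangle hD Dy Dh'p Dh'o.
    have a5 : hd (foot w') (ray w' (t + 1)) = t + 1.
      rewrite -(ray0 w') (ray_hd hM) sub0r normrN ger0_norm; lra.
    have a6 : hd (act h' p') (act h' o) = hd o p'.
      by rewrite (act_hd hM Gh' Dp' Do) (hd_sym hD Dp' Do).
    have a7 := Hb _ pP; have a8 := Hb _ p'P; rewrite (hd_sym hD Dy Dh'p) in a4.
    rewrite /cc; lra.
  have Fl : F (p, p') h' \in l.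
    by apply/allpairsP; exists ((p, p'), h'); split=> //; apply/allpairsP; exists (p, p').
  have il : (index (F (p, p') h') l < size l)%N by rewrite index_mem.
  exists (Ordinal il) => //=; rewrite nth_index // /F; case: pselect => [_|[]]; last by [].
  by exists w'; [split|rewrite pw' reprK].
move=> i; have : nth set0 l i \in l by apply: mem_nth.
move=> /allpairsP[[pp g] /= [_ _ ->]]; rewrite /F; case: pselect => [[Dp [Dp' Gg]]|_]; last first.
  by rewrite diameter0 lte_fin; split; [exact: open0|].
split.
  apply: (pi_tube_open hM) => //; [exact: (act_in hM)|lra].
apply: (@le_lt_trans _ _ (e / 2)%:E); last by rewrite lte_fin; lra.
apply: diameter_le; first by rewrite lee_fin; lra.
move=> _ _ [w [w1 w2] <-] [w' [w'1 w'2] <-].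
apply: ge_ereal_sup => _ [s + <-]; rewrite /= in_itv /= => /andP[s0 st].
rewrite lee_fin; apply/ltW.
have w3 := ray_in hM w (t + 1); have w'3 := ray_in hM w' (t + 1).
have Dw := foot_in w; have Dw' := foot_in w'.
apply: (flow_close Hr (t := t)) => [u ut|]; last by rewrite s0.
apply: (le_lt_trans (rays_close w w' ut)).
have a1 := hd_triangle hD Dw Dp Dw'; rewrite (hd_sym hD Dw Dp) in a1.
have Dgp := act_in hM Gg Dp'.
have a2 := hd_triangle hD w3 Dgp w'3; rewrite (hd_sym hD w3 Dgp) in a2.
rewrite /k in w1 w2 w'1 w'2; lra.
Qed.

(* At each time some group element brings the second ray near the first; it is
   the identity at time [0], and it cannot change in a short time because
   nontrivial elements have displacement bounded from below. *)
Lemma fellow_travel : exists2 e, 0 < e & forall w w' t, foot w = foot w' ->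
  (forall s, 0 <= s <= t -> d (phi s (\pi_(HM)%qT w)) (phi s (\pi_(HM)%qT w')) < e) ->
  forall s, 0 <= s <= t -> hd (ray w s) (ray w' s) < 1.
Proof.
have [i i0 Hi] := displacement hM.
(* In a time step of length [r], the new element displaces a point of the second ray by less than
   [4 * r]: two moves along the rays and the closeness before and after. [r <= i / 8] keeps this
   below [i]. *)
pose r := Num.min 1 (i / 8).
have r0 : 0 < r by rewrite lt_min ltr01 divr_gt0.
have r1 : r <= 1 by rewrite ge_min lexx.
have ri : r <= i / 8 by rewrite ge_min lexx orbT.
have [e e0 He] := footpoints_close r0; exists e => // w w' t ww' close.
have near s : 0 <= s <= t -> exists2 g, Gamma g & hd (ray w s) (act g (ray w' s)) < r.
  move=> /[dup] /close h /andP[s0 _].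
  have := He (slit_flow s w) (slit_flow s w').
  have <- := f_equal2 d (pi_flow hM w s0) (pi_flow hM w' s0).
  move=> /(_ h) [g Gg hg]; exists g => //.
  by have <- := f_equal2 (fun a b => hd a (act g b)) (foot_flow hM w s0) (foot_flow hM w' s0).
have main (k : nat) s : 0 <= s <= t -> s <= k%:R * r -> hd (ray w s) (ray w' s) < r.
  elim: k s => [|k IH] s st.
    rewrite mul0r => s0; have -> : s = 0 by lra.
    by rewrite !ray0 ww' hdxx.
  rewrite -natr1 mulrDl mul1r => sk.
  have [h|h] := leP s r.
    have [g Gg hg] := near s st.
    have E : g = id.
      apply: (Hi g (ray w' s) Gg (ray_in hM w' s)).
      have Da := ray_in hM w' s; have Db := ray_in hM w s.
      have Dc := foot_in w; have Dd := act_in hM Gg Da.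
      have a1 := hd_triangle hD Da Dc Dd; have a2 := hd_triangle hD Dc Db Dd.
      have b1 : hd (ray w' s) (foot w) = `|s|.
        by rewrite ww' -(ray0 w') (ray_hd hM) subr0.
      have b2 : hd (foot w) (ray w s) = `|s|.
        by rewrite -(ray0 w) (ray_hd hM) sub0r normrN.
      rewrite ger0_norm in b1 b2; lra.
    by move: hg; rewrite E (act_id hM).
  have st' : 0 <= s - r <= t by lra.
  have h' := IH (s - r) st' ltac:(lra).
  have [g Gg hg] := near s st.
  have E : g = id.
    apply: (Hi g (ray w' s) Gg (ray_in hM w' s)).
    have Da := ray_in hM w' s; have Db := ray_in hM w s.
    have Da' := ray_in hM w' (s - r); have Db' := ray_in hM w (s - r).
    have Dd := act_in hM Gg Da.
    have a1 := hd_triangle hD Da Da' Dd; have a2 := hd_triangle hD Da' Db' Dd.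
    have a3 := hd_triangle hD Db' Db Dd.
    have b1 : hd (ray w' s) (ray w' (s - r)) = r.
      by rewrite (ray_hd hM) opprB addrC subrK gtr0_norm.
    have b2 : hd (ray w (s - r)) (ray w s) = r.
      by rewrite (ray_hd hM) addrAC subrr sub0r normrN gtr0_norm.
    rewrite (hd_sym hD Da' Db') in a2; lra.
  by move: hg; rewrite E (act_id hM).
move=> s /[dup] st /andP[s0 _]; apply: (lt_le_trans _ r1).
apply: (main (Num.truncn (s / r)).+1 _ st).
by rewrite -ler_pdivrMr //; apply/ltW/truncnS_gt.
Qed.

(* Send [g] to the vector at [o] that points to [act g o]. Orbit points at
   distances with the same integer part and whose vectors lie in the same
   member of the cover are at distance less than [2]; hence the factor
   [t + 2]. *)
Lemma covering_lower o : (0 < n)%N -> D o -> exists2 e0, 0 < e0 &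
  exists2 b : nat, (0 < b)%N & forall e t, 0 < e <= e0 -> 0 < t ->
  (((orbit_count A Omega Gamma o t)%:R / (b%:R * (t + 2)))%:E <= covering_number d phi t e)%E.
Proof.
move=> n0 Do; have [e0 e00 He0] := fellow_travel; exists e0 => //.
(* It bounds the fibres of the map [f] below: composed with the inverse of one of its members, a
   fibre consists of elements that move [o] by less than 2. *)
exists (orbit_count A Omega Gamma o 2); first exact: (orbit_count_gt0 hM).
move=> e t /andP[e_gt0 ee0] t0; apply: le_ereal_inf_tmp => _ [k /= [U [HU covU]] <-].
rewrite lee_fin ler_pdivrMr; last first.
  by rewrite mulr_gt0 ?ltr0n ?(orbit_count_gt0 hM) //; lra.
pose m := (Num.truncn t).+1.
have mt : m%:R <= t + 2.
  have /andP[h _] := truncn_itv (ltW t0).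
  by rewrite /m -addn1 natrD; lra.
suff : (orbit_count A Omega Gamma o t <= (m * k) * orbit_count A Omega Gamma o 2)%N.
  rewrite -(ler_nat R) !natrM => /le_trans; apply.
  have k0 : 0 <= k%:R :> R by [].
  have c0 : 0 <= (orbit_count A Omega Gamma o 2)%:R :> R by [].
  by rewrite [m%:R * _]mulrC -mulrA ler_wpM2l // mulrC ler_wpM2l.
have finB r := finite_orbit_ball hM r Do.
pose G := fset_set [set g | Gamma g /\ hd o (act g o) < t].
have GP g : g \in G -> Gamma g /\ hd o (act g o) < t.
  by rewrite in_fset_set; [move=> /set_mem|exact: finB].
(* An element that fixes [o] gives no direction, so some nonzero vector is needed as a default;
   [0 < n] provides one. *)
have xi1 : (const_mx 1 : 'rV[R]_n) != 0.
  apply/eqP => /rowP /(_ (Ordinal n0)); rewrite !mxE => /eqP.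
  by rewrite oner_eq0.
have vecs g : exists w, foot w = o /\ (Gamma g -> ray w (hd o (act g o)) = act g o).
  have [Gg|nG] := pselect (Gamma g); last by exists (vec Do xi1); split.
  have [e1|ne] := eqVneq o (act g o).
    exists (vec Do xi1); split=> // _; rewrite -e1 hdxx; exact: geo0.
  have Dg := act_in hM Gg Do.
  have ne' : act g o - o != 0 by rewrite subr_eq0 eq_sym.
  exists (vec Do ne'); split=> // _; exact: (geo_through hD Do Dg ne).
pose W g := sval (cid (vecs g)).
have WP g : foot (W g) = o /\ (Gamma g -> ray (W g) (hd o (act g o)) = act g o).
  by rewrite /W; case: cid.
have cov q : exists i, U i q.
  by have : [set: HM] q by []; rewrite -covU => -[i _ Ui]; exists i.
pose J q := sval (cid (cov q)).
have JP q : U (J q) q by rewrite /J; case: cid.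
pose f g : 'I_m * 'I_k := (inord (Num.truncn (hd o (act g o))), J (\pi_(HM)%qT (W g))).
have -> : (m * k = #|{: 'I_m * 'I_k}|)%N by rewrite card_prod !card_ord.
apply: (@size_le_fibers _ _ f) => i.
have fiber g h : g \in G -> h \in G -> f g = f h -> hd (act g o) (act h o) < 2.
  move=> /GP[Gg hg] /GP[Gh hh] [e1 e2].
  have [Wg Rg] := WP g; have [Wh Rh] := WP h.
  have close s : 0 <= s <= t ->
      d (phi s (\pi_(HM)%qT (W g))) (phi s (\pi_(HM)%qT (W h))) < e0.
    move=> st; rewrite -lte_fin.
    have [_ diamU] := HU (J (\pi_(HM)%qT (W g))).
    apply: (@le_lt_trans _ _ (dynamical_dist d phi t (\pi_(HM)%qT (W g)) (\pi_(HM)%qT (W h)))).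
      by apply: ereal_sup_ubound; exists s; rewrite //= in_itv.
    apply: (@le_lt_trans _ _ (diameter (dynamical_dist d phi t) (U (J (\pi_(HM)%qT (W g)))))).
      by apply: diameter_ub; [exact: JP|rewrite e2; exact: JP].
    by apply: (lt_le_trans diamU); rewrite lee_fin.
  have l0 := hd_ge0 hD Do (act_in hM Gg Do).
  have l0' := hd_ge0 hD Do (act_in hM Gh Do).
  have lt : 0 <= hd o (act g o) <= t by rewrite l0 ltW.
  have := He0 _ _ _ (etrans Wg (esym Wh)) close _ lt; rewrite Rg // => h1.
  have h2 := ray_hd hM (W h) (hd o (act g o)) (hd o (act h o)); rewrite Rh // in h2.
  have := hd_triangle hD (act_in hM Gg Do) (ray_in hM (W h) (hd o (act g o))) (act_in hM Gh Do).
  (* One unit comes from fellow travelling at time [hd o (act g o)], the other from the equal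
     integer parts of the distances. *)
  rewrite h2; suff : `|hd o (act g o) - hd o (act h o)| < 1 by lra.
  have bnd u : 0 <= u -> u < t -> (Num.truncn u < m)%N.
    move=> u0 ut; rewrite ltnS truncn_ge_nat ?(ltW t0) //.
    by have /andP[] := truncn_itv u0; lra.
  have : Num.truncn (hd o (act g o)) = Num.truncn (hd o (act h o)).
    by move: e1 => /(congr1 (fun j : 'I_m => (j : nat))); rewrite !inordK // ltnS; exact: bnd.
  have /andP[a1 a2] := truncn_itv l0; have /andP[b1 b2] := truncn_itv l0'.
  move=> E; rewrite E -natr1 in a1 a2; rewrite -natr1 in b2.
  by rewrite ltr_norml; apply/andP; split; lra.
rewrite -size_filter.
case E : [seq g <- G | f g == i] => [//|g0 s']; rewrite -E.
have : g0 \in [seq g <- G | f g == i] by rewrite E mem_head.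
rewrite mem_filter => /andP[/eqP fg0 Gg0]; have [Ga ha] := GP _ Gg0.
have [k0 Gk [kg gk]] := group_inv hM Ga.
rewrite -(size_map (fun g => k0 \o g)); apply: uniq_leq_size.
  rewrite map_inj_uniq; first by rewrite filter_uniq // fset_uniq.
  move=> g h /(congr1 (fun F => g0 \o F)) E'.
  have K u : g0 \o (k0 \o u) = u.
    by apply/funext => p; rewrite /= -[LHS]/((g0 \o k0) (u p)) gk.
  by rewrite !K in E'.
move=> _ /mapP[g + ->]; rewrite mem_filter => /andP[/eqP fg Gg]; have [Gg' hg] := GP _ Gg.
rewrite in_fset_set; last exact: finB.
apply/mem_set; split; first exact: (group_comp hM).
have Dg := act_in hM Gg' Do; have Dg0 := act_in hM Ga Do.
rewrite (act_comp hM _ Gg' Do).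
have := fiber g0 g Gg0 Gg (etrans fg0 (esym fg)).
by rewrite -{1}(act_hd hM Gk Dg0 Dg) (act_invK hM Ga kg Do).
Qed.
End MetricOnHM.

(** * From counting bounds to entropies *)

Lemma lne_growth_cvg (R : realType) (F : R -> \bar R) (a b : R -> R) (L r0 : R) :
  linear_growth (fun r => ln (a r)) L -> linear_growth (fun r => ln (b r)) L ->
  (forall r, r0 <= r -> 0 < a r /\ ((a r)%:E <= F r <= (b r)%:E)%E) ->
  (r^-1%:E * lne (F r))%E @[r --> +oo] --> L%:E.
Proof.
move=> Ha Hb H.
have fin r : r0 <= r -> exists2 u, a r <= u <= b r & F r = u%:E.
  move=> /H[_]; case: (F r) => [u| |] /andP[] //.
  by rewrite !lee_fin => *; exists u => //; apply/andP.
have Hg : linear_growth (fun r => ln (fine (F r))) L.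
  apply: (linear_growth_squeeze (r1 := r0) Ha Hb) => r rr; have [a0 _] := H r rr.
  have [u /andP[au ub] ->] := fin r rr; rewrite /=.
  by rewrite !ler_ln ?posrE ?au //; lra.
apply: cvg_EFin; last first.
  apply: cvg_trans (linear_growth_cvg Hg); apply: near_eq_cvg.
  near=> r; have rr : r0 <= r by near: r; apply: nbhs_pinfty_ge; exact: num_real.
  have [a0 _] := H r rr; have [u /andP[au ub] E] := fin r rr.
  by rewrite /= E lne_EFin //; lra.
near=> r; have rr : r0 <= r by near: r; apply: nbhs_pinfty_ge; exact: num_real.
have [a0 _] := H r rr; have [u /andP[au ub] E] := fin r rr.
rewrite /= E lne_EFin //; lra.
Unshelve. all: by end_near.
Qed.

Lemma cvg_limf_esup (R : realType) (T : choiceType) (X : filteredType T)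
    (F : set_system X) (f : X -> \bar R) (L : R) :
  ProperFilter F -> f @ F --> L%:E -> limf_esup f F = L%:E.
Proof.
move=> PF cf; rewrite limf_esupE; apply/eqP; rewrite eq_le; apply/andP; split.
  apply/lee_addgt0Pr => e e0.
  have FV : F (f @^-1` [set u | (u < (L + e)%:E)%E]).
    apply: cf; apply: open_nbhs_nbhs; split; first exact: open_ereal_lt_ereal.
    by rewrite /= lte_fin ltrDl.
  apply: (@le_trans _ _ (ereal_sup (f @` (f @^-1` [set u | (u < (L + e)%:E)%E])))).
    by apply: ereal_inf_lbound; exists (f @^-1` [set u | (u < (L + e)%:E)%E]).
  by apply: ge_ereal_sup => _ [x /= fx <-]; exact: ltW.
apply: le_ereal_inf_tmp => _ [V FV <-].
rewrite -(cvg_lim _ cf) //; apply: lime_le; first by apply/cvg_ex; exists L%:E.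
by apply: filterS FV => x Vx; apply: ereal_sup_ubound; exists x.
Qed.

Section Entropies.
Variables (R : realType) (n : nat) (A : 'M[R]_(1 + n)).
Variables (Omega : set (proj_space R n))
  (Gamma : set (proj_space R n -> proj_space R n)).
Hypothesis hM : compact_strictly_convex_projective_manifold A Omega Gamma.
Hypothesis n0 : (0 < n)%N.
Variables (x : 'rV[R]_n) (L : R).
Notation D := (in_chart A Omega).
Notation N := (orbit_count A Omega Gamma x).
Hypothesis Dx : D x.
Hypothesis HL : linear_growth (fun r => ln (N r)%:R) L.

Lemma volume_growth_cvg : volume_growth D x r @[r --> +oo] --> L%:E.
Proof.
have [c c0 [C C0 HC]] := volume_upper hM n0 Dx.
have [v v0 Hv] := volume_lower hM n0 Dx.
rewrite /volume_growth /hilbert_ball hdistE.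
have N0 (r : R) : 0 < r -> 0 < (N r)%:R :> R.
  by move=> r0; rewrite ltr0n (orbit_count_gt0 hM).
have lnNM (u k r : R) : 0 < u -> 2 - k <= r -> ln (N (r + k))%:R + ln u = ln (u * (N (r + k))%:R).
  by move=> u0 kr; rewrite lnM ?posrE // 1?addrC //; apply: N0; lra.
have E (u k : R) : 0 < u -> linear_growth (fun r => ln (u * (N (r + k))%:R)) L.
  move=> u0; have G := linear_growth_shift k (ln u) HL.
  by apply: (linear_growth_squeeze (r1 := 2 - k) G G) => r kr; rewrite lnNM // lexx.
(* The shift [-1] is that of [volume_lower]; for [r >= 2] the count [N (r - 1)] includes the
   identity and is positive. *)
apply: (lne_growth_cvg (r0 := 2) (E _ (-1) v0) (E _ c C0)) => r r2; split.
  by rewrite mulr_gt0 // N0 //; lra.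
by apply/andP; split; [exact: Hv|exact: HC].
Qed.

(** The constants of [covering_upper] depend on [e], but not its exponential rate. So for every
    [e <= e0] the upper limit in time is already [L], and the limit in [e] is that of an eventually
    constant function. *)
Lemma topological_entropy_limit (d : HM A Omega Gamma -> HM A Omega Gamma -> R) :
  metrizes d -> topological_entropy d (@geodesic_flow R n A Omega Gamma) = L%:E.
Proof.
move=> hd_d; have [e0 e00 [b b0 Hb]] := covering_lower hM hd_d n0 Dx.
rewrite /topological_entropy; apply: cvg_lim => //; apply: cvg_near_cst.
near=> e.
have e_gt0 : 0 < e by near: e; exact: nbhs_right_gt.
have e_le : e <= e0 by near: e; exact: nbhs_right_le.
apply: cvg_limf_esup.
have [m m0 [c c0 Hm]] := covering_upper hM hd_d Dx e_gt0.
have N0 (r : R) : 0 < r -> 0 < (N r)%:R :> R.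
  by move=> r0; rewrite ltr0n (orbit_count_gt0 hM).
have mR : 0 < m%:R :> R by rewrite ltr0n.
have bR : 0 < b%:R :> R by rewrite ltr0n.
have G1 : linear_growth (fun r => ln ((N r)%:R / (b%:R * (r + 2)))) L.
  have G := linear_growthD (linear_growth_shift 0 (- ln b%:R) HL) (@linear_growth_ln R).
  apply: (linear_growth_squeeze (r1 := 1) G G) => r r1.
  have r2 : 0 < r + 2 by lra.
  rewrite ln_div ?posrE ?mulr_gt0 ?N0 //; last lra.
  by rewrite (lnM (x := b%:R)) ?posrE // addr0; apply/andP; split; lra.
have G2 : linear_growth (fun r => ln (m * N (r + c))%:R) L.
  have G := linear_growth_shift c (ln m%:R) HL.
  apply: (linear_growth_squeeze (r1 := 1) G G) => r r1.
  rewrite natrM lnM ?posrE ?N0 //; first by rewrite addrC lexx.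
  lra.
apply: (lne_growth_cvg (r0 := 1) G1 G2) => r r1; split.
  rewrite divr_gt0 ?mulr_gt0 ?N0 //; lra.
apply/andP; split; [apply: Hb; rewrite ?e_gt0 //|apply: Hm]; lra.
Unshelve. all: by end_near.
Qed.

End Entropies.

Theorem proposition8p2 (R : realType) (n : nat) (A : 'M[R]_(1 + n))
    (Omega : set (proj_space R n))
    (Gamma : set (proj_space R n -> proj_space R n))
    (d : HM A Omega Gamma -> HM A Omega Gamma -> R) (x : 'rV[R]_n) :
  (2 <= n)%N ->
  compact_strictly_convex_projective_manifold A Omega Gamma ->
  metrizes d ->
  in_chart A Omega x ->
  cvg (volume_growth (in_chart A Omega) x r @[r --> +oo]) /\
  topological_entropy d (@geodesic_flow R n A Omega Gamma) =
    volume_entropy (in_chart A Omega) x.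
Proof.
move=> n2 hM hd_d Dx; have n0 : (0 < n)%N by exact: ltnW.
have [L HL] := orbit_count_growth hM Dx.
have V := volume_growth_cvg hM n0 Dx HL.
split; first by apply/cvg_ex; exists L%:E.
by rewrite (topological_entropy_limit hM n0 Dx HL hd_d); apply/esym/cvg_lim.
Qed.
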